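(* It holds $$\Lambda^{(w)}_{hp}=\Big\{\sum_{i=1}^N\mu_i\,\varphi_i:\ \mu_i\in\mathbb{S}_{d,0}\text{ and }|\mu_i|_F\le\sigma_i\text{ for all } i=1,\dots,N\Big\}.$$ Furthermore, let $\lambda_{hp}\in\Lambda^{(w)}_{hp}$ and $p_{hp}\in Q_{hp}$ be represented as $\lambda_{hp}=\sum_{i=1}^N\lambda_i\,\varphi_i$ and $p_{hp}=\sum_{i=1}^Np_i\,\phi_i$ with $\lambda_i,p_i\in\mathbb{S}_{d,0}$. Then $$(\mu_{hp}-\lambda_{hp},p_{hp})_{0,\Omega}\le0\qquad\forall\mu_{hp}\in\Lambda^{(w)}_{hp}$$ if and only if $$\lambda_i:p_i=\sigma_i\,|p_i|_F\qquad\forall i\in\{1,\dots,N\}.$$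
   Context: Let $d\in\{2,3\}$ and $\Omega\subset\mathbb{R}^d$ a bounded Lipschitz domain. $\mathbb{S}_{d,0}$ is the space of symmetric real $d\times d$ matrices with vanishing trace, $:$ the Frobenius inner product, $|\cdot|_F$ the Frobenius norm, $Q:=L^2(\Omega,\mathbb{S}_{d,0})$, $(\cdot,\cdot)_{0,\Omega}$ the $L^2(\Omega)$ inner product (for scalar or matrix-valued functions). $\sigma_y>0$ is a constant. $\mathcal{T}_h$ is a locally quasi-uniform finite element mesh of $\Omega$ of convex, shape regular quadrilaterals ($d=2$) or hexahedrons ($d=3$); $\widehat T=[-1,1]^d$; $F_T:\widehat T\to T$ is the bi-/tri-linear bijective element mapping; $p_T\in\mathbb{N}$, $p_T\ge1$, is the polynomial degree of $T$ (degrees of neighboring elements being comparable). $\mathbb{P}_r(\widehat T)$ is the space of polynomials on $\widehat T$ of degree at most $r$ in each variable. $$Q_{hp}:=\{q\in Q: q|_T\circ F_T\in(\mathbb{P}_{p_T-1}(\widehat T))^{d\times d}\ \forall T\in\mathcal{T}_h\}.$$ For $T\in\mathcal{T}_h$, $\hat x_{k,T}$, $k=1,\dots,n_T:=p_T^d$, are the tensor product Gauss quadrature points on $\widehat T$ ($p_T$ per direction) with positive weights $\hat\omega_{k,T}$, and $$\psi_{hp}(q_{hp}):=\sum_{T\in\mathcal{T}_h}\mathcal{Q}_{hp,T}(\sigma_y|q_{hp}|_F),\qquad \mathcal{Q}_{hp,T}(\varphi):=\begin{cases}|T|\,\varphi(F_T(0)),&p_T=1,\\ \sum_{k=1}^{n_T}\hat\omega_{k,T}\,|\det\nabla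 F_T(\hat x_{k,T})|\,\varphi(F_T(\hat x_{k,T})),&p_T\ge2,\end{cases}$$ $$\Lambda^{(w)}_{hp}:=\{\mu_{hp}\in Q_{hp}: (\mu_{hp},q_{hp})_{0,\Omega}\le\psi_{hp}(q_{hp})\ \forall q_{hp}\in Q_{hp}\}.$$ Bases. Let $\widehat\phi_{k,T}\in\mathbb{P}_{p_T-1}(\widehat T)$ be the Lagrange basis for the Gauss points: $\widehat\phi_{k,T}(\hat x_{l,T})=\delta_{kl}$, $k,l=1,\dots,n_T$. With $N:=\sum_{T}n_T$ and a one-to-one numbering $\zeta:\{(k,T):T\in\mathcal{T}_h,\,1\le k\le n_T\}\to\{1,\dots,N\}$, define $\phi_{\zeta(k,T)}:=\widehat\phi_{k,T}\circ F_T^{-1}$ on $T$ and $\phi_{\zeta(k,T)}:=0$ on all other elements. The biorthogonal functions $\varphi_1,\dots,\varphi_N$ are uniquely determined by $\varphi_j|_T\circ F_T\in\mathbb{P}_{p_T-1}(\widehat T)$ for all $T\in\mathcal{T}_h$ and $(\phi_i,\varphi_j)_{0,\Omega}=\delta_{ij}\,(\phi_i,1)_{0,\Omega}$ for all $i,j$. One has $Q_{hp}=\{\sum_iq_i\phi_i: q_i\in\mathbb{S}_{d,0}\}=\{\sum_i\mu_i\varphi_i:\mu_i\in\mathbb{S}_{d,0}\}$. Finally $D_i:=(\phi_i,1)_{0,\Omega}$ and $\sigma_i:=D_i^{-1}(\sigma_y,\phi_i)_{0,\Omega}$. *)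

(* Defs.v *)
From HB Require Import structures.
From mathcomp Require Import all_boot all_order all_algebra.
From mathcomp Require Import all_classical all_reals all_analysis.
Set Implicit Arguments.
Unset Strict Implicit.
Unset Printing Implicit Defensive.
Import Order.TTheory GRing.Theory Num.Theory.
Import numFieldNormedType.Exports.
Local Open Scope classical_set_scope.
Local Open Scope ring_scope.

(* The sigma-algebra on R^n is generated by the coordinate maps; it is the
   Borel sigma-algebra. *)
Section measurable_rV.
Variables (R : realType) (n : nat).

Let coords : 'I_n -> 'rV[R]_n -> R := fun i x => x 0 i.

Let rV_set0 : g_sigma_preimage coords set0.
Proof. exact: sigma_algebra0. Qed.

Let rV_setC A : g_sigma_preimage coords A -> g_sigma_preimage coords (~` A).
Proof. exact: sigma_algebraC. Qed.

Let rV_bigcup (F : _^nat) : (forall i, g_sigma_preimage coords (F i)) ->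
  g_sigma_preimage coords (\bigcup_i (F i)).
Proof. exact: sigma_algebra_bigcup. Qed.

HB.instance Definition _ := @isMeasurable.Build
  (measure_tuple_display default_measure_display)
  'rV[R]_n (g_sigma_preimage coords) rV_set0 rV_setC rV_bigcup.

Lemma measurable_coord (i : 'I_n) :
  measurable_fun [set: 'rV[R]_n] (fun x : 'rV[R]_n => x 0 i).
Proof.
move=> _ Y mY; rewrite setTI; apply: sub_sigma_algebra => /=.
rewrite -bigcup_seq/=; exists i => /=; first by rewrite mem_index_enum.
by exists Y => //; rewrite setTI.
Qed.

Lemma measurable_fun_rVP d1 (T1 : measurableType d1) (f : T1 -> 'rV[R]_n) :
  (forall i, measurable_fun [set: T1] (fun t => f t 0 i)) ->
  measurable_fun [set: T1] f.
Proof.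
move=> mf; suff : g_sigma_preimage (fun i t => f t 0 i) `<=` measurable.
  move=> prefS _ A mA; apply: prefS.
  by rewrite (_ : (fun i t => f t 0 i) = fun i => coords i \o f)//
    g_sigma_preimage_comp; exists A.
apply: smallest_sub; first exact: sigma_algebra_measurable.
by rewrite -bigcup_seq; apply: bigcup_sub => i _ A [B mB <-]; exact: mf.
Qed.

End measurable_rV.

Definition rV_cons (R : realType) n (z : R * 'rV[R]_n) : 'rV[R]_n.+1 :=
  \row_i if unlift ord0 i is Some j then z.2 0 j else z.1.

Lemma measurable_rV_cons (R : realType) n :
  measurable_fun [set: R * 'rV[R]_n] (@rV_cons R n).
Proof.
apply: measurable_fun_rVP => i; case: (unliftP ord0 i) => [j ->|->].
  rewrite (_ : (fun _ => _) = (fun x : 'rV[R]_n => x 0 j) \o snd).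
    by apply: measurableT_comp => //; exact: measurable_coord.
  by apply/funext => z; rewrite /= mxE liftK.
rewrite (_ : (fun _ => _) = fst) //.
by apply/funext => z; rewrite mxE unlift_none.
Qed.

(* Lebesgue measure on R^n, as the iterated product of the one-dimensional one. *)
Section lebesgue_rV_step.
Local Open Scope ereal_scope.
Variables (R : realType) (n : nat).
Variable m : {sigma_finite_measure set 'rV[R]_n -> \bar R}.

Definition lebesgue_rV_step : set 'rV[R]_n.+1 -> \bar R :=
  pushforward ((@lebesgue_measure R) \x m) (@rV_cons R n).

Let mrc := @measurable_rV_cons R n.

Let step0 : lebesgue_rV_step set0 = 0.
Proof. by rewrite /lebesgue_rV_step /pushforward preimage_set0 measure0. Qed.

Let step_ge0 A : 0 <= lebesgue_rV_step A.
Proof. exact: measure_ge0. Qed.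

Let step_sigma_additive : semi_sigma_additive lebesgue_rV_step.
Proof.
move=> F mF tF mUF; rewrite /lebesgue_rV_step /pushforward preimage_bigcup.
apply: measure_semi_sigma_additive.
- by move=> k; rewrite -[X in measurable X]setTI; exact: mrc.
- apply/trivIsetP => /= i j _ _ ij; rewrite -preimage_setI.
  by move/trivIsetP : tF => /(_ _ _ _ _ ij) ->//; rewrite preimage_set0.
- by rewrite -preimage_bigcup -[X in measurable X]setTI; exact: mrc.
Qed.

HB.instance Definition _ := isMeasure.Build _ _ _
  lebesgue_rV_step step0 step_ge0 step_sigma_additive.

Let step_sigma_finite : sigma_finite [set: 'rV[R]_n.+1] lebesgue_rV_step.
Proof.
have /sigma_finiteP[F [TF ndF Foo]] :=
  sigma_finiteT (@lebesgue_measure R).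
have /sigma_finiteP[G [TG ndG Goo]] := sigma_finiteT m.
pose tl (x : 'rV[R]_n.+1) : 'rV[R]_n := (\row_j x 0 (lift ord0 j))%R.
have mtl : measurable_fun setT tl.
  apply: measurable_fun_rVP => j.
  rewrite (_ : (fun _ => _) = fun x : 'rV[R]_n.+1 => x 0%R (lift ord0 j)).
    exact: measurable_coord.
  by apply/funext => x; rewrite mxE.
pose hd (x : 'rV[R]_n.+1) := x 0%R ord0.
have mhd : measurable_fun setT hd by exact: measurable_coord.
exists (fun k => hd @^-1` F k `&` tl @^-1` G k).
  apply/esym/seteqP; split => // x _.
  have [k _ Fk] : (\bigcup_i F i) (hd x) by rewrite -TF.
  have [l _ Gl] : (\bigcup_i G i) (tl x) by rewrite -TG.
  exists (maxn k l) => //; split.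
  - by have /subsetPset := ndF _ _ (leq_maxl k l); exact.
  - by have /subsetPset := ndG _ _ (leq_maxr k l); exact.
move=> k; have [mF Fk] := Foo k; have [mG Gk] := Goo k; split.
  by apply: measurableI; rewrite -[X in measurable X]setTI;
    [exact: mhd|exact: mtl].
rewrite /lebesgue_rV_step /pushforward (_ : _ @^-1` _ = F k `*` G k).
  by rewrite product_measure1E// lte_mul_pinfty// ge0_fin_numE.
have hdE z : hd (@rV_cons R n z) = z.1 by rewrite /hd mxE unlift_none.
have tlE z : tl (@rV_cons R n z) = z.2.
  by apply/rowP => j; rewrite !mxE liftK.
by apply/seteqP; split => z /=; rewrite hdE tlE.
Qed.

HB.instance Definition _ := Measure_isSigmaFinite.Build _ _ _
  lebesgue_rV_step step_sigma_finite.

End lebesgue_rV_step.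

Fixpoint lebesgue_rV (R : realType) (n : nat) :
    {sigma_finite_measure set 'rV[R]_n -> \bar R} :=
  match n with
  | 0 => [the {sigma_finite_measure set _ -> \bar R} of \d_(0 : 'rV[R]_0)]
  | n'.+1 => [the {sigma_finite_measure set _ -> \bar R} of
               lebesgue_rV_step (lebesgue_rV R n')]
  end.

Lemma lebesgue_rV_box (R : realType) n (a b : 'rV[R]_n) :
  (forall i, a 0 i <= b 0 i) ->
  lebesgue_rV R n [set x | forall i, a 0 i <= x 0 i <= b 0 i] =
  (\prod_i (b 0 i - a 0 i))%:E.
Proof.
elim: n a b => [|n IH] a b ab.
  rewrite big_ord0 /= diracE mem_set// => -[]//.
pose tl (x : 'rV[R]_n.+1) : 'rV[R]_n := \row_j x 0 (lift ord0 j).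
have mbox (c e : 'rV[R]_n) :
    measurable [set x : 'rV[R]_n | forall i, c 0 i <= x 0 i <= e 0 i].
  rewrite (_ : [set _ | _] = \big[setI/setT]_(i < n)
      ((fun x : 'rV[R]_n => x 0 i) @^-1` `[c 0 i, e 0 i])).
    apply: bigsetI_measurable => i _; rewrite -[X in measurable X]setTI.
    by apply: measurable_coord => //.
  apply/seteqP; split => x /=.
    by move=> h; rewrite -bigcap_seq => i _ /=; rewrite in_itv/=.
  by rewrite -bigcap_seq => h i; have /= := h i (mem_index_enum i); rewrite in_itv.
rewrite /= /lebesgue_rV_step /pushforward.
pose B : set (R * 'rV[R]_n) := [set` `[a 0 ord0, b 0 ord0] ] `*`
   [set x : 'rV[R]_n | forall i, tl a 0 i <= x 0 i <= tl b 0 i].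
transitivity (product_measure1 (@lebesgue_measure R) (lebesgue_rV R n) B).
  congr (product_measure1 _ _ _); rewrite /B.
  apply/seteqP; split => -[t x] /=.
    move=> h; split; first by have := h ord0; rewrite mxE unlift_none in_itv.
    by move=> i; have := h (lift ord0 i); rewrite !mxE liftK.
  rewrite in_itv/= => -[h0 h] i; case: (unliftP ord0 i) => [j ->|->].
    by have := h j; rewrite !mxE liftK.
  by rewrite mxE unlift_none.
have mB := mbox (tl a) (tl b).
rewrite /B product_measure1E//= IH; last by move=> i; rewrite !mxE.
rewrite lebesgue_measure_itv/= big_ord_recl lte_fin EFinM.
congr (_ * _)%E.
  have := ab ord0; rewrite le_eqVlt => /predU1P[->|->]; last by rewrite EFinB.
  by rewrite ltxx subrr.
by congr EFin; apply: eq_bigr => i _; rewrite !mxE.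
Qed.

Section frobenius.
Variable R : realType.

(* For row vectors these are the Euclidean inner product and norm. *)
Definition frob m n (A B : 'M[R]_(m, n)) : R := \sum_i \sum_j A i j * B i j.
Definition frobn m n (A : 'M[R]_(m, n)) : R := Num.sqrt (frob A A).

Definition sym0 d (A : 'M[R]_d) : Prop := A^T = A /\ \tr A = 0.

End frobenius.

Section L2.
Variables (R : realType) (d : nat).
Notation leb := (lebesgue_rV R d).
Variable Omega : set 'rV[R]_d.

(* Elements of L^2 are represented by functions defined on R^d; only their
   values at almost every point of Omega matter. *)
Definition L2 (f : 'rV[R]_d -> R) : Prop :=
  measurable_fun Omega f /\ leb.-integrable Omega (fun x => (f x ^+ 2)%:E).

Definition Q_space (q : 'rV[R]_d -> 'M[R]_d) : Prop :=
  (forall i j, L2 (fun x => q x i j)) /\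
  {ae leb, forall x, Omega x -> sym0 (q x)}.

Definition inner (f g : 'rV[R]_d -> R) : R :=
  \int[leb]_(x in Omega) (f x * g x).

Definition inner_mx (A B : 'rV[R]_d -> 'M[R]_d) : R :=
  \int[leb]_(x in Omega) frob (A x) (B x).

End L2.

Section lipschitz_domain.
Variables (R : realType) (d : nat).

(* Near each boundary point x0, in the orthogonal splitting of R^d into the
   hyperplane normal to a unit vector e and the line spanned by e, Omega is the
   strict epigraph of a Lipschitz function g on that hyperplane. *)
Definition lipschitz_boundary (Omega : set 'rV[R]_d) : Prop :=
  forall x0, (closure Omega `\` interior Omega) x0 ->
  exists (e : 'rV[R]_d) (g : 'rV[R]_d -> R) (r L : R),
    [/\ frobn e = 1, 0 < r,
        forall y z, frob y e = 0 -> frob z e = 0 ->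
          `|g y - g z| <= L * frobn (y - z) &
        forall y, frobn (y - x0) < r ->
          (Omega y <-> g (y - frob y e *: e) < frob y e)].

Definition bounded_lipschitz_domain (Omega : set 'rV[R]_d) : Prop :=
  [/\ Omega !=set0, open Omega, connected Omega, bounded_set Omega &
      lipschitz_boundary Omega].

End lipschitz_domain.

Section reference_element.
Variables (R : realType) (d : nat).

Definition That : set 'rV[R]_d := [set x | forall i, -1 <= x 0 i <= 1].

(* Polynomials of degree at most r in each variable, as functions. *)
Definition Ppoly (r : nat) (f : 'rV[R]_d -> R) : Prop :=
  exists c : {ffun 'I_d -> 'I_r.+1} -> R,
    forall x, f x = \sum_a c a * \prod_i x 0 i ^+ a i.

Definition Ppoly_mx (r : nat) (P : 'rV[R]_d -> 'M[R]_d) : Prop :=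
  forall i j, Ppoly r (fun x => P x i j).

End reference_element.
Arguments That {R d}.

Section gauss.
Variable R : realType.

(* Rodrigues' formula *)
Definition legendre (n : nat) : {poly R} :=
  ((2 ^ n * n`!)%N%:R)^-1 *: (('X^2 - 1) ^+ n)^`(n).

(* The zeros of the Legendre polynomial of degree n. *)
Definition gauss_nodes n (x : 'I_n -> R) : Prop :=
  injective x /\ forall k, root (legendre n) (x k).

(* The integral over [-1,1] of the k-th Lagrange polynomial at the nodes. *)
Definition gauss_weight n (x : 'I_n -> R) (k : 'I_n) : R :=
  \int[@lebesgue_measure R]_(t in `[-1, 1])
    \prod_(j < n | j != k) ((t - x j) / (x k - x j)).

(* The tensor product points on [-1,1]^d are indexed by multi-indices. *)
Definition gauss_point d n (x : 'I_n -> R) (k : {ffun 'I_d -> 'I_n}) :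
  'rV[R]_d := \row_i x (k i).

Definition tensor_weight d n (x : 'I_n -> R) (k : {ffun 'I_d -> 'I_n}) : R :=
  \prod_i gauss_weight x (k i).

Definition lagrange_basis d n (x : 'I_n -> R)
    (phih : {ffun 'I_d -> 'I_n} -> 'rV[R]_d -> R) : Prop :=
  forall k, Ppoly n.-1 (phih k) /\
    forall l, phih k (gauss_point x l) = (k == l)%:R.

End gauss.

Record mesh (R : realType) (d : nat) := Mesh {
  elt : finType;
  Fmap : elt -> 'rV[R]_d -> 'rV[R]_d;
  pdeg : elt -> nat }.

Section mesh.
Variables (R : realType) (d : nat) (Th : mesh R d).
Notation leb := (lebesgue_rV R d).

Definition cell (T : elt Th) : set 'rV[R]_d := Fmap T @` That.
Definition Finv (T : elt Th) : 'rV[R]_d -> 'rV[R]_d :=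
  'pinv_(fun=> 0) That (Fmap T).

Definition diam (T : elt Th) : R :=
  sup [set r | exists x y, [/\ cell T x, cell T y & r = frobn (x - y)]].

(* An element is a convex image of the reference cube under an injective
   bi-/trilinear map. Shape regularity with constant kappa: up to kappa, the
   Jacobian matrix scales like diam T and its inverse like 1 / diam T. The row
   vector convention makes 'J the transpose of the usual Jacobian matrix. *)
Definition regular_element (kappa : R) (T : elt Th) : Prop :=
  [/\ forall i, Ppoly 1 (fun x => Fmap T x 0 i),
      set_inj That (Fmap T),
      convex_set (cell T : set (convex_lmodType 'rV[R]_d)) &
      forall x, That x ->
        [/\ 'J (Fmap T) x \in unitmx,
            frobn ('J (Fmap T) x) <= kappa * diam T &
            frobn (invmx ('J (Fmap T) x)) * diam T <= kappa]].

(* The last clause is local quasi-uniformity and comparability of the degrees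
   of neighboring elements. Hanging nodes are allowed. *)
Definition fe_mesh (kappa : R) (Omega : set 'rV[R]_d) : Prop :=
  [/\ closure Omega = \bigcup_(T in [set: elt Th]) cell T,
      forall T T' : elt Th, T != T' ->
        interior (cell T) `&` interior (cell T') = set0,
      forall T : elt Th, regular_element kappa T,
      forall T : elt Th, (1 <= pdeg T)%N &
      forall T T' : elt Th, cell T `&` cell T' !=set0 ->
        diam T <= kappa * diam T' /\
        (pdeg T)%:R <= kappa * (pdeg T')%:R].

(* Pairs (k, T), with k a multi-index instead of an integer below pdeg T ^ d. *)
Definition node : finType := {T : elt Th & {ffun 'I_d -> 'I_(pdeg T)}}.
Definition ndof : nat := (\sum_(T : elt Th) pdeg T ^ d)%N.

(* g is the pullback to the reference element of the restriction of f to T,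
   as classes modulo almost everywhere equality. *)
Definition pullback (V : Type) (T : elt Th) (f g : 'rV[R]_d -> V) : Prop :=
  {ae leb, forall x, cell T x -> f x = g (Finv T x)}.

Variable Omega : set 'rV[R]_d.

Definition Q_hp (q : 'rV[R]_d -> 'M[R]_d) : Prop :=
  Q_space Omega q /\
  forall T : elt Th, exists P, Ppoly_mx (pdeg T).-1 P /\ pullback T q P.

Definition hp_fun (f : 'rV[R]_d -> R) : Prop :=
  L2 Omega f /\
  forall T : elt Th, exists P, Ppoly (pdeg T).-1 P /\ pullback T f P.

(* The representative of q on T whose pullback is a polynomial on the reference
   element; point values of q on T refer to it. *)
Definition hp_rep (q : 'rV[R]_d -> 'M[R]_d) (T : elt Th) (x : 'rV[R]_d) :
    'M[R]_d :=
  xget (fun=> 0) [set P | Ppoly_mx (pdeg T).-1 P /\ pullback T q P] (Finv T x).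

Variable x : forall n, 'I_n -> R.

Definition quadrature (T : elt Th) (f : 'rV[R]_d -> R) : R :=
  if pdeg T == 1%N then fine (leb (cell T)) * f (Fmap T 0)
  else \sum_(k : {ffun 'I_d -> 'I_(pdeg T)})
    tensor_weight (@x (pdeg T)) k *
    `|\det ('J (Fmap T) (gauss_point (@x (pdeg T)) k))| *
    f (Fmap T (gauss_point (@x (pdeg T)) k)).

Variable sigma_y : R.

Definition psi_hp (q : 'rV[R]_d -> 'M[R]_d) : R :=
  \sum_(T : elt Th) quadrature T (fun y => sigma_y * frobn (hp_rep q T y)).

Definition Lambda_w : set ('rV[R]_d -> 'M[R]_d) :=
  [set mu | Q_hp mu /\ forall q, Q_hp q -> inner_mx Omega mu q <= psi_hp q].

Definition nodal_basis
    (phih : forall T : elt Th, {ffun 'I_d -> 'I_(pdeg T)} -> 'rV[R]_d -> R)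
    (zeta : node -> 'I_ndof) (phi : 'I_ndof -> 'rV[R]_d -> R) : Prop :=
  forall (T : elt Th) (k : {ffun 'I_d -> 'I_(pdeg T)}) y,
    phi (zeta (Tagged (fun T => {ffun 'I_d -> 'I_(pdeg T)}) k)) y =
    \1_(cell T) y * phih T k (Finv T y).

Definition biorthogonal_basis (phi vphi : 'I_ndof -> 'rV[R]_d -> R) : Prop :=
  (forall j, hp_fun (vphi j)) /\
  forall i j, inner Omega (phi i) (vphi j) =
    (i == j)%:R * inner Omega (phi i) (cst 1).

Definition sigma_coef (phi : 'I_ndof -> 'rV[R]_d -> R) (i : 'I_ndof) : R :=
  (inner Omega (phi i) (cst 1))^-1 * inner Omega (cst sigma_y) (phi i).

(* f = \sum_i c_i b_i in L^2(Omega) *)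
Definition represents (b : 'I_ndof -> 'rV[R]_d -> R) (c : 'I_ndof -> 'M[R]_d)
    (f : 'rV[R]_d -> 'M[R]_d) : Prop :=
  {ae leb, forall y, Omega y -> f y = \sum_i b i y *: c i}.

End mesh.

(* Main.v *)
From HB Require Import structures.
Require Import Defs.
From mathcomp Require Import all_boot all_order all_algebra.
From mathcomp Require Import all_classical all_reals all_analysis.
From mathcomp Require Import fingroup perm measurable_realfun polyrcf ring lra.
Set Implicit Arguments.
Unset Strict Implicit.
Unset Printing Implicit Defensive.
Import Order.TTheory GRing.Theory Num.Theory.
Import numFieldNormedType.Exports.
Local Open Scope classical_set_scope.
Local Open Scope ring_scope.

(** The statement reduces to one identity: the integral [D_i] of the nodal basis
    function [phi_i] over the domain is positive and equals the weight that the
    element quadrature attaches to the node [i] ([dmassE], [dmass_gt0]). Granting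
    it, [sigma_i = sigma_y], the functional is
    [psi_hp q = \sum_i D_i sigma_y |q_i|] in terms of the nodal values of [q]
    ([psi_hpE]), and biorthogonality gives [(mu, q) = \sum_i D_i mu_i : q_i]
    ([inner_mx_coord]), so that everything decouples node by node. Testing with
    [q = phi_i mu_i] shows [|mu_i| <= sigma_y] for admissible [mu], Cauchy-Schwarz
    gives the converse, and in the second assertion the variational inequality
    compares [lambda] with the admissible [mu] whose coefficients are aligned with
    those of [p], where each term of the pairing is maximal.

    The identity for [D_i] has two ingredients.

    The Gauss rule with [p] nodes is exact in degree [2 p - 1] ([gauss_exact]),
    because the Legendre polynomial is orthogonal to lower degrees; its nodes are
    interior and its weights positive. On the reference cube the integrand is a
    Lagrange polynomial of degree [p - 1] in each variable times the Jacobian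
    determinant of a multi-affine map. That determinant has degree at most
    [d - 1 <= 2] in each variable ([det_Jac_fpol]) and a constant sign
    ([det_Jac_sign]), so the tensor rule is exact as soon as [p >= 2]; for [p = 1]
    the basis function is constant and [D_i] is the volume of the element.

    The change of variables formula for an injective multi-affine map [F] with
    invertible Jacobian ([pullint_cov]). Linear maps scale Lebesgue measure by
    their determinant ([lebesgue_rV_linear]). A cube of half-side [r] and centre
    [c] is mapped into a parallelepiped [F c + (1 + O(r)) cube *m Jac c], and its
    interior onto a set that contains [F c + (1 - O(r)) cube *m Jac c], by the
    contraction principle. Both sides of the formula are sub- or superadditive
    under bisection of cubes, and errors of smaller order than the volume vanish
    under repeated bisection ([bisection_le0]). The integral on the reference side
    is evaluated by the algebraic antiderivative ([fint]), so that no integration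
    theory is used there.

    The estimate from below uses open cubes and the one from above closed cubes;
    as they agree, the boundary of an element is a null set
    ([lebesgue_cell_diff]). With the fact that a Lipschitz domain contains the
    interior of its closure, this shows that almost every point of the domain lies
    in the interior of exactly one element and that the elements are contained in
    the domain up to null sets ([ae_regular], [open_cell_Omega]). *)

(** * Gauss quadrature on the interval [-1, 1] *)
Section gauss_quadrature.
Variable R : realType.
Implicit Types p q : {poly R}.

Definition antideriv p : {poly R} := \poly_(i < (size p).+1) (p`_i.-1 / i%:R).

Lemma coef_antideriv p i : (antideriv p)`_i = p`_i.-1 / i%:R.
Proof.
rewrite coef_poly; case: ltnP => // spi.
rewrite nth_default ?mul0r //; case: i spi => //.
Qed.

Lemma deriv_antideriv p : (antideriv p)^`() = p.
Proof.
apply/polyP => i; rewrite coef_deriv coef_antideriv /= -[(_ / _) *+ _]mulr_natr divfK // pnatr_eq0.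
Qed.

(** The integral of [p] over [-1, 1]. *)
Definition intp p : R := (antideriv p).[1] - (antideriv p).[-1].

Lemma intp_deriv q : intp q^`() = q.[1] - q.[-1].
Proof.
have -> : q = antideriv q^`() + (q`_0)%:P.
  apply/polyP => -[|i]; rewrite coefD coefC coef_antideriv /= ?invr0 ?mulr0 ?add0r //.
  by rewrite addr0 coef_deriv -[_ *+ _]/(q`_i.+1 *+ i.+1) -[q`_i.+1 *+ _]mulr_natr mulfK // pnatr_eq0.
by rewrite derivD derivC addr0 deriv_antideriv /intp !hornerE opprD addrACA subrr addr0.
Qed.

Lemma intpD p q : intp (p + q) = intp p + intp q.
Proof. by rewrite -{1}(deriv_antideriv p) -{1}(deriv_antideriv q) -derivD intp_deriv !hornerD /intp; ring. Qed.

Lemma intpZ a p : intp (a *: p) = a * intp p.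
Proof. by rewrite -{1}(deriv_antideriv p) -derivZ intp_deriv !hornerZ /intp; ring. Qed.

Lemma intp_sum I (s : seq I) (P : pred I) (F : I -> {poly R}) :
  intp (\sum_(i <- s | P i) F i) = \sum_(i <- s | P i) intp (F i).
Proof.
elim/big_rec2: _ => [|i x y _ <-]; last by rewrite intpD.
by have := intpZ 0 0; rewrite scale0r mul0r.
Qed.

Lemma intp_parts p q :
  intp (p^`() * q) = p.[1] * q.[1] - p.[-1] * q.[-1] - intp (p * q^`()).
Proof.
have := intp_deriv (p * q); rewrite derivM intpD !hornerM => <-.
by rewrite addrK.
Qed.

Lemma intp_ge0 p : (forall t, -1 < t < 1 -> 0 <= p.[t]) -> 0 <= intp p.
Proof.
move=> p0; have mono : {in `[-1, 1] &, {homo horner (antideriv p) : x y / x <= y}}.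
  by apply: ler_hornerW => t; rewrite in_itv /= deriv_antideriv => /p0.
by rewrite /intp subr_ge0; apply: mono; rewrite ?in_itv /= ?lexx ?andbT; lra.
Qed.

Lemma poly_infinite_roots p : (forall t, -1 <= t <= 1 -> p.[t] = 0) -> p = 0.
Proof.
move=> p0; apply/eqP; apply: contraT => pn0.
pose rs := [seq (i.+1%:R : R)^-1 | i <- iota 0 (size p)].
have := max_poly_roots (rs := rs) pn0.
rewrite size_map size_iota ltnn => /(_ _ _); apply => //.
  apply/allP => _ /mapP[i _ ->]; apply/eqP; apply: p0.
  rewrite (le_trans (lerN10 _)) ?invr_ge0 ?ler0n //= invf_le1 ?ltr0n //.
  by rewrite ler1n.
rewrite map_inj_uniq ?iota_uniq // => i j /invr_inj /eqP.
by rewrite eqr_nat => /eqP [].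
Qed.

(** A nonnegative polynomial with zero integral has a constant antiderivative. *)
Lemma intp_eq0 p : (forall t, -1 < t < 1 -> 0 <= p.[t]) -> intp p = 0 -> p = 0.
Proof.
move=> p0 ip0.
have mono : {in `[-1, 1] &, {homo horner (antideriv p) : x y / x <= y}}.
  by apply: ler_hornerW => t; rewrite in_itv /= deriv_antideriv => /p0.
suff : antideriv p - ((antideriv p).[-1])%:P = 0.
  by move/(congr1 (fun q => q^`())); rewrite derivB derivC subr0 deriv_antideriv deriv0.
apply: poly_infinite_roots => t tI; rewrite !hornerE; apply/eqP.
have h1 := mono (-1) t; have h2 := mono t 1.
rewrite !in_itv /= !lexx in h1 h2.
rewrite eq_le; rewrite /intp in ip0; apply/andP; split; move: h1 h2; lra.
Qed.


Lemma derivn_expX2_root n j : (j <= n)%N ->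
  exists s : {poly R}, (('X^2 - 1) ^+ n)^`(j) = ('X^2 - 1) ^+ (n - j) * s.
Proof.
elim: j => [_|j IH jn]; first by exists 1; rewrite derivn0 subn0 mulr1.
have [s ds] := IH (ltnW jn); rewrite derivnS ds -subSS subSn //.
exists (('X^2 - 1)^`() *+ (n - j.+1).+1 * s + ('X^2 - 1) * s^`()).
rewrite derivM deriv_exp /=; move: ('X^2 - 1) (n - j.+1)%N => v k.
by rewrite exprSr mulrDr -mulrA mulrA [v^`() * _]mulrC -mulrnAr -!mulrA.
Qed.

Lemma derivn_expX2_end n j (e : R) : (j < n)%N -> e ^+ 2 = 1 ->
  (('X^2 - 1) ^+ n)^`(j).[e] = 0.
Proof.
move=> jn e1; have [s ->] := derivn_expX2_root (ltnW jn).
rewrite hornerM horner_exp hornerD hornerN hornerXn hornerC e1 subrr expr0n subn_eq0 leqNgt jn.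
by rewrite mul0r.
Qed.

(** Integrating by parts moves the derivatives of Rodrigues' formula to [q],
    the boundary terms vanishing because [X^2 - 1] survives as a factor. *)
Lemma intp_derivn_expX2 n m q : (m <= n)%N -> (size q <= m)%N ->
  intp ((('X^2 - 1) ^+ n)^`(m) * q) = 0.
Proof.
elim: m q => [|m IH] q mn; rewrite ?leqn0 ?size_poly_eq0 => sq.
  by rewrite (eqP sq) mulr0 -(scale0r 0) intpZ mul0r.
rewrite derivnS intp_parts !derivn_expX2_end // ?expr1n ?sqrrN ?expr1n //.
rewrite !mul0r subrr sub0r IH ?oppr0 ?(ltnW mn) //.
by rewrite (leq_trans (size_poly _ _)) //; case: (size q) sq.
Qed.

Lemma intp_legendre n q : (size q <= n)%N -> intp (legendre R n * q) = 0.
Proof. by move=> sq; rewrite /legendre -scalerAl intpZ intp_derivn_expX2 ?mulr0. Qed.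

Lemma size_legendre n : size (legendre R n) = n.+1.
Proof.
rewrite /legendre size_scale ?invr_eq0 ?pnatr_eq0 ?muln_eq0 ?negb_or ?expn_eq0 -?lt0n ?fact_gt0 //.
have W : 'X^2 - 1 = 'X^2 - 1%:P :> {poly R} by [].
have mW : (('X^2 - 1 : {poly R}) ^+ n) \is monic.
  by rewrite monic_exp // W monicXnsubC.
have sW : size (('X^2 - 1 : {poly R}) ^+ n) = (n + n).+1.
  rewrite polySpred ?monic_neq0 // size_exp W size_XnsubC //=.
  by rewrite mulSn mul1n.
apply/eqP; rewrite eqn_leq; apply/andP; split.
  apply/leq_sizeP => j nj; rewrite coef_derivn nth_default ?mul0rn //.
  by rewrite sW ltn_add2l.
rewrite ltnNge; apply/negP => /leq_sizeP /(_ n (leqnn n)) /eqP.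
rewrite coef_derivn.
have : lead_coef (('X^2 - 1 : {poly R}) ^+ n) = 1 by apply/eqP; rewrite -monicE.
rewrite lead_coefE sW /= => ->.
by rewrite pnatr_eq0 => /eqP n0; have := ffact_gt0 (n + n) n; rewrite n0 leq_addr.
Qed.

Variables (n : nat) (x : 'I_n -> R).
Hypothesis gx : gauss_nodes x.

Definition lagrange_poly (k : 'I_n) : {poly R} :=
  \prod_(j < n | j != k) ((x k - x j)^-1 *: ('X - (x j)%:P)).

Definition lagrange_weight (k : 'I_n) : R := intp (lagrange_poly k).

Lemma horner_lagrange_poly k t :
  (lagrange_poly k).[t] = \prod_(j < n | j != k) ((t - x j) / (x k - x j)).
Proof.
rewrite /lagrange_poly horner_prod; apply: eq_bigr => j _.
by rewrite !hornerE mulrC.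
Qed.

Lemma lagrange_polyE k l : (lagrange_poly k).[x l] = (k == l)%:R.
Proof.
rewrite horner_lagrange_poly; case: eqVneq => [<-|kl].
  apply: big1 => j jk; rewrite divff // subr_eq0.
  by apply: contra jk => /eqP /gx.1 ->.
by rewrite (bigD1 l) 1?eq_sym //= subrr mul0r mul0r.
Qed.

Lemma size_lagrange_poly k : (size (lagrange_poly k) <= n)%N.
Proof.
rewrite /lagrange_poly scaler_prod (leq_trans (size_scale_leq _ _)) //.
rewrite -big_filter size_prod_XsubC size_filter.
have := count_predC (pred1 k) (index_enum 'I_n).
by rewrite [size _](_ : _ = n) ?count_uniq_mem ?index_enum_uniq ?mem_index_enum // -?[index_enum _]enumT ?size_enum_ord // add1n => ->.
Qed.

(** Lagrange interpolation: a polynomial with more roots than its degree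
    vanishes. *)
Lemma lagrange_poly_interp p : (size p <= n)%N -> p = \sum_k p.[x k] *: lagrange_poly k.
Proof.
move=> sp; apply/eqP; rewrite -subr_eq0; apply: contraT => nz.
have := max_poly_roots (rs := codom x) nz.
rewrite size_codom card_ord ltnNge .
have -> : (size (p - \sum_k p.[x k] *: lagrange_poly k)%R <= n)%N.
  rewrite (leq_trans (size_polyD _ _)) // geq_max sp size_polyN.
  rewrite (leq_trans (size_sum _ _ _)) //; apply/bigmax_leqP => k _.
  exact: leq_trans (size_scale_leq _ _) (size_lagrange_poly k).
have uc : uniq (codom x) by rewrite map_inj_uniq ?enum_uniq //; exact: gx.1.
suff rts : all (root (p - \sum_k p.[x k] *: lagrange_poly k)) (codom x).
  by move=> /(_ rts uc).
apply/allP => _ /codomP[k ->]; rewrite /root !hornerE horner_sum (bigD1 k) //=.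
rewrite big1 ?addr0 => [|l lk]; rewrite !hornerE lagrange_polyE.
  by rewrite eqxx mulr1 subrr.
by rewrite (negbTE lk) mulr0.
Qed.

(** The quotient [q] of the Legendre polynomial by [X - x_k] has degree [n - 1],
    so [q ^ 2 (X - x_k)] has zero integral. Were [x_k] outside of the open
    interval, this product would have a constant sign there. *)
Lemma gauss_node_itv k : -1 < x k < 1.
Proof.
have /factor_theorem [q defL] := gx.2 k.
have qn0 : q != 0.
  by apply/eqP => q0; have := size_legendre n; rewrite defL q0 mul0r size_poly0.
have sq : size q = n.
  have := size_legendre n; rewrite defL size_Mmonic ?monicXsubC // size_XsubC addn2 /=.
  by case.
have orth : intp (q ^+ 2 * ('X - (x k)%:P)) = 0.
  by rewrite expr2 -mulrA -defL mulrC intp_legendre // sq.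
have nz : q ^+ 2 * ('X - (x k)%:P) != 0.
  by rewrite mulf_neq0 ?expf_neq0 ?polyXsubC_eq0.
have q2 t : 0 <= q.[t] ^+ 2 by exact: sqr_ge0.
rewrite !ltNge -negb_or; apply: contraNN nz => xk; apply/eqP.
have : forall e : R, e = 1 \/ e = -1 -> (forall t, -1 < t < 1 -> 0 <= e * (t - x k)) ->
    q ^+ 2 * ('X - (x k)%:P) = 0.
  move=> e e1 H; apply: (scalerI (a := e)); first by case: e1 => ->; rewrite ?oppr_eq0 oner_eq0.
  rewrite scaler0; apply: intp_eq0 => [t /H tH|]; last by rewrite intpZ orth mulr0.
  by rewrite hornerZ hornerM horner_exp hornerXsubC mulrCA mulr_ge0.
move=> H; case/orP: xk => xk; [apply: (H 1); first by left|apply: (H (-1)); first by right];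
  by move=> t; lra.
Qed.

(** Modulo the Legendre polynomial, which integrates to zero against the quotient
    and vanishes at the nodes, [p] has degree less than [n] and is equal to its
    Lagrange interpolant. *)
Lemma gauss_exact p : (size p <= n + n)%N ->
  \sum_k lagrange_weight k * p.[x k] = intp p.
Proof.
move=> sp; have Ln0 : legendre R n != 0 by rewrite -size_poly_eq0 size_legendre.
have sm : (size (p %% legendre R n)%R <= n)%N.
  by rewrite -ltnS -(size_legendre n) ltn_modp.
have sd : (size (p %/ legendre R n)%R <= n)%N.
  by rewrite size_divp // size_legendre /= leq_subLR.
rewrite {2}(divp_eq p (legendre R n)) intpD mulrC intp_legendre // add0r.
rewrite [in RHS](lagrange_poly_interp sm) intp_sum; apply: eq_bigr => k _.
rewrite intpZ mulrC; congr (_ * _); rewrite {1}(divp_eq p (legendre R n)) hornerD hornerM.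
by have /eqP -> := gx.2 k; rewrite mulr0 add0r.
Qed.

(** By exactness the weight is also the integral of the square of the Lagrange
    polynomial, whose degree is [2 n - 2]. *)
Lemma lagrange_weight_gt0 k : 0 < lagrange_weight k.
Proof.
have -> : lagrange_weight k = intp (lagrange_poly k ^+ 2).
  rewrite -gauss_exact; last first.
    rewrite expr2 (leq_trans (size_polyMleq _ _)) //.
    have := size_lagrange_poly k; move: (size _) => s ss.
    by rewrite (leq_trans (leq_pred _)) // leq_add.
  rewrite (bigD1 k) //= big1 ?addr0 => [|l lk]; rewrite horner_exp lagrange_polyE.
    by rewrite eqxx expr1n mulr1.
  by rewrite eq_sym (negbTE lk) expr0n mulr0.
have l0 t : 0 <= (lagrange_poly k ^+ 2).[t] by rewrite horner_exp sqr_ge0.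
rewrite lt_neqAle intp_ge0 // andbT eq_sym; apply/negP => /eqP /intp_eq0.
move=> /(_ (fun t _ => l0 t)) /eqP; rewrite expf_eq0 /= => /eqP l00.
by have := lagrange_polyE k k; rewrite l00 hornerC eqxx => /eqP; rewrite eq_sym oner_eq0.
Qed.

Lemma Rintegral_poly p :
  \int[@lebesgue_measure R]_(t in `[-1, 1]) p.[t] = intp p.
Proof.
have N11 : (-1 : R) < 1 by rewrite (lt_trans (ltrN10 R) ltr01).
rewrite /Rintegral (@continuous_FTC2 _ _ (horner (antideriv p))) //.
- by apply: continuous_subspaceT => t; exact: continuous_horner.
- split => [t _|/=|/=]; first exact: derivable_horner.
    by apply: cvg_at_right_filter; exact: continuous_horner.
  by apply: cvg_at_left_filter; exact: continuous_horner.
- by move=> t _; rewrite -derivE deriv_antideriv.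
Qed.

Lemma gauss_weightE k : gauss_weight x k = lagrange_weight k.
Proof.
rewrite /gauss_weight /lagrange_weight -Rintegral_poly; congr (fine _).
by apply: eq_integral => t _; rewrite horner_lagrange_poly.
Qed.

End gauss_quadrature.

(** * Lebesgue measure on R^n *)
Section lebesgue_rV_theory.
Variable R : realType.
Local Notation leb := (lebesgue_rV R).

Lemma coord_le_norm n (x : 'rV[R]_n) i : `|x 0 i| <= `|x|.
Proof.
rewrite {2}/Num.norm /= mx_normrE.
exact: (le_bigmax _ (fun ij : 'I_1 * 'I_n => `|x ij.1 ij.2|) (0, i)).
Qed.

Lemma norm_le_coord n (x : 'rV[R]_n) r : 0 <= r ->
  (forall i, `|x 0 i| <= r) -> `|x| <= r.
Proof.
move=> r0 xr; rewrite {1}/Num.norm /= mx_normrE; apply/bigmax_leP; split=> // -[i j] _ /=.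
by rewrite ord1.
Qed.

Definition rV_box n (a b : 'rV[R]_n) : set 'rV[R]_n :=
  [set x | forall i, a 0 i <= x 0 i <= b 0 i].

Lemma measurable_coord_itv n (i : 'I_n) (J : interval R) :
  measurable [set x : 'rV[R]_n | x 0 i \in J].
Proof.
rewrite -[X in measurable X]setTI.
by apply: (@measurable_coord R n i measurableT [set` J]); exact: measurable_itv.
Qed.

Lemma measurable_rV_box n (a b : 'rV[R]_n) : measurable (rV_box a b).
Proof.
rewrite (_ : rV_box a b = \big[setI/setT]_(i < n) [set x : 'rV[R]_n | x 0 i \in `[a 0 i, b 0 i]]).
  by apply: bigsetI_measurable => i _; exact: measurable_coord_itv.
apply/seteqP; split => x /=.
  by move=> h; rewrite -bigcap_seq => i _ /=; rewrite in_itv/=.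
by rewrite -bigcap_seq => h i; have /= := h i (mem_index_enum i); rewrite in_itv.
Qed.

Definition rV_boxes n : set (set 'rV[R]_n) :=
  [set A | exists a b, A = rV_box a b].

Lemma rV_boxes_setI n : setI_closed (@rV_boxes n).
Proof.
move=> _ _ [a [b ->]] [a' [b' ->]].
exists (\row_i Num.max (a 0 i) (a' 0 i)), (\row_i Num.min (b 0 i) (b' 0 i)).
apply/seteqP; split => x /= => [[h h'] i|h].
  by rewrite !mxE ge_max le_min; have /andP[-> ->] := h i; have /andP[-> ->] := h' i.
by split=> i; have := h i; rewrite !mxE ge_max le_min => /andP[/andP[? ?] /andP[? ?]]; apply/andP.
Qed.

Lemma rV_box_cover n :
  \bigcup_(k : nat) rV_box (const_mx (- k%:R)) (const_mx k%:R) = [set: 'rV[R]_n].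
Proof.
apply/seteqP; split => // x _.
exists (Num.truncn `|x|).+1 => // i; rewrite !mxE -ler_norml.
exact: le_trans (coord_le_norm x i) (ltW (truncnS_gt _)).
Qed.

Lemma measurable_rVE n : measurable = <<s @rV_boxes n >>.
Proof.
apply/seteqP; split; last first.
  apply: smallest_sub; first exact: sigma_algebra_measurable.
  by move=> _ [a [b ->]]; exact: measurable_rV_box.
apply: smallest_sub; first exact: smallest_sigma_algebra.
rewrite -bigcup_seq; apply: bigcup_sub => i _ _ [Y mY <-].
have : measurable_fun setT (fun x : g_sigma_algebraType (@rV_boxes n) => (x : 'rV[R]_n) 0 i : R).
  apply: (measurability (@measurable_realfun.RGenCInfty.G R)); first exact: measurable_realfun.RGenCInfty.measurableE.
  move=> _ [_ [r ->] <-]; rewrite setTI.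
  rewrite (_ : _ @^-1` _ = \bigcup_(k : nat) (rV_box
     (\row_j if j == i then r else - k%:R) (const_mx k%:R))).
    apply: bigcupT_measurable => k; apply: sub_sigma_algebra.
    by do 2 eexists.
  apply/seteqP; split => x /=; rewrite ?in_itv /= ?andbT.
    move=> rx; exists (Num.truncn `|x : 'rV[R]_n|).+1 => // j; rewrite !mxE.
    have := le_trans (coord_le_norm x j) (ltW (truncnS_gt `|x : 'rV[R]_n|)).
    rewrite ler_norml => /andP[h1 h2].
    by case: eqP h1 h2 => [->|_] h1 h2; rewrite ?rx ?h1 h2.
  move=> [k _ /(_ i)]; by rewrite !mxE eqxx => /andP[].
by move=> /(_ measurableT _ mY).
Qed.

(** A measure on R^n is Lebesgue measure as soon as it gives boxes their volume:
    boxes form a generating pi-system. *)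
Lemma lebesgue_rV_unique n (m : {measure set 'rV[R]_n -> \bar R}) :
  (forall a b : 'rV[R]_n, (forall i, a 0 i <= b 0 i) ->
     m (rV_box a b) = (\prod_i (b 0 i - a 0 i))%:E) ->
  forall A, measurable A -> leb n A = m A.
Proof.
move=> mbox; apply: (measure_unique (@rV_boxes n)
  (fun k : nat => rV_box (const_mx (- k%:R)) (const_mx k%:R))).
- exact: measurable_rVE.
- exact: rV_boxes_setI.
- by move=> k; do 2 eexists.
- exact: rV_box_cover.
- move=> _ [a [b ->]]; case: (pselect (forall i, a 0 i <= b 0 i)) => [ab|/existsNP[i abi]].
    by rewrite mbox // -lebesgue_rV_box.
  rewrite (_ : rV_box a b = set0) ?measure0 //; apply/seteqP; split => // x /(_ i) /andP[h1 h2].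
  exact: abi (le_trans h1 h2).
- move=> k; rewrite /= [leb n (rV_box _ _)]lebesgue_rV_box ?ltry // => i.
  by rewrite !mxE (le_trans (y := 0)) ?oppr_le0.
Qed.

Lemma measurable_mulmx n m (A : 'M[R]_(n, m)) :
  measurable_fun setT (fun x : 'rV[R]_n => x *m A).
Proof.
apply: measurable_fun_rVP => j.
rewrite (_ : (fun _ => _) = fun x : 'rV[R]_n => \sum_i x 0 i * A i j).
  by apply: measurable_sum => i; apply: measurable_funM => //; exact: measurable_coord.
by apply/funext => x; rewrite mxE.
Qed.

Definition monomial_map n (s : 'S_n) (a b : 'I_n -> R) (x : 'rV[R]_n) : 'rV[R]_n :=
  \row_i (a i * x 0 (s i) + b i).

Lemma measurable_monomial_map n (s : 'S_n) a b :
  measurable_fun setT (monomial_map s a b).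
Proof.
apply: measurable_fun_rVP => j.
rewrite (_ : (fun _ => _) = fun x : 'rV[R]_n => a j * x 0 (s j) + b j).
  by apply: measurable_funD => //; apply: measurable_funM => //; exact: measurable_coord.
by apply/funext => x; rewrite mxE.
Qed.

(** Translations, dilations of the axes and permutations of the axes map boxes
    to boxes, so that their effect on Lebesgue measure is read off from boxes. *)
Lemma lebesgue_monomial_map n (s : 'S_n) a b E : (forall i, a i != 0) ->
  measurable E ->
  ((\prod_i `|a i|)%:E * leb n (monomial_map s a b @^-1` E))%E = leb n E.
Proof.
move=> a0 mE; have p0 : 0 <= \prod_i `|a i| by apply: prodr_ge0.
have mm := measurable_monomial_map s a b.
pose m0 : {measure set 'rV[R]_n -> \bar R} := pushforward (leb n) (monomial_map s a b).
pose m : {measure set 'rV[R]_n -> \bar R} := mscale (NngNum p0) (m0 mm).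
suff mbox (l u : 'rV[R]_n) : (forall i, l 0 i <= u 0 i) ->
    m (rV_box l u) = (\prod_i (u 0 i - l 0 i))%:E.
  by rewrite (lebesgue_rV_unique mbox mE).
move=> lu; rewrite [LHS](_ : _ = (\prod_i `|a i|)%:E * leb n (monomial_map s a b @^-1` rV_box l u))%E //.
pose cn i : R := (u 0 i + l 0 i) / 2; pose hw i : R := (u 0 i - l 0 i) / 2.
pose l' : 'rV[R]_n := \row_j let i := (s^-1)%g j in (cn i - b i) / a i - hw i / `|a i|.
pose u' : 'rV[R]_n := \row_j let i := (s^-1)%g j in (cn i - b i) / a i + hw i / `|a i|.
have hw0 i : 0 <= hw i / `|a i| by rewrite divr_ge0 ?divr_ge0 // subr_ge0.
have -> : monomial_map s a b @^-1` rV_box l u = rV_box l' u'.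
  have key x i : (l 0 i <= monomial_map s a b x 0 i <= u 0 i) =
      (l' 0 (s i) <= x 0 (s i) <= u' 0 (s i)).
    rewrite !mxE permK -!ler_distl; set y := x 0 (s i).
    have -> : (l 0 i <= a i * y + b i <= u 0 i) = (`|a i * y + b i - cn i| <= hw i).
      by rewrite ler_distl /cn /hw; congr (_ && _); [congr (_ <= _)|congr (_ <= _)]; field.
    have -> : a i * y + b i - cn i = a i * (y - (cn i - b i) / a i) by field.
    by rewrite normrM mulrC -ler_pdivlMr ?normr_gt0.
  apply/seteqP; split => x /= H i; last by rewrite key.
  by have := H ((s^-1)%g i); rewrite key permKV.
rewrite [leb n _]lebesgue_rV_box; last first.
  move=> i; rewrite !mxE /=; have := hw0 ((s^-1)%g i).
  by move: (hw _ / _) => w; lra.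
rewrite -EFinM -big_split /= (reindex_inj (h := s)) //=; last exact: perm_inj.
congr EFin.
transitivity (\prod_i `|a i| * \prod_i (u' 0 (s i) - l' 0 (s i))).
  by rewrite big_split; congr (_ * _); rewrite [RHS](reindex_inj (h := s)) //; exact: perm_inj.
rewrite -big_split; apply: eq_bigr => i _; rewrite /= !mxE permK.
have a0' : `|a i| != 0 by rewrite normr_eq0.
by rewrite /= /hw; field; rewrite a0' a0.
Qed.

Lemma lebesgue_rV_translation n (v : 'rV[R]_n) E : measurable E ->
  leb n ((fun x => x + v) @^-1` E) = leb n E.
Proof.
move=> mE; rewrite -[RHS](@lebesgue_monomial_map n 1%g (fun=> 1) (fun i => v 0 i)) //.
rewrite big1 ?mul1e => [|i _]; last by rewrite normr1.
by congr (leb n (_ @^-1` E)); apply/funext => x; apply/rowP => i; rewrite !mxE perm1 mul1r.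
Qed.

Definition scales_lebesgue n (A : 'M[R]_n) := forall E, measurable E ->
  (`|\det A|%:E * leb n ((fun x => x *m A) @^-1` E))%E = leb n E.

Lemma scales_lebesgue_mul n (A B : 'M[R]_n) :
  scales_lebesgue A -> scales_lebesgue B -> scales_lebesgue (A *m B).
Proof.
move=> sA sB E mE; have mBE : measurable ((fun x : 'rV[R]_n => x *m B) @^-1` E).
  by rewrite -[X in measurable X]setTI; exact: measurable_mulmx.
rewrite det_mulmx normrM mulrC EFinM -muleA -[RHS](sB E mE) -(sA _ mBE).
congr (_ * (_ * leb n _))%E; apply/seteqP.
by split => x /=; rewrite mulmxA.
Qed.

Lemma scales_lebesgue_perm n (s : 'S_n) : scales_lebesgue (perm_mx s).
Proof.
move=> E mE; rewrite -[RHS](@lebesgue_monomial_map n (s^-1)%g (fun=> 1) (fun=> 0)) //.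
rewrite det_perm normrX normrN1 expr1n big1 => [|i _]; last by rewrite normr1.
congr (_ * leb n (_ @^-1` E))%E; apply/funext => x; apply/rowP => i.
by rewrite -[s in LHS]invgK -col_permE !mxE mul1r addr0.
Qed.

Lemma scales_lebesgue_diag n (d : 'rV[R]_n) : (forall i, d 0 i != 0) ->
  scales_lebesgue (diag_mx d).
Proof.
move=> d0 E mE; rewrite -[RHS](@lebesgue_monomial_map n 1%g (fun i => d 0 i) (fun=> 0)) //.
rewrite det_diag normr_prod.
congr (_ * leb n (_ @^-1` E))%E; apply/funext => x; apply/rowP => i.
by rewrite mul_mx_diag !mxE perm1 addr0 mulrC.
Qed.

Lemma rV_cons_mulmx n (U : 'M[R]_n.+1) (z : R * 'rV[R]_n) :
  (forall i : 'I_n, U (lift ord0 i) ord0 = 0) -> U ord0 ord0 = 1 ->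
  rV_cons z *m U = rV_cons (z.1, z.2 *m row' ord0 (col' ord0 U) +
                                 \row_j (z.1 * U ord0 (lift ord0 j))).
Proof.
move=> U0 U1; apply/rowP => j; rewrite !mxE big_ord_recl mxE unlift_none.
under eq_bigr do rewrite mxE liftK.
case: (unliftP ord0 j) => [k ->|->].
  by rewrite /= !mxE addrC; congr (_ + _); apply: eq_bigr => i _; rewrite !mxE.
by rewrite U1 mulr1 big1 ?addr0 // => i _; rewrite U0 mulr0.
Qed.

(** For fixed first coordinate, an upper unitriangular matrix acts on the other
    coordinates by a smaller such matrix followed by a translation. *)
Lemma lebesgue_upper_unitriangular n (U : 'M[R]_n) E :
  (forall i j : 'I_n, (j < i)%N -> U i j = 0) -> (forall i, U i i = 1) ->
  measurable E -> leb n ((fun x => x *m U) @^-1` E) = leb n E.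
Proof.
elim: n U E => [|n IH] U E U0 U1 mE.
  by congr (leb 0 _); apply/seteqP; split => x /=; rewrite (thinmx0 (x *m U)) (thinmx0 x).
rewrite /= /lebesgue_rV_step /pushforward /product_measure1.
apply: eq_integral => t _ /=.
set D := row' ord0 (col' ord0 U).
set v : 'rV[R]_n := \row_j (t * U ord0 (lift ord0 j)).
have mS : measurable (xsection (@rV_cons R n @^-1` E) t).
  apply: measurable_xsection; rewrite -[X in measurable X]setTI.
  exact: measurable_rV_cons.
rewrite -[RHS](lebesgue_rV_translation v mS) -[RHS](IH D).
- congr (leb n _); apply/seteqP; split => y /=; rewrite !xsectionE /=.
    by rewrite rV_cons_mulmx // => i; rewrite U0.
  by rewrite rV_cons_mulmx // => i; rewrite U0.
- by move=> i j ji; rewrite !mxE U0.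
- by move=> i; rewrite !mxE.
- rewrite -[X in measurable X]setTI.
  rewrite (_ : (fun x => x + v) = monomial_map 1 (fun=> 1) (fun i => v 0 i)).
    exact: measurable_monomial_map.
  by apply/funext => x; apply/rowP => i; rewrite !mxE perm1 mul1r.
Qed.

Lemma scales_lebesgue_upper_unitriangular n (U : 'M[R]_n) :
  (forall i j : 'I_n, (j < i)%N -> U i j = 0) -> (forall i, U i i = 1) ->
  scales_lebesgue U.
Proof.
move=> U0 U1 E mE; rewrite lebesgue_upper_unitriangular // -det_tr det_trig.
  by rewrite big1 ?normr1 ?mul1e // => i _; rewrite mxE.
by apply/is_trig_mxP => i j ij; rewrite mxE U0.
Qed.

(** The linear change of variables follows from the LUP decomposition; the lower
    triangular factor is conjugate to an upper triangular one. *)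
Lemma lebesgue_rV_linear n (A : 'M[R]_n) : A \in unitmx -> scales_lebesgue A.
Proof.
case: n A => [|n] A Au.
  move=> E mE; rewrite det_mx00 normr1 mul1e; congr (leb 0 _).
  by apply/seteqP; split => x /=; rewrite (thinmx0 (x *m A)) (thinmx0 x).
have := cormen_lup_correct A; have := cormen_lup_perm A.
have := cormen_lup_lower A; have := cormen_lup_upper A; have := cormen_lup_detL A.
case: (cormen_lup A) => -[P L] U /= detL Uu Ll /is_perm_mxP[s ->] PA.
have defA : A = perm_mx (s^-1)%g *m (L *m U).
  by rewrite -[L *m U]PA mulmxA -perm_mxM mulVg perm_mx1 mul1mx.
have detU : \det U = \prod_i U i i.
  rewrite -det_tr det_trig; first by apply: eq_bigr => i _; rewrite mxE.
  by apply/is_trig_mxP => i j ij; rewrite mxE Uu.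
have Ui i : U i i != 0.
  have : \det A != 0 by rewrite -unitfE -unitmxE.
  rewrite defA !det_mulmx detL mul1r detU mulf_eq0 negb_or => /andP[_].
  by rewrite prodf_seq_neq0 => /allP /(_ i (mem_index_enum i)).
rewrite defA; apply: scales_lebesgue_mul; first exact: scales_lebesgue_perm.
apply: scales_lebesgue_mul.
  have sw : {s : 'S_n.+1 | forall i, s i = rev_ord i}.
    by exists (perm (@rev_ord_inj _)) => i; rewrite permE.
  case: sw => w wE; have wV : (w^-1)%g = w.
    by apply/permP => i; apply: (@perm_inj _ w); rewrite permKV !wE rev_ordK.
  have -> : L = perm_mx w *m (perm_mx w *m L *m perm_mx w) *m perm_mx w.
    rewrite -!mulmxA -perm_mxM !mulmxA -perm_mxM -{1 4}wV mulVg mulgV.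
    by rewrite perm_mx1 mulmx1 mul1mx.
  apply: scales_lebesgue_mul; last exact: scales_lebesgue_perm.
  apply: scales_lebesgue_mul; first exact: scales_lebesgue_perm.
  have WE i j : (perm_mx w *m L *m perm_mx w) i j = L (rev_ord i) (rev_ord j).
    by rewrite -[X in _ *m perm_mx X]wV -col_permE -row_permE !mxE !wE.
  apply: scales_lebesgue_upper_unitriangular => [i j ji|i]; rewrite WE Ll ?eqxx //=.
    by rewrite (inj_eq (@rev_ord_inj _)) -val_eqE /= gtn_eqF.
  by rewrite leq_sub2l // ltnW.
have -> : U = diag_mx (\row_i U i i) *m \matrix_(i, j) ((U i i)^-1 * U i j).
  by apply/matrixP => i j; rewrite mul_diag_mx !mxE mulVKf.
apply: scales_lebesgue_mul.
  by apply: scales_lebesgue_diag => i; rewrite mxE.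
apply: scales_lebesgue_upper_unitriangular => [i j ji|i]; rewrite mxE.
  by rewrite (Uu i j) // mulr0.
by rewrite mulVf.
Qed.

Definition cube n (c : 'rV[R]_n) r : set 'rV[R]_n :=
  [set x | forall i, `|x 0 i - c 0 i| <= r].

Lemma cubeE n (c : 'rV[R]_n) r :
  cube c r = rV_box (c - const_mx r) (c + const_mx r).
Proof. by apply/seteqP; split => x /= H i; have := H i; rewrite !mxE ler_distl. Qed.

Lemma measurable_cube n (c : 'rV[R]_n) r : measurable (cube c r).
Proof. by rewrite cubeE; exact: measurable_rV_box. Qed.

Lemma cube_normP n (c x : 'rV[R]_n) r : 0 <= r -> cube c r x <-> `|x - c| <= r.
Proof.
move=> r0; split=> [H|H i].
  by apply: norm_le_coord => // i; have := H i; rewrite !mxE.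
by have := le_trans (coord_le_norm (x - c) i) H; rewrite !mxE.
Qed.

Lemma lebesgue_cube n (c : 'rV[R]_n) r : 0 <= r ->
  leb n (cube c r) = ((2 * r) ^+ n)%:E.
Proof.
move=> r0; rewrite cubeE [leb n _]lebesgue_rV_box => [|i]; last by rewrite !mxE; lra.
congr EFin; rewrite -[n in RHS]card_ord -prodr_const.
by apply: eq_bigr => i _; rewrite !mxE; ring.
Qed.

Lemma affine_cubeE n (A : 'M[R]_n) (b : 'rV[R]_n) r : A \in unitmx ->
  [set b + z *m A | z in cube 0 r] =
  monomial_map 1 (fun=> 1) (fun i => (- b) 0 i) @^-1` ((fun x => x *m invmx A) @^-1` cube 0 r).
Proof.
have E x : monomial_map 1 (fun=> 1) (fun i => (- b) 0 i) x = x - b.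
  by apply/rowP => i; rewrite !mxE perm1 mul1r.
move=> Au; apply/seteqP; split => [_ [z zr <-]|x] /=; rewrite E.
  by rewrite [b + _]addrC addrK mulmxK.
by move=> xr; exists ((x - b) *m invmx A) => //; rewrite mulmxKV // addrC subrK.
Qed.

Lemma measurable_affine_cube n (A : 'M[R]_n) (b : 'rV[R]_n) r : A \in unitmx ->
  measurable [set b + z *m A | z in cube 0 r].
Proof.
move=> Au; rewrite affine_cubeE // -[X in measurable X]setTI.
apply: measurable_monomial_map => //; rewrite -[X in measurable X]setTI.
by apply: measurable_mulmx => //; exact: measurable_cube.
Qed.

Lemma lebesgue_affine_cube n (A : 'M[R]_n) (b : 'rV[R]_n) r : A \in unitmx -> 0 <= r ->
  leb n [set b + z *m A | z in cube 0 r] = (`|\det A| * (2 * r) ^+ n)%:E.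
Proof.
move=> Au r0; have mC := measurable_cube (0 : 'rV[R]_n) r.
have mD : measurable ((fun x : 'rV[R]_n => x *m invmx A) @^-1` cube 0 r).
  by rewrite -[X in measurable X]setTI; exact: measurable_mulmx.
rewrite affine_cubeE // -[leb n _]mul1e.
have -> : (1 = (\prod_(i < n) `|1 : R|)%:E :> \bar R)%E by rewrite big1 // => i _; rewrite normr1.
rewrite lebesgue_monomial_map //.
have := @lebesgue_rV_linear n (invmx A) _ _ mC.
rewrite unitmx_inv det_inv normfV lebesgue_cube // => /(_ Au) H.
have d0 : `|\det A| != 0 by rewrite normr_eq0 -unitfE -unitmxE.
by rewrite EFinM -H muleA -EFinM mulfV // mul1e.
Qed.

Lemma ball_cube n (x : 'rV[R]_n) e y : 0 < e -> ball x e y <-> `|y - x| < e.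
Proof. by move=> e0; rewrite -ball_normE /= distrC. Qed.

(** An open set is the union of the rational cubes that it contains. *)
Lemma open_measurable_rV n (U : set 'rV[R]_n) : open U -> measurable U.
Proof.
move=> oU.
pose C (m : nat) : set 'rV[R]_n :=
  if @unpickle ('rV[rat]_n * nat)%type m is Some (q, k) then
    let Q := cube (map_mx ratr q) k.+1%:R^-1 in
    if `[< Q `<=` U >] then Q else set0
  else set0.
have -> : U = \bigcup_m C m.
  apply/seteqP; split=> [x Ux|x [m _]]; last first.
    by rewrite /C; case: unpickle => [[q k]|//]; case: asboolP => // QU /QU.
  have /nbhs_ballP[e /= e0 eU] : nbhs x U by exact: oU.
  have [k ke] : exists k : nat, k.+1%:R^-1 < e / 2.
    have [N _ /(_ N (leqnn _)) H] := near_infty_natSinv_lt (PosNum (divr_gt0 e0 (ltr0n R 2))).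
    by exists N.
  have /choice[q qP] : forall i, exists q : rat, `|x 0 i - ratr q| <= k.+1%:R^-1.
    move=> i; have : 0 < k.+1%:R^-1 :> R by rewrite invr_gt0.
    move: (k.+1%:R^-1) => w w0; have : x 0 i - w < x 0 i + w by lra.
    move=> /rat_in_itvoo[q]; rewrite in_itv /= => H; exists q.
    by rewrite ler_distl; have /andP[h1 h2] := H; apply/andP; split; lra.
  exists (pickle (\row_i q i, k)) => //; rewrite /C pickleK.
  have sub : cube (map_mx ratr (\row_i q i)) k.+1%:R^-1 `<=` U.
    move=> y yQ; apply: eU; apply/ball_cube => //.
    apply: (@le_lt_trans _ _ (2 * k.+1%:R^-1)); last first.
      by move: ke; move: (k.+1%:R^-1) => w; lra.
    apply: norm_le_coord => [|i]; first by rewrite mulr_ge0 // invr_ge0.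
    have := yQ i; have := qP i; rewrite !mxE !ler_distl.
    move: (k.+1%:R^-1) (ratr _) => w z /andP[h1 h2] /andP[h3 h4].
    by apply/andP; split; lra.
  by rewrite asboolT // => i; rewrite !mxE.
apply: bigcupT_measurable => m; rewrite /C; case: unpickle => [[q k]|//].
by case: asboolP => // _; exact: measurable_cube.
Qed.

Lemma closed_measurable_rV n (F : set 'rV[R]_n) : closed F -> measurable F.
Proof.
by move=> cF; rewrite -[F]setCK; apply: measurableC; apply: open_measurable_rV; exact: closed_openC.
Qed.

Lemma compact_measurable_rV n (F : set 'rV[R]_n) : compact F -> measurable F.
Proof.
move=> /compact_closed cF; apply: closed_measurable_rV; apply: cF.
exact: norm_hausdorff.
Qed.

Lemma compact_cube n (c : 'rV[R]_n) r : compact (cube c r).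
Proof.
rewrite (_ : cube c r = [set v | forall i, `[c 0 i - r, c 0 i + r]%classic (v ord0 i)]).
  by apply: (rV_compact (A := fun i => `[c 0 i - r, c 0 i + r]%classic)) => i; exact: segment_compact.
by apply/seteqP; split => x /= H i; have := H i; rewrite in_itv /= ler_distl.
Qed.

End lebesgue_rV_theory.


(** * Polynomials in several variables *)
Section formal_polynomials.
Variables (R : realType) (d : nat).
Implicit Types (x y u v c : 'rV[R]_d) (s t : seq (R * {ffun 'I_d -> nat})).

Definition mono (e : {ffun 'I_d -> nat}) x : R := \prod_i x 0 i ^+ e i.

(** Polynomials are represented by lists of coefficients and exponents, which keeps
    track of the degree in each variable separately. *)
Definition fpol := seq (R * {ffun 'I_d -> nat}).

Definition feval (s : fpol) x : R := \sum_(p <- s) p.1 * mono p.2 x.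

Definition degs_le (e : 'I_d -> nat) (s : fpol) : bool :=
  all (fun p : R * {ffun 'I_d -> nat} => [forall i, p.2 i <= e i])%N s.

Lemma degs_leW (e e' : 'I_d -> nat) (s : fpol) : (forall i, e i <= e' i)%N ->
  degs_le e s -> degs_le e' s.
Proof.
move=> ee'; apply: sub_all => p /forallP pe.
by apply/forallP => i; exact: leq_trans (pe i) (ee' i).
Qed.

Lemma Ppoly_fpol r f : Ppoly r f ->
  exists2 s : fpol, degs_le (fun=> r) s & forall x, f x = feval s x.
Proof.
move=> [c fE]; exists [seq (c a, [ffun i => a i : nat]) | a <- enum {ffun 'I_d -> 'I_r.+1}].
  rewrite /degs_le all_map; apply/allP => a _ /=; apply/forallP => i.
  by rewrite ffunE -ltnS.
move=> x; rewrite fE /feval big_map big_enum; apply: eq_bigr => a _; congr (_ * _).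
by apply: eq_bigr => i _; rewrite ffunE.
Qed.

Lemma fpol_Ppoly r (s : fpol) f : degs_le (fun=> r) s ->
  (forall x, f x = feval s x) -> Ppoly r f.
Proof.
move=> sr fE; exists (fun a => \sum_(p <- s | [ffun i => inord (p.2 i)] == a) p.1) => x.
rewrite fE /feval (partition_big (fun p : R * {ffun 'I_d -> nat} => [ffun i => inord (p.2 i)] : {ffun 'I_d -> 'I_r.+1}) predT) //=.
apply: eq_bigr => a _; rewrite mulr_suml big_seq_cond [RHS]big_seq_cond.
apply: eq_bigr => p /andP[ps /eqP <-]; congr (_ * _); apply: eq_bigr => i _.
by rewrite ffunE inordK // ltnS; have /forallP := allP sr _ ps.
Qed.

Definition fmul (s t : fpol) : fpol :=
  [seq (p.1 * q.1, [ffun i => (p.2 i + q.2 i)%N]) |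
     p : R * {ffun 'I_d -> nat} <- s, q : R * {ffun 'I_d -> nat} <- t].

Lemma feval_mul (s t : fpol) x : feval (fmul s t) x = feval s x * feval t x.
Proof.
rewrite /feval big_allpairs_dep mulr_suml; apply: eq_bigr => p _.
rewrite mulr_sumr; apply: eq_bigr => q _ /=; rewrite mulrACA; congr (_ * _).
by rewrite /mono -big_split; apply: eq_bigr => i _; rewrite ffunE exprD.
Qed.

Lemma degs_le_mul e e' (s t : fpol) : degs_le e s -> degs_le e' t ->
  degs_le (fun i => e i + e' i)%N (fmul s t).
Proof.
move=> es et; apply/allP => _ /allpairsP[[p q] [/= ps qt ->]] /=.
apply/forallP => i; rewrite ffunE leq_add //.
  by have /forallP := allP es _ ps.
by have /forallP := allP et _ qt.
Qed.

Lemma feval_cat (s t : fpol) x : feval (s ++ t) x = feval s x + feval t x.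
Proof. by rewrite /feval big_cat. Qed.

Definition fscale a (s : fpol) : fpol := [seq (a * p.1, p.2) | p <- s].

Lemma feval_scale a (s : fpol) x : feval (fscale a s) x = a * feval s x.
Proof. by rewrite /feval big_map mulr_sumr; apply: eq_bigr => p _; rewrite mulrA. Qed.

Lemma degs_le_scale e a (s : fpol) : degs_le e (fscale a s) = degs_le e s.
Proof. by rewrite /degs_le all_map. Qed.

Definition fone : fpol := [:: (1, [ffun=> 0%N])].

Lemma feval_one x : feval fone x = 1.
Proof.
by rewrite /feval big_seq1 mul1r /mono big1 // => i _; rewrite ffunE expr0.
Qed.

Lemma degs_le_one e : degs_le e fone.
Proof. by rewrite /degs_le /= andbT; apply/forallP => i; rewrite ffunE. Qed.

Lemma Ppoly_eq r (f g : 'rV[R]_d -> R) : f =1 g -> Ppoly r f -> Ppoly r g.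
Proof. by move=> fg [c fE]; exists c => x; rewrite -fg. Qed.

Lemma Ppoly_cst r a : Ppoly r (fun _ : 'rV[R]_d => a).
Proof.
apply: (@fpol_Ppoly r (fscale a fone)); first by rewrite degs_le_scale degs_le_one.
by move=> x; rewrite feval_scale feval_one mulr1.
Qed.

Lemma Ppoly_add r f g : Ppoly r f -> Ppoly r g -> Ppoly (d := d) r (fun x : 'rV[R]_d => f x + g x).
Proof.
move=> /Ppoly_fpol[s sr fE] /Ppoly_fpol[t tr gE].
apply: (@fpol_Ppoly r (s ++ t)); first by rewrite /degs_le all_cat; apply/andP.
by move=> x; rewrite feval_cat fE gE.
Qed.

Lemma Ppoly_scale r a f : Ppoly r f -> Ppoly (d := d) r (fun x : 'rV[R]_d => a * f x).
Proof.
move=> /Ppoly_fpol[s sr fE]; apply: (@fpol_Ppoly r (fscale a s)).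
  by rewrite degs_le_scale.
by move=> x; rewrite feval_scale fE.
Qed.

Lemma Ppoly_sum r (I : Type) (l : seq I) (P : pred I) (f : I -> 'rV[R]_d -> R) :
  (forall i, Ppoly r (f i)) -> Ppoly r (fun x => \sum_(i <- l | P i) f i x).
Proof.
move=> fr; elim: l => [|i l IH].
  by apply: Ppoly_eq (Ppoly_cst r 0) => x; rewrite big_nil.
apply: (@Ppoly_eq r (fun x => (if P i then f i x else 0) + \sum_(i <- l | P i) f i x)).
  by move=> x; rewrite big_cons; case: ifP => // _; rewrite add0r.
by apply: Ppoly_add => //; case: (P i) => //; exact: Ppoly_cst.
Qed.

(** Boundedness and the Lipschitz condition are required with one constant, which
    makes the class stable under products. *)
Definition bounded_lip (M : R) (f : 'rV[R]_d -> R) :=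
  exists2 K, 0 <= K & forall x y, `|x| <= M -> `|y| <= M ->
    `|f x| <= K /\ `|f x - f y| <= K * `|x - y|.

Lemma bounded_lip_eq M f g : f =1 g -> bounded_lip M f -> bounded_lip M g.
Proof. by move=> fg [K K0 fK]; exists K => // x y xM yM; rewrite -!fg; exact: fK. Qed.

Lemma bounded_lip_cst M a : bounded_lip M (fun=> a).
Proof.
exists `|a| => // x y _ _; rewrite subrr normr0 mulr_ge0 //.
Qed.

Lemma bounded_lip_coord M i : bounded_lip M (fun x => x 0 i).
Proof.
exists (`|M| + 1) => [|x y xM yM]; first by rewrite addr_ge0.
split.
  rewrite (le_trans (coord_le_norm x i)) // (le_trans xM) //.
  by rewrite (le_trans (ler_norm M)) // lerDl.
have := coord_le_norm (x - y) i; rewrite !mxE => h; rewrite (le_trans h) //.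
by rewrite ler_peMl // lerDr.
Qed.

Lemma bounded_lip_add M f g : bounded_lip M f -> bounded_lip M g -> bounded_lip M (fun x => f x + g x).
Proof.
move=> [K K0 fK] [L L0 gL]; exists (K + L) => [|x y xM yM]; first by rewrite addr_ge0.
have [f1 f2] := fK x y xM yM; have [g1 g2] := gL x y xM yM.
split; first by rewrite (le_trans (ler_normD _ _)) // lerD.
by rewrite opprD addrACA (le_trans (ler_normD _ _)) // mulrDl lerD.
Qed.

Lemma bounded_lip_mul M f g : bounded_lip M f -> bounded_lip M g -> bounded_lip M (fun x => f x * g x).
Proof.
move=> [K K0 fK] [L L0 gL]; exists (K * L *+ 2) => [|x y xM yM].
  by rewrite mulrn_wge0 ?mulr_ge0.
have [f1 f2] := fK x y xM yM; have [g1 g2] := gL x y xM yM.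
have [f3 _] := fK y x yM xM.
split; first by rewrite normrM (le_trans (ler_pM _ _ f1 g1)) // mulr2n lerDl mulr_ge0.
have -> : f x * g x - f y * g y = (f x - f y) * g x + f y * (g x - g y) by ring.
rewrite (le_trans (ler_normD _ _)) // !normrM mulrnAl mulr2n lerD //.
  by rewrite mulrAC ler_pM.
by rewrite -mulrA ler_pM.
Qed.

Lemma bounded_lip_mono M (e : {ffun 'I_d -> nat}) : bounded_lip M (mono e).
Proof.
rewrite /mono; elim: (index_enum _) => [|i l IH].
  by apply: bounded_lip_eq (bounded_lip_cst M 1) => x; rewrite big_nil.
apply: (@bounded_lip_eq M (fun x => x 0 i ^+ e i * \prod_(j <- l) x 0 j ^+ e j)).
  by move=> x; rewrite big_cons.
apply: bounded_lip_mul => //; elim: (e i) => [|n IHn]; first by apply: bounded_lip_eq (bounded_lip_cst M 1).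
apply: (@bounded_lip_eq M (fun x => x 0 i * x 0 i ^+ n)) => [x|]; first by rewrite exprS.
by apply: bounded_lip_mul => //; exact: bounded_lip_coord.
Qed.

Lemma bounded_lip_feval M (s : fpol) : bounded_lip M (feval s).
Proof.
elim: s => [|p s IH].
  by apply: bounded_lip_eq (bounded_lip_cst M 0) => x; rewrite /feval big_nil.
apply: (@bounded_lip_eq M (fun x => p.1 * mono p.2 x + feval s x)).
  by move=> x; rewrite /feval big_cons.
apply: bounded_lip_add => //; apply: bounded_lip_mul; [exact: bounded_lip_cst|exact: bounded_lip_mono].
Qed.

Lemma bounded_lip_Ppoly M r f : Ppoly r f -> bounded_lip M f.
Proof.
by move=> /Ppoly_fpol[s _ fE]; apply: bounded_lip_eq (bounded_lip_feval M s) => x; rewrite fE.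
Qed.

End formal_polynomials.

(** * Tensor product quadrature *)
Section tensor_quadrature.
Variables (R : realType) (d : nat).
Implicit Types (x y c : 'rV[R]_d).

(** The integral of [t ^ n] over [u - r, u + r]. *)
Definition pint n (u r : R) : R := ((u + r) ^+ n.+1 - (u - r) ^+ n.+1) / n.+1%:R.

(** The integral over the cube of centre [c] and half-side [r], term by term. *)
Definition fint (s : fpol R d) c r : R :=
  \sum_(p <- s) p.1 * \prod_i pint (p.2 i) (c 0 i) r.

Lemma intpXn n : intp 'X^n = pint n 0 1 :> R.
Proof.
have -> : 'X^n = ((n.+1%:R)^-1 *: 'X^(n.+1))^`() :> {poly R}.
  rewrite derivZ derivXn /= -['X^n *+ _]scaler_nat scalerA mulVf ?scale1r // pnatr_eq0.
by rewrite intp_deriv !hornerE /pint add0r sub0r mulrC mulrBl; congr (_ - _); rewrite mulrC.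
Qed.

(** The centres of the [2 ^ d] cubes into which bisection of all axes divides a cube. *)
Definition halfshift c r (b : {ffun 'I_d -> bool}) : 'rV[R]_d :=
  \row_i (c 0 i + (if b i then r else - r) / 2).

Lemma pint_bisect n u r :
  pint n u r = \sum_(b : bool) pint n (u + (if b then r else - r) / 2) (r / 2).
Proof.
rewrite big_bool /= /pint -mulrDl; congr (_ / _).
have -> : u + r / 2 + r / 2 = u + r by field.
have -> : u + r / 2 - r / 2 = u by field.
have -> : u + - r / 2 + r / 2 = u by field.
have -> : u + - r / 2 - r / 2 = u - r by field.
by rewrite addrC addrA subrK addrC.
Qed.

Lemma fint_bisect s c r :
  fint s c r = \sum_(b : {ffun 'I_d -> bool}) fint s (halfshift c r b) (r / 2).
Proof.
rewrite /fint exchange_big /=; apply: eq_bigr => p _.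
rewrite -mulr_sumr; congr (_ * _).
under eq_bigr do rewrite pint_bisect.
rewrite bigA_distr_bigA; apply: eq_bigr => b _; apply: eq_bigr => i _.
by rewrite mxE.
Qed.

Lemma ler_norm_prodB (I : Type) (l : seq I) (a b : I -> R) :
  (forall i, `|a i| <= 1) -> (forall i, `|b i| <= 1) ->
  `|\prod_(i <- l) a i - \prod_(i <- l) b i| <= \sum_(i <- l) `|a i - b i|.
Proof.
move=> a1 b1; elim: l => [|i l IH]; first by rewrite !big_nil subrr normr0.
rewrite !big_cons; set A := \prod_(j <- l) a j; set B := \prod_(j <- l) b j.
have -> : a i * A - b i * B = (a i - b i) * A + b i * (A - B) by ring.
rewrite (le_trans (ler_normD _ _)) // !normrM lerD //.
  by rewrite ler_piMr // /A normr_prod prodr_ile1 // => j _; rewrite normr_ge0 a1.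
by rewrite (le_trans _ IH) // ler_piMl.
Qed.

Lemma exprB_le n (u v : R) : `|u| <= 1 -> `|v| <= 1 ->
  `|u ^+ n - v ^+ n| <= n%:R * `|u - v|.
Proof.
move=> u1 v1; have := @ler_norm_prodB _ (iota 0 n) (fun=> u) (fun=> v) (fun=> u1) (fun=> v1).
by rewrite !big_const_seq count_predT size_iota iter_mulr_1 iter_mulr_1 iter_addr_0 mulr_natl.
Qed.

(** The mean value of [t ^ n] over [u - r, u + r], from [a ^ n.+1 - b ^ n.+1]
    [= (a - b) (a ^ n + a ^ (n - 1) b + ... + b ^ n)]. *)
Definition pavg n (u r : R) : R :=
  (\sum_(i < n.+1) (u + r) ^+ (n - i) * (u - r) ^+ i) / n.+1%:R.

Lemma pintE n u r : pint n u r = 2 * r * pavg n u r.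
Proof.
rewrite /pint /pavg subrXX mulrA; congr (_ * _ / _); ring.
Qed.

Lemma pavg_close n u r : 0 <= r -> `|u| + r <= 1 -> `|pavg n u r - u ^+ n| <= n%:R * r.
Proof.
move=> r0 ur.
have p1 : `|u + r| <= 1 by rewrite (le_trans (ler_normD _ _)) // (ger0_norm r0).
have m1 : `|u - r| <= 1 by rewrite (le_trans (ler_normB _ _)) // (ger0_norm r0).
have u1 : `|u| <= 1 by rewrite (le_trans _ ur) // lerDl.
have n0 : n.+1%:R != 0 :> R by rewrite pnatr_eq0.
have -> : pavg n u r - u ^+ n =
    (\sum_(i < n.+1) ((u + r) ^+ (n - i) * (u - r) ^+ i - u ^+ (n - i) * u ^+ i)) / n.+1%:R.
  rewrite big_split /= mulrDl; congr (_ + _).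
  rewrite (eq_bigr (fun=> - u ^+ n)) => [|i _]; last by rewrite -exprD subnK // -ltnS.
  by rewrite sumr_const card_ord -[_ *+ n.+1]mulr_natr mulfK.
rewrite normrM normfV (@ger0_norm _ n.+1%:R) ?ler0n // ler_pdivrMr ?ltr0n //.
rewrite (le_trans (ler_norm_sum _ _ _)) //.
rewrite (le_trans (y := \sum_(i < n.+1) n%:R * r)) //; last first.
  by rewrite sumr_const card_ord mulr_natr.
apply: ler_sum => i _; have [in_] : (i <= n)%N by rewrite -ltnS.
have e1 := exprB_le (n - i) p1 u1; have e2 := exprB_le i m1 u1.
have -> : (u + r) ^+ (n - i) * (u - r) ^+ i - u ^+ (n - i) * u ^+ i =
  ((u + r) ^+ (n - i) - u ^+ (n - i)) * (u - r) ^+ i +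
  u ^+ (n - i) * ((u - r) ^+ i - u ^+ i) by ring.
have -> : n%:R = (n - i)%:R + i%:R :> R by rewrite -natrD subnK.
rewrite (le_trans (ler_normD _ _)) // [leRHS]mulrDl lerD //.
  rewrite normrM (le_trans (ler_piMr _ _)) //; first by rewrite normrX exprn_ile1.
  by rewrite (le_trans e1) // addrAC subrr add0r (ger0_norm r0).
rewrite normrM (le_trans (ler_piMl _ _)) //; first by rewrite normrX exprn_ile1.
by rewrite (le_trans e2) // addrAC subrr add0r normrN (ger0_norm r0).
Qed.

Lemma pavg_le1 n u r : 0 <= r -> `|u| + r <= 1 -> `|pavg n u r| <= 1.
Proof.
move=> r0 ur.
have p1 : `|u + r| <= 1 by rewrite (le_trans (ler_normD _ _)) // (ger0_norm r0).
have m1 : `|u - r| <= 1 by rewrite (le_trans (ler_normB _ _)) // (ger0_norm r0).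
rewrite normrM normfV (@ger0_norm _ n.+1%:R) ?ler0n // ler_pdivrMr ?ltr0n // mul1r.
rewrite (le_trans (ler_norm_sum _ _ _)) //.
rewrite (le_trans (y := \sum_(i < n.+1) 1)) //; last by rewrite sumr_const card_ord.
apply: ler_sum => i _; rewrite normrM mulr_ile1 // normrX exprn_ile1 //.
Qed.

(** On a small cube the integral is the value at the centre times the volume. *)
Lemma fint_close (s : fpol R d) : exists2 K, 0 <= K & forall c r, 0 <= r ->
  (forall i, `|c 0 i| + r <= 1) ->
  `|fint s c r - (2 * r) ^+ d * feval s c| <= K * r * (2 * r) ^+ d.
Proof.
exists (\sum_(p <- s) `|p.1| * \sum_i (p.2 i)%:R).
  by apply: sumr_ge0 => p _; rewrite mulr_ge0 // sumr_ge0.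
move=> c r r0 cr.
have -> : fint s c r - (2 * r) ^+ d * feval s c = (2 * r) ^+ d *
    \sum_(p <- s) p.1 * (\prod_i pavg (p.2 i) (c 0 i) r - mono p.2 c).
  rewrite /fint /feval !mulr_sumr -sumrB; apply: eq_bigr => p _.
  rewrite (eq_bigr (fun i => 2 * r * pavg (p.2 i) (c 0 i) r)) => [|i _]; last exact: pintE.
  by rewrite big_split prodr_const card_ord /=; ring.
have D0 : 0 <= (2 * r) ^+ d by rewrite exprn_ge0 // mulr_ge0.
rewrite normrM (ger0_norm D0) mulrC ler_wpM2r //.
rewrite (le_trans (ler_norm_sum _ _ _)) // mulr_suml; apply: ler_sum => p _.
rewrite normrM -mulrA ler_wpM2l // /mono.
rewrite (le_trans (ler_norm_prodB _ _ _)) //.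
- by move=> i; exact: pavg_le1.
- by move=> i; rewrite normrX exprn_ile1 // (le_trans _ (cr i)) // lerDl.
- by rewrite mulr_suml; apply: ler_sum => i _; exact: pavg_close.
Qed.

Variables (n : nat) (xg : 'I_n -> R).
Hypothesis gx : gauss_nodes xg.
Local Notation gp := (@gauss_point R d n xg).

(** The sum over the tensor grid factors into one-dimensional Gauss rules. *)
Lemma fint_quadrature (s : fpol R d) : degs_le (fun=> (n + n).-1) s -> (0 < n)%N ->
  fint s 0 1 = \sum_k tensor_weight xg k * feval s (gp k).
Proof.
move=> sn n0; rewrite /fint /feval.
under [RHS]eq_bigr do rewrite mulr_sumr.
rewrite exchange_big /= big_seq [RHS]big_seq; apply: eq_bigr => p ps.
under [RHS]eq_bigr do rewrite mulrCA.
rewrite -mulr_sumr; congr (_ * _).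
rewrite (eq_bigr (fun i => \sum_k gauss_weight xg k * xg k ^+ p.2 i)) => [|i _].
  rewrite bigA_distr_bigA; apply: eq_bigr => k _.
  by rewrite big_split /=; congr (_ * _); apply: eq_bigr => i _; rewrite mxE.
rewrite mxE -intpXn -(gauss_exact gx).
  by apply: eq_bigr => k _; rewrite gauss_weightE // hornerXn.
rewrite size_polyXn; have /forallP /(_ i) := allP sn _ ps.
by case: (n) n0 => // m _; rewrite addSn ltnS.
Qed.

Lemma tensor_weight_gt0 (k : {ffun 'I_d -> 'I_n}) : 0 < tensor_weight xg k.
Proof. by apply: prodr_gt0 => i _; rewrite gauss_weightE // lagrange_weight_gt0. Qed.

Lemma gauss_point_That k : That (gp k).
Proof. by move=> i; rewrite mxE; have /andP[/ltW -> /ltW ->] := gauss_node_itv gx (k i). Qed.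

(** Expand every factor of a monomial by Lagrange interpolation in one variable and
    distribute the product. *)
Lemma Ppoly_interp f y : (0 < n)%N -> Ppoly n.-1 f ->
  f y = \sum_k f (gp k) * \prod_i (lagrange_poly xg (k i)).[y 0 i].
Proof.
move=> n0 /Ppoly_fpol[s sn fE]; rewrite fE /feval.
under [RHS]eq_bigr do rewrite fE /feval mulr_suml.
rewrite exchange_big /= big_seq [RHS]big_seq; apply: eq_bigr => p ps.
under [RHS]eq_bigr do rewrite -mulrA.
rewrite -mulr_sumr; congr (_ * _).
rewrite /mono (eq_bigr (fun i => \sum_k xg k ^+ p.2 i * (lagrange_poly xg k).[y 0 i])) => [|i _].
  rewrite bigA_distr_bigA; apply: eq_bigr => k _.
  by rewrite big_split /=; congr (_ * _); apply: eq_bigr => i _; rewrite mxE.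
have sp : (size ('X^(p.2 i) : {poly R}) <= n)%N.
  by rewrite size_polyXn; have /forallP /(_ i) := allP sn _ ps; rewrite -ltnS prednK.
have := congr1 (fun q => q.[y 0 i]) (lagrange_poly_interp gx sp).
by rewrite hornerXn horner_sum => ->; apply: eq_bigr => k _; rewrite !hornerE.
Qed.

(** Hence a nodal basis is the tensor product Lagrange basis, and expands every
    polynomial of the space. *)
Lemma lagrange_basis_interp phih f y : (0 < n)%N -> lagrange_basis xg phih ->
  Ppoly n.-1 f -> f y = \sum_k f (gp k) * phih k y.
Proof.
move=> n0 hphi fP; rewrite (Ppoly_interp y n0 fP); apply: eq_bigr => k _.
congr (_ * _); rewrite (Ppoly_interp y n0 (hphi k).1) (bigD1 k) //= [X in _ + X]big1.
  by rewrite (hphi k).2 eqxx mul1r addr0.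
by move=> l lk; rewrite (hphi k).2 eq_sym (negbTE lk) mul0r.
Qed.

End tensor_quadrature.

(** * Bisection of cubes *)
Section bisection.
Variables (R : realType) (d : nat).

(** A set function of cubes that is subadditive under bisection and of smaller
    order than the volume on small cubes is nonpositive: bisect [m] times. *)
Lemma bisection_le0 (Phi : 'rV[R]_d -> R -> R) (K r0 : R) : 0 <= K -> 0 < r0 ->
  (forall (c : 'rV[R]_d) r, 0 < r -> (forall i, `|c 0 i| + r <= 1) ->
     Phi c r <= \sum_(b : {ffun 'I_d -> bool}) Phi (halfshift c r b) (r / 2)) ->
  (forall (c : 'rV[R]_d) r, 0 < r -> r <= r0 -> (forall i, `|c 0 i| + r <= 1) ->
     Phi c r <= K * r * r ^+ d) ->
  Phi 0 1 <= 0.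
Proof.
move=> K0 r00 Hsub Hsmall.
have key m (c : 'rV[R]_d) r : 0 < r -> r / 2 ^+ m <= r0 -> (forall i, `|c 0 i| + r <= 1) ->
    Phi c r <= K * (r / 2 ^+ m) * r ^+ d.
  elim: m c r => [|m IH] c r r_gt0 rm cr.
    by move: rm; rewrite expr0 divr1 => rm; exact: Hsmall.
  have h0 : 0 < r / 2 by rewrite divr_gt0.
  have rm2 : r / 2 / 2 ^+ m = r / 2 ^+ m.+1 by rewrite exprS invfM mulrA.
  rewrite (le_trans (Hsub c r r_gt0 cr)) //.
  rewrite (le_trans (y := \sum_(b : {ffun 'I_d -> bool}) K * (r / 2 ^+ m.+1) * (r / 2) ^+ d)) //.
    apply: ler_sum => b _; rewrite -rm2; apply: IH => //; first by rewrite rm2.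
    move=> i; rewrite mxE.
    have : `|(if b i then r else - r) / 2| = r / 2.
      by case: (b i); rewrite ?mulNr ?normrN gtr0_norm.
    have := cr i; have := ler_normD (c 0 i) ((if b i then r else - r) / 2).
    by move: (`|c 0 i + _|) => A h1 h2 h3; rewrite h3 in h1; lra.
  rewrite sumr_const card_ffun card_bool card_ord -[_ *+ _ ^ _]mulr_natr -mulrA natrX.
  by rewrite -exprMn divfK.
apply/ler_addgt0Pr => e e0; rewrite add0r.
have K1 : 0 < K + 1 by rewrite ltr_wpDl.
have w0 : 0 < Num.min r0 (e / (K + 1)) by rewrite lt_min r00 divr_gt0.
have [m] : exists m : nat, 1 / 2 ^+ m <= Num.min r0 (e / (K + 1)).
  exists (Num.truncn (Num.min r0 (e / (K + 1)))^-1).+1.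
  rewrite div1r -[leRHS]invrK lef_pV2 ?posrE ?invr_gt0 ?exprn_gt0 //.
  by rewrite (le_trans (ltW (truncnS_gt _))) // -natrX ler_nat ltnW // ltn_expl.
rewrite le_min => /andP[m1 m2]; have := key m 0 1 ltr01 m1.
rewrite expr1n mulr1 => h; apply: le_trans (h _) _ => [i|].
  by rewrite mxE normr0 add0r.
rewrite (le_trans (ler_wpM2l K0 m2)) // mulrCA ler_piMr ?(ltW e0) //.
by rewrite ler_pdivrMr // mul1r lerDl.
Qed.

End bisection.

(** * Multi-affine maps *)
Section multiaffine.
Variables (R : realType) (d : nat).
Implicit Types (x y u v c : 'rV[R]_d) (f : 'rV[R]_d -> R).

Definition set_coord x (i : 'I_d) (t : R) : 'rV[R]_d := \row_j if j == i then t else x 0 j.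

(** For a function that is affine in the [i]-th variable, the partial derivative. *)
Definition slope f (i : 'I_d) x : R := f (set_coord x i 1) - f (set_coord x i 0).

Lemma mono_set_coord (e : {ffun 'I_d -> nat}) x i t :
  mono e (set_coord x i t) = t ^+ e i * \prod_(j | j != i) x 0 j ^+ e j.
Proof.
rewrite /mono (bigD1 i) //= mxE eqxx; congr (_ * _); apply: eq_bigr => j ji.
by rewrite mxE (negbTE ji).
Qed.

Lemma slopeE f i x t t' : Ppoly 1 f ->
  f (set_coord x i t) - f (set_coord x i t') = (t - t') * slope f i x.
Proof.
move=> /Ppoly_fpol[s s1 fE]; rewrite /slope !fE /feval -!sumrB mulr_sumr.
rewrite big_seq [RHS]big_seq; apply: eq_bigr => p ps; rewrite !mono_set_coord.
have /forallP/(_ i) := allP s1 _ ps.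
by case: (p.2 i) => [|[|]] // _; rewrite ?expr0 ?expr1; ring.
Qed.

Definition fslope (i : 'I_d) (s : fpol R d) : fpol R d :=
  [seq (p.1, [ffun j => if j == i then 0 else p.2 j]%N) |
     p : R * {ffun 'I_d -> nat} <- [seq p : R * {ffun 'I_d -> nat} <- s | p.2 i == 1%N]].

Lemma feval_slope f i (s : fpol R d) x : degs_le (fun=> 1%N) s ->
  (forall x, f x = feval s x) -> slope f i x = feval (fslope i s) x.
Proof.
move=> s1 fE; rewrite /slope !fE /feval -sumrB big_map big_filter [RHS]big_mkcond /=.
rewrite big_seq [RHS]big_seq; apply: eq_bigr => p ps; rewrite !mono_set_coord -mulrBr -mulrBl.
have -> : mono [ffun j => if j == i then 0 else p.2 j]%N x =
    \prod_(j | j != i) x 0 j ^+ p.2 j.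
  rewrite /mono (bigD1 i) //= ffunE eqxx expr0 mul1r; apply: eq_bigr => j ji.
  by rewrite ffunE (negbTE ji).
have /forallP/(_ i) := allP s1 _ ps.
by case: (p.2 i) => [|[|]] // _; rewrite ?expr0 ?expr1 ?subrr ?subr0 ?mul0r ?mulr0 ?mul1r.
Qed.

Lemma degs_le_slope i (s : fpol R d) : degs_le (fun=> 1%N) s ->
  degs_le (fun j => (j != i) : nat) (fslope i s).
Proof.
move=> s1; apply/allP => _ /mapP[p + -> /=]; rewrite mem_filter => /andP[_ ps].
apply/forallP => j; rewrite ffunE; case: eqP => // _.
by have /forallP/(_ j) := allP s1 _ ps.
Qed.

Lemma Ppoly_slope f i : Ppoly 1 f -> Ppoly 1 (slope f i).
Proof.
move=> /Ppoly_fpol[s s1 fE]; apply: (@fpol_Ppoly _ _ 1 (fslope i s)).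
  by apply: degs_leW (degs_le_slope i s1) => j; exact: leq_b1.
by move=> x; exact: feval_slope.
Qed.

(** The increment of a multi-affine function is a telescoping sum of increments
    along the axes, each of them exact; freezing the slopes at [c] costs a
    quadratically small error. *)
Lemma multiaffine_increment f M : Ppoly 1 f -> exists2 K, 0 <= K &
  forall c u v r, `|c| <= M -> `|u| <= M -> `|v| <= M -> 0 <= r ->
    `|u - c| <= r -> `|v - c| <= r ->
    `|f u - f v - \sum_i (u 0 i - v 0 i) * slope f i c| <= K * r * `|u - v|.
Proof.
move=> f1; have lip i := bounded_lip_Ppoly M (Ppoly_slope i f1).
have /choice[k kP] : forall i, exists k, 0 <= k /\ forall x y, `|x| <= M -> `|y| <= M ->
    `|slope f i x - slope f i y| <= k * `|x - y|.
  by move=> i; have [k k0 kP] := lip i; exists k; split=> // x y xM yM; have [] := kP x y xM yM.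
exists (\sum_i k i) => [|c u v r cM uM vM r0 uc vc].
  by apply: sumr_ge0 => i _; have [] := kP i.
pose h (m : nat) : 'rV[R]_d := \row_j if (j < m)%N then v 0 j else u 0 j.
have hM m : `|h m| <= M.
  apply: norm_le_coord => [|i]; first exact: le_trans (normr_ge0 c) cM.
  by rewrite mxE; case: ifP => _; exact: le_trans (coord_le_norm _ i) _.
have hc m : `|h m - c| <= r.
  apply: norm_le_coord => // i; rewrite !mxE.
  have := le_trans (coord_le_norm (u - c) i) uc; have := le_trans (coord_le_norm (v - c) i) vc.
  by rewrite !mxE; case: ifP.
have step (i : 'I_d) : f (h i) - f (h i.+1) = (u 0 i - v 0 i) * slope f i (h i).
  rewrite -slopeE //; congr (f _ - f _); apply/rowP => j; rewrite !mxE.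
    by case: eqP => // ->; rewrite ltnn.
  by rewrite ltnS leq_eqVlt val_eqE; case: eqP => [->|].
have -> : f u - f v = \sum_(i < d) (u 0 i - v 0 i) * slope f i (h i).
  rewrite (eq_bigr (fun i : 'I_d => f (h i) - f (h i.+1))) => [|i _]; last by rewrite step.
  rewrite -(big_mkord xpredT (fun i => f (h i) - f (h i.+1))) -[RHS]opprK -sumrN.
  rewrite (eq_bigr (fun i => f (h i.+1) - f (h i))) => [|i _]; last by rewrite opprB.
  rewrite telescope_sumr // opprB; congr (f _ - f _); apply/rowP => j; rewrite mxE //.
  by rewrite ltn_ord.
rewrite -sumrB (le_trans (ler_norm_sum _ _ _)) // -mulrA mulr_suml.
apply: ler_sum => i _; rewrite -mulrBr normrM mulrC mulrA ler_pM //.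
  have [k0 kl] := kP i; rewrite (le_trans (kl _ _ (hM _) cM)) // ler_wpM2l //.
by have := coord_le_norm (u - v) i; rewrite !mxE.
Qed.

End multiaffine.

(** * Geometry of multi-affine elements *)
(** Row vectors form a complete normed space, as Banach's fixed point theorem
    requires. *)
HB.instance Definition _ (R : realType) n := Complete.on 'rV[R]_n.

Lemma lipschitz_at_continuous (R : realType) (V W : normedModType R) (f : V -> W) x K :
  0 <= K -> (forall y, `|y - x| <= 1 -> `|f y - f x| <= K * `|y - x|) ->
  continuous_at x f.
Proof.
move=> K0 KP; apply/cvgrPdist_le => e e0; apply/nbhs_ballP.
have K1 : 0 < K + 1 by rewrite ltr_wpDl.
have w0 : 0 < Num.min 1 (e / (K + 1)) by rewrite lt_min ltr01 divr_gt0.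
exists (Num.min 1 (e / (K + 1))) => //= y.
rewrite -ball_normE /= lt_min distrC => /andP[y1 y2].
rewrite distrC (le_trans (KP _ (ltW y1))) //.
rewrite (le_trans (ler_wpM2l K0 (ltW y2))) // mulrCA ler_piMr ?(ltW e0) //.
by rewrite ler_pdivrMr // mul1r lerDl.
Qed.

Section element_geometry.
Variables (R : realType) (d : nat) (F : 'rV[R]_d -> 'rV[R]_d).
Hypothesis Faff : forall j, Ppoly 1 (fun x => F x 0 j).
Implicit Types (x y u v c h z : 'rV[R]_d).

Definition Jac x : 'M[R]_d := \matrix_(i, j) slope (fun y => F y 0 j) i x.

Lemma multiaffine_map_increment M : exists2 K, 0 <= K & forall c u v r,
  `|c| <= M -> `|u| <= M -> `|v| <= M -> 0 <= r -> `|u - c| <= r -> `|v - c| <= r ->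
  `|F u - F v - (u - v) *m Jac c| <= K * r * `|u - v|.
Proof.
have /choice[k kP] : forall j, exists k, 0 <= k /\ forall c u v r,
    `|c| <= M -> `|u| <= M -> `|v| <= M -> 0 <= r -> `|u - c| <= r -> `|v - c| <= r ->
    `|F u 0 j - F v 0 j - \sum_i (u 0 i - v 0 i) * slope (fun y => F y 0 j) i c| <= k * r * `|u - v|.
  by move=> j; have [k k0 kP] := multiaffine_increment M (Faff j); exists k.
have k0 j : 0 <= k j by have [] := kP j.
exists (\sum_j k j) => [|c u v r cM uM vM r0 uc vc]; first exact: sumr_ge0.
apply: norm_le_coord => [|j]; first by rewrite !mulr_ge0 // sumr_ge0.
rewrite !mxE; under eq_bigr do rewrite !mxE.
have [_ H] := kP j; rewrite (le_trans (H c u v r _ _ _ _ _ _)) // -!mulrA.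
rewrite ler_wpM2r ?mulr_ge0 // (bigD1 j) //= lerDl sumr_ge0 //.
Qed.

Lemma map_lipschitz M : exists2 K, 0 <= K & forall u v, `|u| <= M -> `|v| <= M ->
  `|F u - F v| <= K * `|u - v|.
Proof.
have /choice[k kP] : forall j, exists k, 0 <= k /\ forall u v, `|u| <= M -> `|v| <= M ->
    `|F u 0 j - F v 0 j| <= k * `|u - v|.
  move=> j; have [k k0 kP] := bounded_lip_Ppoly M (Faff j); exists k; split=> // u v uM vM.
  by have [] := kP u v uM vM.
have k0 j : 0 <= k j by have [] := kP j.
exists (\sum_j k j) => [|u v uM vM]; first exact: sumr_ge0.
apply: norm_le_coord => [|j]; first by rewrite !mulr_ge0 // sumr_ge0.
rewrite !mxE; have [_ H] := kP j; rewrite (le_trans (H u v _ _)) //.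
rewrite ler_wpM2r // (bigD1 j) //= lerDl sumr_ge0 //.
Qed.

Lemma map_continuous : continuous F.
Proof.
move=> x; have [K K0 KP] := map_lipschitz (`|x| + 1).
apply: (lipschitz_at_continuous (K := K)) => // y xy; apply: KP.
  by rewrite -[y](subrK x) addrC (le_trans (ler_normD _ _)) // lerD2l.
by rewrite lerDl.
Qed.

Lemma jacobianE x : 'J F x = Jac x.
Proof.
pose df : {linear 'rV[R]_d -> 'rV[R]_d} := mulmxr (Jac x).
have [L L0 dfL] : exists2 L, 0 <= L & forall h, `|df h| <= L * `|h|.
  exists (\sum_i \sum_j `|Jac x i j|) => [|h]; first by do 2 apply: sumr_ge0 => ? _.
  apply: norm_le_coord => [|j]; first by rewrite mulr_ge0 //; do 2 apply: sumr_ge0 => ? _.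
  rewrite mxE (le_trans (ler_norm_sum _ _ _)) // mulr_suml; apply: ler_sum => i _.
  rewrite normrM mulrC ler_pM ?coord_le_norm // (bigD1 j) //= lerDl sumr_ge0 //.
have dfc : continuous df.
  move=> h; apply: (lipschitz_at_continuous (K := L)) => // y _.
  by rewrite -linearB.
have E : 'd F x = df :> ('rV[R]_d -> 'rV[R]_d).
  apply: diff_unique => //; apply/eqaddoP => e e0.
  have [K K0 KP] := multiaffine_map_increment (`|x| + 1).
  have K1 : 0 < K + 1 by rewrite ltr_wpDl.
  have w0 : 0 < Num.min 1 (e / (K + 1)) by rewrite lt_min ltr01 divr_gt0.
  apply/nbhs_ballP; exists (Num.min 1 (e / (K + 1))) => //= h.
  rewrite -ball_normE /= sub0r normrN lt_min => /andP[h1 h2].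
  have -> : (F \o shift x - (cst (F x) + df)) h = F (h + x) - F x - (h + x - x) *m Jac x.
    by rewrite addrK /= /df /= opprD addrA.
  rewrite (le_trans (KP x (h + x) x `|h| _ _ _ _ _ _)) ?lerDl ?addrK ?subrr ?normr0 //.
    by rewrite addrC (le_trans (ler_normD _ _)) // lerD2l ltW.
  rewrite ler_wpM2r // (le_trans (ler_wpM2l K0 (ltW h2))) // mulrCA ler_piMr ?(ltW e0) //.
  by rewrite ler_pdivrMr // mul1r lerDl.
apply/matrixP => i j; rewrite /jacobian mxE E /df /= -rowE mxE //.
Qed.

Lemma fpol_prod (I : Type) (l : seq I) (e : I -> 'I_d -> nat) (f : I -> 'rV[R]_d -> R) :
  (forall i, exists2 s : fpol R d, degs_le (e i) s & forall x, f i x = feval s x) ->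
  exists2 s : fpol R d, degs_le (fun k => \sum_(i <- l) e i k)%N s &
    forall x, \prod_(i <- l) f i x = feval s x.
Proof.
move=> H; elim: l => [|i l [s se sE]].
  by exists (fone R d) => [|x]; rewrite ?degs_le_one // big_nil feval_one.
have [t te tE] := H i; exists (fmul t s).
  by apply: degs_leW (degs_le_mul te se) => k; rewrite big_cons.
by move=> x; rewrite big_cons feval_mul tE sE.
Qed.

(** The determinant of the Jacobian has degree at most [d - 1] in each variable,
    because the row of the derivative in that variable does not contain it. *)
Lemma det_Jac_fpol : exists2 s : fpol R d, degs_le (fun=> d.-1) s &
  forall x, \det (Jac x) = feval s x.
Proof.
have H (s : {perm 'I_d}) : exists2 t : fpol R d, degs_le (fun=> d.-1) t &
    forall x, (-1) ^+ s * \prod_i Jac x i (s i) = feval t x.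
  have [i|t te tE] := @fpol_prod _ (index_enum 'I_d) (fun i k => k != i : nat)
    (fun i x => Jac x i (s i)).
    have [t t1 tE] := Ppoly_fpol (Faff (s i)).
    exists (fslope i t); first exact: degs_le_slope.
    by move=> x; rewrite mxE (feval_slope _ _ t1).
  exists (fscale ((-1) ^+ s) t).
    rewrite degs_le_scale; apply: degs_leW te => k.
    rewrite (bigD1 k) //= eqxx add0n (eq_bigr (fun=> 1%N)) => [|i ik].
      by rewrite sum1_card cardC1 card_ord.
    by rewrite eq_sym ik.
  by move=> x; rewrite feval_scale -tE.
have /choice[t tP] : forall s : {perm 'I_d}, exists t : fpol R d, degs_le (fun=> d.-1) t /\
    forall x, (-1) ^+ s * \prod_i Jac x i (s i) = feval t x.
  by move=> s; have [t ? ?] := H s; exists t.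
exists (flatten [seq t s | s <- index_enum {perm 'I_d}]).
  apply/allP => p /flattenP[_ /mapP[s _ ->] pt].
  by have [ts _] := tP s; exact: (allP ts).
move=> x; rewrite /feval big_flatten big_map; apply: eq_bigr => s _.
by have [_ ->] := tP s.
Qed.

Hypothesis Jinv : forall x, That x -> Jac x \in unitmx.

Lemma cube_That : That = cube (0 : 'rV[R]_d) 1.
Proof. by apply/seteqP; split => x H i; have := H i; rewrite mxE subr0 ler_norml. Qed.

Lemma That_norm x : That x <-> `|x| <= 1.
Proof. by rewrite cube_That cube_normP // subr0. Qed.

(** The Jacobian determinant has no zero on the cube, hence a constant sign: on
    the segment from the origin to [x] it is a polynomial in one variable. *)
Lemma det_Jac_sign : exists sg : R, forall x, That x -> `|\det (Jac x)| = sg * \det (Jac x).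
Proof.
have [s _ sE] := det_Jac_fpol.
exists (Num.sg (\det (Jac 0))) => x Tx.
have T0 : That (0 : 'rV[R]_d) by apply/That_norm; rewrite normr0 ler01.
rewrite normrEsg; congr (_ * _).
have d0 y : That y -> \det (Jac y) != 0 by move=> Ty; rewrite -unitfE -unitmxE Jinv.
pose q : {poly R} := \sum_(p <- s) (p.1 * mono p.2 x) *: 'X^(\sum_i p.2 i).
have qE t : q.[t] = \det (Jac (t *: x)).
  rewrite sE /q horner_sum; apply: eq_bigr => p _; rewrite hornerZ hornerXn -mulrA; congr (_ * _).
  rewrite mulrC /mono -prodrXr -big_split /=; apply: eq_bigr => i _.
  by rewrite mxE exprMn.
apply/eqP; rewrite eq_sym; apply: contraT => neq.
have : q.[0] * q.[1] <= 0.
  rewrite !qE scale0r scale1r; have := d0 _ T0; have := d0 _ Tx; move: neq.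
  by case: (sgrP (\det (Jac x))) => // hx; case: (sgrP (\det (Jac 0))) => // h0;
    rewrite ?eqxx // => _ _ _; [apply: mulr_le0_ge0; exact: ltW|apply: mulr_ge0_le0; exact: ltW].
move=> /(polyrcf.poly_ivt ler01)[t]; rewrite in_itv /= => /andP[t0 t1] /rootP; rewrite qE => /eqP.
rewrite (negbTE (d0 _ _)) //; apply/That_norm; rewrite normrZ ger0_norm //.
by rewrite mulr_ile1 //; exact/That_norm.
Qed.

Definition ocube c r : set 'rV[R]_d := [set x | `|x - c| < r].

(** The cube of centre [c] and half-side [r] lies in the reference cube. *)
Definition inside c r := forall i, `|c 0 i| + r <= 1.

Lemma inside_norm c r x : 0 <= r -> inside c r -> `|x - c| <= r -> `|x| <= 1.
Proof.
move=> r0 cr xr; apply: norm_le_coord => // i.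
have := le_trans (coord_le_norm _ i) xr; rewrite !mxE => xi.
rewrite -[x 0 i](subrK (c 0 i)) addrC (le_trans (ler_normD _ _)) //.
by rewrite (le_trans _ (cr i)) // lerD2l.
Qed.

Lemma inside_center c r : 0 <= r -> inside c r -> `|c| <= 1.
Proof. by move=> r0 cr; apply: (inside_norm r0 cr); rewrite subrr normr0. Qed.

Variable kappa : R.
Hypothesis kappa0 : 0 <= kappa.
Hypothesis Jbound : forall x z, That x -> `|z *m invmx (Jac x)| <= kappa * `|z|.

(** The increment of [F] differs from its linear part by [O(r ^ 2)], which is
    absorbed by enlarging the cube before applying the linear part. *)
Lemma image_cube_sub : exists2 K, 0 <= K & forall c r, 0 < r -> inside c r ->
  F @` cube c r `<=` [set F c + z *m Jac c | z in cube 0 (r * (1 + K * r))].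
Proof.
have [K K0 KP] := multiaffine_map_increment 1.
exists (kappa * K) => [|c r r0 cr]; first exact: mulr_ge0.
have r0' := ltW r0; have c1 := inside_center r0' cr.
have cT : That c by apply/That_norm.
move=> _ [x /(cube_normP _ _ r0') xr <-] /=; have x1 := inside_norm r0' cr xr.
exists ((F x - F c) *m invmx (Jac c)); last by rewrite mulmxKV ?Jinv // addrC subrK.
apply/cube_normP; first by rewrite mulr_ge0 // addr_ge0 ?ler01 // !mulr_ge0.
rewrite subr0 -[_ *m _](subrK (x - c)) -{1}[x - c](mulmxK (Jinv cT)) -mulmxBl.
rewrite (le_trans (ler_normD _ _)) // mulrDr mulr1 addrC lerD //.
rewrite (le_trans (Jbound _ cT)) // mulrCA -!mulrA ler_wpM2l //.
rewrite (le_trans (KP c x c r _ _ _ _ _ _)) ?subrr ?normr0 //.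
by rewrite -mulrA ler_wpM2l // ler_wpM2l.
Qed.

(** Conversely the image of a small open cube contains a slightly smaller
    parallelepiped, as solving [F (c + h) = F c + z *m Jac c] for [h] is a fixed
    point problem for a contraction. *)
Lemma image_ocube_sup : exists K r0, [/\ 0 <= K, 0 < r0, K * r0 <= 2^-1 &
  forall c r, 0 < r -> r <= r0 -> inside c r -> forall z, `|z| <= r * (1 - K * r) ->
    exists2 h, `|h| < r & F (c + h) = F c + z *m Jac c].
Proof.
have [K K0 KP] := multiaffine_map_increment 1.
set L := kappa * K; have L0 : 0 <= L by exact: mulr_ge0.
have L1 : 0 < 2 * (2 * L + 1) by lra.
exists (2 * L + 1), (2 * (2 * L + 1))^-1; split; [lra|by rewrite invr_gt0| |].
  by rewrite invfM mulrCA mulfV ?mulr1 //; apply/eqP; lra.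
move=> c r r0 rr cr z zr; have r0' := ltW r0; have c1 := inside_center r0' cr.
have cT : That c by apply/That_norm.
have Lr : (2 * L + 1) * r <= 2^-1.
  rewrite (le_trans (ler_wpM2l _ rr)) //; first lra.
  by rewrite invfM mulrCA mulfV ?mulr1 //; apply/eqP; lra.
(* On the ball of radius [rho] the error term is at most [L r ^ 2], and it takes
   [|z| <= r - (2 L + 1) r ^ 2] to at most [r - (L + 1) r ^ 2]. *)
pose rho := r - (L + 1) * r * r.
have rho_lt : rho < r by rewrite /rho ltrBlDr ltrDl !mulr_gt0 //; lra.
have rho0 : 0 <= rho by rewrite /rho; nra.
pose G h := z + h - (F (c + h) - F c) *m invmx (Jac c).
have normc h : `|h| <= rho -> `|c + h| <= 1.
  move=> hr; apply: (inside_norm r0' cr); rewrite addrC addKr.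
  exact: le_trans hr (ltW rho_lt).
have GB h h' : `|h| <= rho -> `|h'| <= rho -> `|G h - G h'| <= L * r * `|h - h'|.
  move=> hr hr'; have -> : G h - G h' = - ((F (c + h) - F (c + h') - (c + h - (c + h')) *m Jac c) *m invmx (Jac c)).
    rewrite mulmxBl mulmxK ?Jinv // /G !mulmxBl.
    by apply/rowP => i; rewrite !mxE; ring.
  rewrite normrN (le_trans (Jbound _ cT)) // /L -!mulrA ler_wpM2l //.
  have ar (w : 'rV[R]_d) : `|w| <= rho -> `|c + w - c| <= r.
    by move=> wr; rewrite addrC addKr (le_trans wr) // ltW.
  have := KP c (c + h) (c + h') r c1 (normc _ hr) (normc _ hr') r0' (ar _ hr) (ar _ hr').
  by rewrite -mulrA (_ : c + h - (c + h') = h - h') //; apply/rowP => i; rewrite !mxE; ring.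
have G0 : G 0 = z by rewrite /G !addr0 subrr mul0mx subr0.
pose U : set 'rV[R]_d := cube 0 rho.
have UE h : U h <-> `|h| <= rho by rewrite /U cube_normP // subr0.
have GU : {homo G : x / U x >-> U x}.
  move=> h /UE hr; apply/UE.
  have := GB h 0 hr; rewrite G0 normr0 subr0 => /(_ rho0) Gz.
  rewrite -[G h](subrK z) (le_trans (ler_normD _ _)) // (le_trans (lerD Gz zr)) //.
  have := ler_wpM2l (mulr_ge0 L0 r0') hr.
  have := ler_wpM2l (mulr_ge0 L0 r0') (ltW rho_lt).
  by rewrite /rho; lra.
have [|||p /UE pr pG] := @banach_fixed_point R 'rV[R]_d U (mkfun_fun GU).
- have Lr0 : 0 <= L * r by rewrite mulr_ge0.
  exists (NngNum Lr0); split => /=; first by lra.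
  move=> [h h'] [/= /UE hr /UE hr']; exact: GB.
- by apply: compact_closed; [exact: norm_hausdorff|exact: compact_cube].
- by exists 0; apply/UE; rewrite normr0.
exists p; first exact: le_lt_trans pr rho_lt.
have : (F (c + p) - F c) *m invmx (Jac c) = z.
  move: pG; rewrite /= /G => /eqP; rewrite -subr_eq0 => /eqP E.
  by apply/rowP => i; have := congr1 (fun v : 'rV[R]_d => v 0 i) E; rewrite !mxE; lra.
by move=> <-; rewrite mulmxKV ?Jinv // [RHS]addrC subrK.
Qed.

(** Around each point the image contains a parallelepiped, hence a ball. *)
Lemma image_ocube_open c r : inside c r -> open (F @` ocube c r).
Proof.
move=> cr; have [K [r0 [K0 r00 Kr0 HP]]] := image_ocube_sup.
rewrite openE => _ [x xr <-] /=; rewrite /ocube /= in xr.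
pose r' := Num.min r0 (r - `|x - c|).
have r'0 : 0 < r' by rewrite lt_min r00 subr_gt0.
have r'1 : r' <= r0 by rewrite ge_min lexx.
have r'2 : r' <= r - `|x - c| by rewrite ge_min lexx orbT.
have xr' : inside x r'.
  move=> i; have := cr i; have := coord_le_norm (x - c) i; rewrite !mxE => h1 h2.
  have := ler_normD (c 0 i) (x 0 i - c 0 i); rewrite addrC subrK => h3; lra.
have Kr' : K * r' <= 2^-1 by rewrite (le_trans _ Kr0) // ler_wpM2l.
have xT : That x by apply/That_norm; apply: inside_center (ltW r'0) xr'.
have k1 : 0 < kappa + 1 by rewrite ltr_wpDl.
have d0 : 0 < r' * (1 - K * r') / (kappa + 1) by rewrite divr_gt0 // mulr_gt0 //; lra.
apply/nbhs_ballP; exists (r' * (1 - K * r') / (kappa + 1)) => //= y.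
rewrite -ball_normE /= distrC => yx.
have [|h hr hE] := HP x r' r'0 r'1 xr' ((y - F x) *m invmx (Jac x)).
  rewrite (le_trans (Jbound _ xT)) // (le_trans (ler_wpM2l kappa0 (ltW yx))) //.
  rewrite mulrCA ler_piMr ?mulr_ge0 ?(ltW r'0) //; first by lra.
  by rewrite ler_pdivrMr // mul1r lerDl.
exists (x + h); last by rewrite hE mulmxKV ?Jinv // addrC subrK.
have := ler_normD (x - c) h; rewrite (_ : x - c + h = x + h - c); last first.
  by rewrite addrAC.
by move=> h1; rewrite /ocube /=; lra.
Qed.

Lemma measurable_image_ocube c r : inside c r -> measurable (F @` ocube c r).
Proof. by move=> cr; apply: open_measurable_rV; exact: image_ocube_open. Qed.

Lemma compact_image_cube c r : compact (F @` cube c r).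
Proof.
apply: continuous_compact; last exact: compact_cube.
by apply: continuous_subspaceT => x; exact: map_continuous.
Qed.

Lemma measurable_image_cube c r : measurable (F @` cube c r).
Proof. by apply: compact_measurable_rV; exact: compact_image_cube. Qed.

Local Notation leb := (lebesgue_rV R d).

Lemma measurable_affine_Jac c r : That c ->
  measurable [set F c + z *m Jac c | z in cube 0 r].
Proof. by move=> cT; apply: measurable_affine_cube; exact: Jinv. Qed.

Lemma lebesgue_image_cube_le : exists2 K, 0 <= K & forall c r, 0 < r -> inside c r ->
  (leb (F @` cube c r) <= (`|\det (Jac c)| * (2 * (r * (1 + K * r))) ^+ d)%:E)%E.
Proof.
have [K K0 KP] := image_cube_sub; exists K => // c r r0 cr.
have cT : That c by apply/That_norm; apply: inside_center (ltW r0) cr.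
rewrite -(lebesgue_affine_cube (F c)) ?Jinv //; last first.
  by rewrite mulr_ge0 ?(ltW r0) // addr_ge0 // mulr_ge0 // ltW.
apply: le_measure; last exact: KP.
  by apply: mem_set; exact: measurable_image_cube.
by apply: mem_set; exact: measurable_affine_Jac.
Qed.

Lemma lebesgue_image_ocube_ge : exists K r0, [/\ 0 <= K, 0 < r0, K * r0 <= 2^-1 &
  forall c r, 0 < r -> r <= r0 -> inside c r ->
  ((`|\det (Jac c)| * (2 * (r * (1 - K * r))) ^+ d)%:E <= leb (F @` ocube c r))%E].
Proof.
have [K [r0 [K0 r00 Kr KP]]] := image_ocube_sup; exists K, r0; split=> // c r r_gt0 rr cr.
have cT : That c by apply/That_norm; apply: inside_center (ltW r_gt0) cr.
have Kr' : K * r <= 2^-1 by rewrite (le_trans _ Kr) // ler_wpM2l.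
have r'0 : 0 <= r * (1 - K * r) by rewrite mulr_ge0 ?(ltW r_gt0) //; lra.
rewrite -(lebesgue_affine_cube (F c)) ?Jinv //.
apply: le_measure.
- by apply: mem_set; exact: measurable_affine_Jac.
- by apply: mem_set; exact: measurable_image_ocube.
move=> _ [z /(cube_normP _ _ r'0) zr <-]; rewrite subr0 in zr.
have [h hr <-] := KP c r r_gt0 rr cr z zr.
by exists (c + h) => //; rewrite /ocube /= addrC addKr.
Qed.

Hypothesis Finj : set_inj That F.
Local Notation cellF := (F @` That).
Local Notation invF := ('pinv_(fun=> 0) That F).

Lemma invFK x : That x -> invF (F x) = x.
Proof. by move=> xT; apply: pinvKV => //; exact: mem_set. Qed.

Lemma measurable_cellF : measurable cellF.
Proof. by rewrite cube_That; exact: measurable_image_cube. Qed.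

(** The preimages of closed half-spaces are images of compact sets. *)
Lemma measurable_invF i : measurable_fun cellF (fun y => invF y 0 i).
Proof.
apply: (measurability (@measurable_realfun.RGenCInfty.G R)).
  exact: measurable_realfun.RGenCInfty.measurableE.
move=> _ [_ [a ->] <-].
have -> : cellF `&` (fun y => invF y 0 i) @^-1` `[a, +oo[ =
    F @` (That `&` (fun x => x 0 i) @^-1` `[a, +oo[).
  apply/seteqP; split => [_ [[x xT <-]]|_ [x [xT xa] <-]] /=.
    by rewrite invFK // => xa; exists x.
  by rewrite invFK //; split => //; exists x.
apply: compact_measurable_rV; apply: continuous_compact.
  by apply: continuous_subspaceT => x; exact: map_continuous.
rewrite cube_That; apply: compact_closedI; first exact: compact_cube.
apply: (@closed_comp _ _ (fun x : 'rV[R]_d => x 0 i)); last exact: interval_closed.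
by move=> x _; exact: coord_continuous.
Qed.

Lemma lebesgue_sub_cellF_fin E : measurable E -> E `<=` cellF -> (leb E < +oo)%E.
Proof.
move=> mE Ec; have [K K0 KP] := lebesgue_image_cube_le.
apply: le_lt_trans (ltry _); apply: le_trans (KP 0 1 ltr01 _).
  apply: le_measure; [exact: mem_set|by apply: mem_set; exact: measurable_image_cube|].
  by rewrite -cube_That.
by move=> i; rewrite mxE normr0 add0r.
Qed.

Lemma measurable_pull (s : fpol R d) E : measurable E -> E `<=` cellF ->
  measurable_fun E (fun y => feval s (invF y)).
Proof.
move=> mE Ec; apply: (measurable_funS measurable_cellF Ec).
apply: measurable_sum => p; apply: measurable_funM => //.
apply: measurable_prod => i _; apply: measurable_funX; exact: measurable_invF.
Qed.

Lemma integrable_pull (s : fpol R d) E : measurable E -> E `<=` cellF ->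
  leb.-integrable E (EFin \o (fun y => feval s (invF y))).
Proof.
move=> mE Ec; apply: measurable_bounded_integrable => //.
- exact: lebesgue_sub_cellF_fin.
- exact: measurable_pull.
have [K K0 KP] := bounded_lip_feval 1 s.
exists K; split; first exact: num_real.
move=> M KM _ /= /Ec [x xT <-]; rewrite invFK //.
have x1 := (That_norm x).1 xT.
by have [/le_trans -> //] := KP x x x1 x1; exact: ltW.
Qed.

Lemma integrable_cst_cellF E (M : R) : measurable E -> E `<=` cellF ->
  leb.-integrable E (EFin \o (fun=> M)).
Proof.
move=> mE Ec; apply: measurable_bounded_integrable => //; first exact: lebesgue_sub_cellF_fin.
by exists `|M|; split=> // N MN _ _ /=; exact: ltW.
Qed.

(** The integral over [E] of a polynomial in the reference coordinates. *)
Definition pullint (s : fpol R d) (E : set 'rV[R]_d) : R :=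
  \int[leb]_(y in E) feval s (invF y).

Lemma pullint_le (s : fpol R d) E M : measurable E -> E `<=` cellF ->
  (forall x, That x -> E (F x) -> feval s x <= M) ->
  pullint s E <= M * fine (leb E).
Proof.
move=> mE Ec H; rewrite -Rintegral_cst //; apply: le_Rintegral => //.
- exact: integrable_pull.
- exact: integrable_cst_cellF.
by move=> y Ey; have [x xT xy] := Ec _ Ey; rewrite -xy invFK //; apply: H; rewrite ?xy.
Qed.

Lemma pullint_ge (s : fpol R d) E M : measurable E -> E `<=` cellF ->
  (forall x, That x -> E (F x) -> M <= feval s x) ->
  M * fine (leb E) <= pullint s E.
Proof.
move=> mE Ec H; rewrite -Rintegral_cst //; apply: le_Rintegral => //.
- exact: integrable_cst_cellF.
- exact: integrable_pull.
by move=> y Ey; have [x xT xy] := Ec _ Ey; rewrite -xy invFK //; apply: H; rewrite ?xy.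
Qed.

Lemma pullint_setU (s : fpol R d) A B : measurable A -> measurable B ->
  A `<=` cellF -> B `<=` cellF -> A `&` B = set0 ->
  pullint s (A `|` B) = pullint s A + pullint s B.
Proof.
move=> mA mB Ac Bc AB; apply: Rintegral_setU => //; last by apply/disj_setPS; rewrite AB.
by apply: integrable_pull; [exact: measurableU|rewrite subUset].
Qed.

Lemma pullint_sub (s : fpol R d) A B : (forall x, That x -> 0 <= feval s x) ->
  measurable A -> measurable B -> A `<=` B -> B `<=` cellF ->
  pullint s A <= pullint s B.
Proof.
move=> s0 mA mB AB Bc; have Dc : B `\` A `<=` cellF by move=> y [/Bc].
have mD : measurable (B `\` A) by exact: measurableD.
rewrite -(setDUK AB) pullint_setU //; [|exact: subset_trans AB Bc|exact: setDIK].
rewrite lerDl -[0](mul0r (fine (leb (B `\` A)))); apply: pullint_ge => // x xT _; exact: s0.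
Qed.

Lemma pullint_subadditive (s : fpol R d) (I : choiceType) (l : seq I) (E : I -> set 'rV[R]_d) :
  (forall x, That x -> 0 <= feval s x) ->
  (forall i, measurable (E i)) -> (forall i, E i `<=` cellF) ->
  pullint s (\big[setU/set0]_(i <- l) E i) <= \sum_(i <- l) pullint s (E i).
Proof.
move=> s0 mE Ec; elim: l => [|i l IH]; first by rewrite !big_nil /pullint Rintegral_set0.
rewrite !big_cons; set U := \big[setU/set0]_(j <- l) E j.
have mU : measurable U by apply: bigsetU_measurable.
have Uc : U `<=` cellF.
  by rewrite /U; elim/big_ind: _ => // A B Ac Bc; rewrite subUset.
have -> : E i `|` U = E i `|` (U `\` E i) by rewrite setUDr setDv setD0.
have DU : U `\` E i `<=` U by move=> y [].
rewrite pullint_setU //; [|exact: measurableD|exact: subset_trans DU Uc|exact: setDIK].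
rewrite lerD2l (le_trans _ IH) // pullint_sub //; exact: measurableD.
Qed.

Lemma pullint_additive (s : fpol R d) (I : choiceType) (l : seq I) (E : I -> set 'rV[R]_d) :
  uniq l -> (forall i, measurable (E i)) -> (forall i, E i `<=` cellF) ->
  (forall i j, i != j -> E i `&` E j = set0) ->
  pullint s (\big[setU/set0]_(i <- l) E i) = \sum_(i <- l) pullint s (E i).
Proof.
move=> + mE Ec Ed; elim: l => [|i l IH] /=; first by rewrite !big_nil /pullint Rintegral_set0.
move=> /andP[il /IH {}IH]; rewrite !big_cons -IH pullint_setU //.
- by apply: bigsetU_measurable.
- by elim/big_ind: _ => // A B Ac Bc; rewrite subUset.
apply/seteqP; split => // y [Ei]; rewrite -bigcup_seq => -[j /= jl Ej].
have ij : i != j by apply: contraNneq il => ->.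
by have : (E i `&` E j) y by []; rewrite Ed.
Qed.

Lemma inside_half c r b : 0 < r -> inside c r -> inside (halfshift c r b) (r / 2).
Proof.
move=> r0 cr i; rewrite mxE.
have e : `|(if b i then r else - r) / 2| = r / 2.
  by case: (b i); rewrite ?mulNr ?normrN gtr0_norm ?divr_gt0.
have := cr i; have := ler_normD (c 0 i) ((if b i then r else - r) / 2).
by rewrite e; move: (`|c 0 i + _|) => A h1 h2; lra.
Qed.

Lemma inside01 : inside 0 1.
Proof. by move=> i; rewrite mxE normr0 add0r. Qed.

Lemma image_cube_cellF c r : 0 <= r -> inside c r -> F @` cube c r `<=` cellF.
Proof.
move=> r0 cr _ [x /(cube_normP _ _ r0) xr <-]; exists x => //.
by apply/That_norm; exact: inside_norm xr.
Qed.

Lemma ocube_sub_cube c r : 0 <= r -> ocube c r `<=` cube c r.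
Proof. by move=> r0 x xr; apply/cube_normP => //; exact: ltW. Qed.

Lemma image_ocube_cellF c r : 0 <= r -> inside c r -> F @` ocube c r `<=` cellF.
Proof.
move=> r0 cr; apply: subset_trans (image_cube_cellF r0 cr).
by apply: image_subset; exact: ocube_sub_cube.
Qed.

Lemma cube_bisect c r : 0 < r ->
  cube c r `<=` \bigcup_b cube (halfshift c r b) (r / 2).
Proof.
move=> r0 x xr; exists [ffun i => c 0 i <= x 0 i] => // i; rewrite mxE ffunE.
have := xr i; rewrite !ler_distl => /andP[h1 h2].
by case: ifP => [h|/negbT]; rewrite -?ltNge => *; apply/andP; split; lra.
Qed.

Lemma halfshift_dist c r b : 0 < r -> `|halfshift c r b - c| <= r / 2.
Proof.
move=> r0; apply: norm_le_coord => [|i]; first by rewrite divr_ge0 // ltW.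
rewrite !mxE addrC addKr.
by case: (b i); rewrite ?mulNr ?normrN gtr0_norm ?divr_gt0.
Qed.

Lemma ocube_bisect c r b : 0 < r -> ocube (halfshift c r b) (r / 2) `<=` ocube c r.
Proof.
move=> r0 x; rewrite /ocube /= => xr; have := halfshift_dist c b r0.
have := ler_normD (x - halfshift c r b) (halfshift c r b - c).
rewrite addrA subrK => h1 h2; lra.
Qed.

Lemma ocube_bisect_disjoint c r b b' : 0 < r -> b != b' ->
  ocube (halfshift c r b) (r / 2) `&` ocube (halfshift c r b') (r / 2) = set0.
Proof.
move=> r0 bb'; apply/seteqP; split => // x [xb xb']; apply/negP: bb'; rewrite negbK.
apply/eqP/ffunP => i.
have := le_lt_trans (coord_le_norm _ i) xb; have := le_lt_trans (coord_le_norm _ i) xb'.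
rewrite !mxE !ltr_distl.
by case: (b i); case: (b' i) => // /andP[h1 h2] /andP[h3 h4]; exfalso; lra.
Qed.

Lemma expr1D_le K n : 0 <= K -> exists2 K', 0 <= K' & forall r : R, 0 <= r -> r <= 1 ->
  (1 + K * r) ^+ n <= 1 + K' * r.
Proof.
move=> K0; elim: n => [|n [K' K'0 H]].
  by exists 0 => // r _ _; rewrite expr0 mul0r addr0.
exists (K + K' + K * K') => [|r r0 r1]; first by rewrite !addr_ge0 // mulr_ge0.
rewrite exprS (le_trans (ler_wpM2l _ (H r r0 r1))) ?addr_ge0 ?mulr_ge0 //.
have : K * K' * r * r <= K * K' * r by rewrite ler_piMr // !mulr_ge0.
lra.
Qed.

Lemma expr1B_ge (t : R) n : 0 <= t -> t <= 1 -> 1 - n%:R * t <= (1 - t) ^+ n.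
Proof.
move=> t0 t1; elim: n => [|n IH]; first by rewrite mul0r subr0 expr0.
have h0 : 0 <= (1 - t) ^+ n by rewrite exprn_ge0 // subr_ge0.
have h1 : (1 - t) ^+ n <= 1 by rewrite exprn_ile1 // ?subr_ge0 // gerBl.
rewrite exprS mulrBl mul1r -natr1 mulrDl mul1r.
have : t * (1 - t) ^+ n <= t by rewrite ler_piMr.
by move: IH; move: ((1 - t) ^+ n) (t * _) => A B; lra.
Qed.

Variable P : fpol R d.
Hypothesis PE : forall x, That x -> feval P x = `|\det (Jac x)|.

(** Upper half of the change of variables formula: small cubes are mapped into
    slightly enlarged parallelepipeds. *)
Lemma pullint_upper (s : fpol R d) : (forall x, That x -> 0 <= feval s x) ->
  pullint s (F @` cube 0 1) <= fint (fmul s P) 0 1.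
Proof.
move=> s0; rewrite -subr_le0.
have [K K0 KP] := lebesgue_image_cube_le.
have [K' K'0 K'P] := expr1D_le d K0.
have [G G0 GP] := bounded_lip_feval 1 s.
have [D D0 DP] := bounded_lip_feval 1 P.
have [C C0 CP] := fint_close (fmul s P).
pose B := G * D * K' + G * D + G * D * K' + C.
have B0 : 0 <= B by rewrite /B !addr_ge0 ?mulr_ge0.
apply: (@bisection_le0 _ _ (fun c r => pullint s (F @` cube c r) - fint (fmul s P) c r)
  (B * 2 ^+ d) 1 _ ltr01).
- by rewrite mulr_ge0 // exprn_ge0.
- move=> c r r0 cr; rewrite sumrB -fint_bisect lerD2r.
  pose E b := F @` cube (halfshift c r b) (r / 2).
  have mE b : measurable (E b) by exact: measurable_image_cube.
  have r20 : 0 <= r / 2 by rewrite divr_ge0 // ltW.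
  have Ec b : E b `<=` cellF by apply: image_cube_cellF => //; exact: inside_half.
  apply: le_trans (pullint_subadditive (index_enum _) s0 mE Ec).
  apply: pullint_sub => //.
  + exact: measurable_image_cube.
  + by apply: bigsetU_measurable.
  + rewrite -bigcup_seq => _ [x /(cube_bisect r0)[b _ xb] <-].
    by exists b; [rewrite /= mem_index_enum|exists x].
  + by elim/big_ind: _ => // A A' Ac A'c; rewrite subUset.
move=> c r r0 r1 cr; have r0' := ltW r0.
have c1 := inside_center r0' cr; have cT : That c by apply/That_norm.
set V := (2 * r) ^+ d; have V0 : 0 <= V by rewrite exprn_ge0 // mulr_ge0.
set g := feval s c; set dt := `|\det (Jac c)|.
have g0 : 0 <= g by exact: s0.
have gG : g <= G by have [h _] := GP c c c1 c1; rewrite (le_trans (ler_norm _)).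
have dt0 : 0 <= dt by exact: normr_ge0.
have dtD : dt <= D by have [h _] := DP c c c1 c1; rewrite PE // in h; rewrite (le_trans _ h) // ler_norm.
have m_le : fine (leb (F @` cube c r)) <= dt * V * (1 + K' * r).
  have := KP c r r0 cr; rewrite -(@fineK _ (leb (F @` cube c r))); last first.
    rewrite ge0_fin_numE //; apply: lebesgue_sub_cellF_fin; last exact: image_cube_cellF.
    exact: measurable_image_cube.
  rewrite lee_fin => h; apply: le_trans h _; rewrite mulrA exprMn mulrA ler_wpM2l ?mulr_ge0 //.
  exact: K'P.
have I1 : pullint s (F @` cube c r) <= (g + G * r) * (dt * V * (1 + K' * r)).
  apply: (le_trans (y := (g + G * r) * fine (leb (F @` cube c r)))); last first.
    by rewrite ler_wpM2l // addr_ge0 // mulr_ge0.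
  apply: pullint_le; [exact: measurable_image_cube|exact: image_cube_cellF|].
  move=> x xT [x' /(cube_normP _ _ r0') x'r xx'].
  have ex : x' = x.
    apply: Finj => //; apply/mem_set => //; apply/That_norm; exact: (inside_norm r0' cr x'r).
  have x1 := (That_norm x).1 xT; have [_ h] := GP x c x1 c1.
  rewrite -lerBlDl (le_trans (ler_norm _)) // (le_trans h) // ler_wpM2l // -ex //.
have I2 : V * (g * dt) - C * r * V <= fint (fmul s P) c r.
  have := CP c r r0' cr; rewrite feval_mul PE // -/g -/dt -/V ler_distl => /andP[h _].
  by move: h; rewrite lerBlDr; lra.
have -> : B * 2 ^+ d * r * r ^+ d = V * (B * r) by rewrite /V exprMn; ring.
rewrite (le_trans (lerB I1 I2)) //.
have -> : (g + G * r) * (dt * V * (1 + K' * r)) - (V * (g * dt) - C * r * V) =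
  V * (g * dt * K' * r + G * dt * r + G * dt * K' * r * r + C * r) by ring.
rewrite ler_wpM2l // /B !mulrDl !lerD //.
- by rewrite ler_wpM2r // ler_wpM2r // ler_pM.
- by rewrite ler_wpM2r // ler_wpM2l.
- rewrite (le_trans (y := G * dt * K' * r)) //; first by rewrite ler_piMr // !mulr_ge0.
  by rewrite ler_wpM2r // ler_wpM2r // ler_wpM2l.
Qed.

(** Lower half: images of small open cubes contain slightly shrunk
    parallelepipeds. *)
Lemma pullint_lower (s : fpol R d) : (forall x, That x -> 0 <= feval s x) ->
  fint (fmul s P) 0 1 <= pullint s (F @` ocube 0 1).
Proof.
move=> s0; rewrite -subr_le0.
have [K1 K10 K1P] := lebesgue_image_cube_le.
have [K' K'0 K'P] := expr1D_le d K10.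
have [K [r0 [K0 r00 Kr0 KP]]] := lebesgue_image_ocube_ge.
have [G G0 GP] := bounded_lip_feval 1 s.
have [D D0 DP] := bounded_lip_feval 1 P.
have [C C0 CP] := fint_close (fmul s P).
pose B := C + G * D * (d%:R * K) + (G * D + G * D * K').
have B0 : 0 <= B by rewrite /B !addr_ge0 ?mulr_ge0.
have r10 : 0 < Num.min r0 1 by rewrite lt_min r00 ltr01.
apply: (@bisection_le0 _ _ (fun c r => fint (fmul s P) c r - pullint s (F @` ocube c r))
  (B * 2 ^+ d) _ _ r10).
- by rewrite mulr_ge0 // exprn_ge0.
- move=> c r r_gt0 cr; rewrite sumrB -fint_bisect lerD2l lerN2.
  pose E b := F @` ocube (halfshift c r b) (r / 2).
  have r20 : 0 <= r / 2 by rewrite divr_ge0 // ltW.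
  have insb b : inside (halfshift c r b) (r / 2) by exact: inside_half.
  have mE b : measurable (E b) by exact: measurable_image_ocube.
  have Ec b : E b `<=` cellF by exact: image_ocube_cellF.
  have Ed b b' : b != b' -> E b `&` E b' = set0.
    move=> bb'; apply/seteqP; split => // _ [[x xb <-] [x' xb' xx']].
    have cb b'' y : ocube (halfshift c r b'') (r / 2) y -> y \in That.
      by move=> /ltW h; apply/mem_set/That_norm; exact: inside_norm h.
    have ex : x' = x by apply: Finj => //; [exact: cb xb'|exact: cb xb].
    have := ocube_bisect_disjoint c r_gt0 bb' => h.
    by have : set0 x by rewrite -h; split => //; rewrite -ex.
  rewrite -(pullint_additive s (index_enum_uniq _) mE Ec Ed).
  apply: pullint_sub => //.
  + by apply: bigsetU_measurable.
  + exact: measurable_image_ocube.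
  + by rewrite -bigcup_seq => _ [b _ [x xb <-]]; exists x => //; exact: ocube_bisect xb.
  + by apply: image_ocube_cellF => //; exact: ltW.
move=> c r r_gt0; rewrite le_min => /andP[rr0 r1] cr; have r0' := ltW r_gt0.
have c1 := inside_center r0' cr; have cT : That c by apply/That_norm.
set V := (2 * r) ^+ d; have V0 : 0 <= V by rewrite exprn_ge0 // mulr_ge0.
set g := feval s c; set dt := `|\det (Jac c)|.
have g0 : 0 <= g by exact: s0.
have gG : g <= G by have [h _] := GP c c c1 c1; rewrite (le_trans (ler_norm _)).
have dt0 : 0 <= dt by exact: normr_ge0.
have dtD : dt <= D by have [h _] := DP c c c1 c1; rewrite PE // in h; rewrite (le_trans _ h) // ler_norm.
have mI := measurable_image_ocube cr; have Ic := image_ocube_cellF r0' cr.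
have fI : leb (F @` ocube c r) \is a fin_num.
  by rewrite ge0_fin_numE //; exact: lebesgue_sub_cellF_fin.
set m := fine (leb (F @` ocube c r)).
have m_le : m <= dt * V * (1 + K' * r).
  have : (leb (F @` ocube c r) <= leb (F @` cube c r))%E.
    apply: le_measure; [exact: mem_set|by apply: mem_set; exact: measurable_image_cube|].
    by apply: image_subset; exact: ocube_sub_cube.
  move=> /le_trans /(_ (K1P c r r_gt0 cr)); rewrite -(fineK fI) -/m lee_fin => h.
  by apply: le_trans h _; rewrite mulrA exprMn mulrA ler_wpM2l ?mulr_ge0 // K'P.
have m_ge : dt * V * (1 - d%:R * K * r) <= m.
  have := KP c r r_gt0 rr0 cr; rewrite -(fineK fI) -/m lee_fin => h.
  apply: le_trans _ h; rewrite [2 * (_ * _)]mulrA exprMn mulrA ler_wpM2l ?mulr_ge0 //.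
  rewrite -mulrA expr1B_ge ?mulr_ge0 //.
  by rewrite (le_trans (ler_wpM2l K0 rr0)) // (le_trans Kr0) //; lra.
have I1 : (g - G * r) * m <= pullint s (F @` ocube c r).
  apply: pullint_ge => // x xT [x' /ltW x'r xx'].
  have ex : x' = x.
    apply: Finj => //; apply/mem_set => //; apply/That_norm; exact: (inside_norm r0' cr x'r).
  have x1 := (That_norm x).1 xT; have [_ h] := GP x c x1 c1.
  have : G * `|x - c| <= G * r by rewrite ler_wpM2l // -ex.
  by move: h; rewrite ler_distl => /andP[h1 h2]; move: h1; rewrite -/g; lra.
have I2 : fint (fmul s P) c r <= V * (g * dt) + C * r * V.
  have := CP c r r0' cr; rewrite feval_mul PE // -/g -/dt -/V ler_distl => /andP[_ h].
  by [].
have -> : B * 2 ^+ d * r * r ^+ d = V * (B * r) by rewrite /V exprMn; ring.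
have I3 : g * (dt * V * (1 - d%:R * K * r)) <= g * m by rewrite ler_wpM2l.
have I4 : G * r * m <= G * r * (dt * V * (1 + K' * r)) by rewrite ler_wpM2l // mulr_ge0.
apply: (le_trans (y := V * (g * dt) + C * r * V -
    (g * (dt * V * (1 - d%:R * K * r)) - G * r * (dt * V * (1 + K' * r))))).
  by apply: lerB => //; apply: le_trans I1; rewrite mulrBl lerB.
have -> : V * (g * dt) + C * r * V -
    (g * (dt * V * (1 - d%:R * K * r)) - G * r * (dt * V * (1 + K' * r))) =
  V * (C * r + g * dt * (d%:R * K) * r + (G * dt * r + G * dt * K' * r * r)) by ring.
rewrite ler_wpM2l // /B !mulrDl !lerD //.
- by rewrite ler_wpM2r // ler_wpM2r ?mulr_ge0 // ler_pM.
- by rewrite ler_wpM2r // ler_wpM2l.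
- rewrite (le_trans (y := G * dt * K' * r)) //; first by rewrite ler_piMr // !mulr_ge0.
  by rewrite ler_wpM2r // ler_wpM2r // ler_wpM2l.
Qed.

(** Change of variables: integrals over the element, or over any set between the
    image of the open cube and the element, are integrals over the reference
    cube. Constants reduce the general case to the nonnegative one. *)
Lemma pullint_cov (s : fpol R d) E : measurable E ->
  F @` ocube 0 1 `<=` E -> E `<=` cellF -> pullint s E = fint (fmul s P) 0 1.
Proof.
move=> mE oE Ec.
have pos t : (forall x, That x -> 0 <= feval t x) -> pullint t E = fint (fmul t P) 0 1.
  move=> t0; apply/eqP; rewrite eq_le; apply/andP; split.
    apply: le_trans (pullint_upper t0); rewrite -cube_That.
    by apply: pullint_sub => //; exact: measurable_cellF.
  apply: le_trans (pullint_lower t0) _; apply: pullint_sub => //.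
  exact: measurable_image_ocube inside01.
have [G G0 GP] := bounded_lip_feval 1 s.
set t := fscale G (fone R d).
have tE x : feval t x = G by rewrite feval_scale feval_one mulr1.
have st0 x : That x -> 0 <= feval (s ++ t) x.
  move=> /That_norm x1; rewrite feval_cat tE.
  by have [h _] := GP x x x1 x1; move: h; rewrite ler_norml => /andP[h _]; lra.
have e1 := pos _ st0; have e2 : pullint t E = fint (fmul t P) 0 1.
  by apply: pos => x _; rewrite tE.
have : pullint (s ++ t) E = pullint s E + pullint t E.
  rewrite /pullint -RintegralD //; [|exact: integrable_pull..].
  by apply: eq_Rintegral => y _; rewrite feval_cat.
rewrite e1 e2 /fmul map_cat flatten_cat /fint big_cat => /addIr <- //.
Qed.

(** The formula gives the element and the image of the open cube the same
    measure. *)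
Lemma lebesgue_cellF_diff : leb (cellF `\` F @` ocube 0 1) = 0%E.
Proof.
have mo := measurable_image_ocube inside01; have mc := measurable_cellF.
have oc := image_ocube_cellF ler01 inside01.
have fo : leb (F @` ocube 0 1) \is a fin_num.
  by rewrite ge0_fin_numE //; exact: lebesgue_sub_cellF_fin.
have fc : leb cellF \is a fin_num.
  by rewrite ge0_fin_numE //; exact: lebesgue_sub_cellF_fin.
have E1 D : measurable D -> pullint (fone R d) D = fine (leb D).
  move=> mD; rewrite /pullint -[RHS]mul1r -Rintegral_cst //.
  by apply: eq_Rintegral => y _; rewrite feval_one.
have := pullint_cov (fone R d) mc oc (@subset_refl _ _).
rewrite -(pullint_cov (fone R d) mo (@subset_refl _ _) oc) !E1 // => e.
rewrite measureD //; last by rewrite -ge0_fin_numE.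
have e' : leb cellF = leb (F @` ocube 0 1) by rewrite -(fineK fo) -(fineK fc) e.
rewrite (setIidr oc); have := subee fo; rewrite -{1}e'; exact.
Qed.

Lemma lebesgue_image_gt0 : (0 < leb (F @` ocube 0%R 1%R))%E.
Proof.
have [K [r0 [K0 r00 Kr0 KP]]] := lebesgue_image_ocube_ge.
pose r := Num.min r0 1; have r_gt0 : 0 < r by rewrite lt_min r00 ltr01.
have r_r0 : r <= r0 by rewrite ge_min lexx.
have r_1 : r <= 1 by rewrite ge_min lexx orbT.
have ins : inside 0 r by move=> i; rewrite mxE normr0 add0r.
have Kr : K * r <= 2^-1 by rewrite (le_trans (ler_wpM2l K0 r_r0)).
have T0 : That (0 : 'rV[R]_d) by apply/That_norm; rewrite normr0 ler01.
apply: lt_le_trans (le_trans (KP 0 r r_gt0 r_r0 ins) _).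
  rewrite lte_fin mulr_gt0 ?normr_gt0 -?unitfE -?unitmxE ?Jinv //.
  by rewrite exprn_gt0 // !mulr_gt0 //; lra.
apply: le_measure; [| |by apply: image_subset => x; rewrite /ocube /=; lra].
  by apply: mem_set; exact: measurable_image_ocube.
by apply: mem_set; exact: measurable_image_ocube inside01.
Qed.

End element_geometry.

(** * Frobenius norm *)
Section frobenius_theory.
Variable R : realType.

Lemma frobC m n (A B : 'M[R]_(m, n)) : frob A B = frob B A.
Proof. by apply: eq_bigr => i _; apply: eq_bigr => j _; rewrite mulrC. Qed.

Lemma frobDl m n (A B C : 'M[R]_(m, n)) : frob (A + B) C = frob A C + frob B C.
Proof.
rewrite /frob -big_split; apply: eq_bigr => i _; rewrite -big_split.
by apply: eq_bigr => j _; rewrite mxE mulrDl.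
Qed.

Lemma frobZl m n a (A B : 'M[R]_(m, n)) : frob (a *: A) B = a * frob A B.
Proof.
rewrite /frob mulr_sumr; apply: eq_bigr => i _; rewrite mulr_sumr.
by apply: eq_bigr => j _; rewrite mxE mulrA.
Qed.

Lemma frobNl m n (A B : 'M[R]_(m, n)) : frob (- A) B = - frob A B.
Proof. by rewrite -scaleN1r frobZl mulN1r. Qed.

Lemma frobBl m n (A B C : 'M[R]_(m, n)) : frob (A - B) C = frob A C - frob B C.
Proof. by rewrite frobDl frobNl. Qed.

Lemma frob_ge0 m n (A : 'M[R]_(m, n)) : 0 <= frob A A.
Proof. by apply: sumr_ge0 => i _; apply: sumr_ge0 => j _; rewrite -expr2 sqr_ge0. Qed.

Lemma frobn_ge0 m n (A : 'M[R]_(m, n)) : 0 <= frobn A.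
Proof. exact: sqrtr_ge0. Qed.

Lemma frobn_sqr m n (A : 'M[R]_(m, n)) : frobn A ^+ 2 = frob A A.
Proof. by rewrite sqr_sqrtr // frob_ge0. Qed.

Lemma entry_le_frobn m n (A : 'M[R]_(m, n)) i j : `|A i j| <= frobn A.
Proof.
rewrite -(ler_pXn2r (ltn0Sn 1)) ?nnegrE ?frobn_ge0 // frobn_sqr real_normK ?num_real //.
rewrite /frob (bigD1 i) //= (bigD1 j) //= -expr2 -addrA lerDl addr_ge0 //.
  by apply: sumr_ge0 => k _; rewrite -expr2 sqr_ge0.
by apply: sumr_ge0 => k _; apply: sumr_ge0 => l _; rewrite -expr2 sqr_ge0.
Qed.

Lemma frobn_eq0 m n (A : 'M[R]_(m, n)) : frobn A = 0 -> A = 0.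
Proof.
move=> A0; apply/matrixP => i j; have := entry_le_frobn A i j.
by rewrite A0 normr_le0 mxE => /eqP.
Qed.

Lemma frobn0 m n : frobn (0 : 'M[R]_(m, n)) = 0.
Proof.
rewrite /frobn /frob big1 ?sqrtr0 // => i _; rewrite big1 // => j _.
by rewrite mxE mul0r.
Qed.

Lemma frobnZ m n a (A : 'M[R]_(m, n)) : frobn (a *: A) = `|a| * frobn A.
Proof. by rewrite /frobn frobZl frobC frobZl mulrA -expr2 sqrtrM ?sqr_ge0 // sqrtr_sqr. Qed.

Lemma frob_CauchySchwarz m n (A B : 'M[R]_(m, n)) : frob A B <= frobn A * frobn B.
Proof.
have [/frobn_eq0 ->|A0] := eqVneq (frobn A) 0.
  by rewrite frobn0 mul0r -(scale0r 0) frobZl mul0r.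
have [/frobn_eq0 ->|B0] := eqVneq (frobn B) 0.
  by rewrite frobn0 mulr0 frobC -(scale0r 0) frobZl mul0r.
have ab : 0 < frobn A * frobn B by rewrite mulr_gt0 // lt0r ?A0 ?B0 frobn_ge0.
have := frob_ge0 (frobn B *: A - frobn A *: B).
rewrite frobBl !frobZl ![frob _ (_ - _)]frobC !frobBl !frobZl -!frobn_sqr (frobC B A).
move: (frob A B) (frobn A) (frobn B) ab => t a b ab h.
by rewrite -subr_ge0 -(pmulr_rge0 _ ab); move: h; lra.
Qed.

Lemma frob_row_le d (x y : 'rV[R]_d) : `|frob x y| <= d%:R * `|x| * `|y|.
Proof.
rewrite /frob big_ord1 (le_trans (ler_norm_sum _ _ _)) //.
rewrite (le_trans (y := \sum_(j < d) `|x| * `|y|)) //.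
  by apply: ler_sum => j _; rewrite normrM ler_pM // coord_le_norm.
by rewrite sumr_const card_ord -[_ *+ d]mulr_natl mulrA.
Qed.

Lemma frobn_row_le d (x : 'rV[R]_d) : frobn x <= d%:R * `|x|.
Proof.
case: d x => [|d] x; first by rewrite /frobn /frob big_ord1 big_ord0 sqrtr0 mul0r.
rewrite -(ler_pXn2r (ltn0Sn 1)) ?nnegrE ?frobn_ge0 ?mulr_ge0 // frobn_sqr.
rewrite (le_trans (ler_norm _)) // (le_trans (frob_row_le _ _)) //.
rewrite expr2 mulrACA -mulrA ler_wpM2r ?mulr_ge0 //.
by rewrite -natrM ler_nat leq_pmulr.
Qed.

Lemma mulmx_norm_le d (z : 'rV[R]_d) (M : 'M[R]_d) : `|z *m M| <= d%:R * frobn M * `|z|.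
Proof.
apply: norm_le_coord => [|j]; first by rewrite !mulr_ge0 // frobn_ge0.
rewrite mxE (le_trans (ler_norm_sum _ _ _)) //.
rewrite (le_trans (y := \sum_(i < d) frobn M * `|z|)) //.
  apply: ler_sum => i _; rewrite normrM mulrC ler_pM ?coord_le_norm //.
  exact: entry_le_frobn.
by rewrite sumr_const card_ord -[_ *+ d]mulr_natl mulrA.
Qed.

End frobenius_theory.

(** * Lipschitz domains *)

(** A Lipschitz domain lies on one side of its boundary: just below a boundary
    point the points are outside of the domain, and remain so nearby. *)
Lemma lipschitz_domain_interior_closure (R : realType) d (Omega : set 'rV[R]_d) :
  bounded_lipschitz_domain Omega -> interior (closure Omega) `<=` Omega.
Proof.
move=> [_ oO _ _ lipO] x0 x0I; apply: contrapT => nOx.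
have x0C : closure Omega x0 by exact: interior_subset.
have x0nI : ~ interior Omega x0 by move=> /interior_subset.
have [e [g [r [L [e1 r0 glip gO]]]]] := lipO x0 (conj x0C x0nI).
have ee : frob e e = 1 by rewrite -frobn_sqr e1 expr1n.
have en : `|e| <= 1.
  by apply: norm_le_coord => // i; rewrite -e1; exact: entry_le_frobn.
pose pr (y : 'rV[R]_d) := y - frob y e *: e.
have pre y : frob (pr y) e = 0 by rewrite frobBl frobZl ee mulr1 subrr.
have g0 : frob x0 e <= g (pr x0).
  rewrite leNgt; apply/negP => h; apply: nOx; apply/gO => //.
  by rewrite subrr frobn0.
have /nbhs_ballP[del /= del0 delO] := x0I.
pose D : R := d%:R + 1; have D1 : 1 <= D by rewrite lerDr ler0n.
have dD : d%:R <= D by rewrite lerDl ler01.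
have Dp : 0 < D by exact: lt_le_trans ltr01 D1.
pose t := Num.min del (r / D) / 4.
have t0 : 0 < t by rewrite divr_gt0 // lt_min del0 divr_gt0.
have tdel : 4 * t <= del by rewrite /t mulrC divfK // ge_min lexx.
have tr : 4 * t <= r / D by rewrite /t mulrC divfK // ge_min lexx orbT.
pose C := D + `|L| * (D * (1 + D)) + 1.
have C1 : 1 <= C by rewrite /C lerDr addr_ge0 ?mulr_ge0 ?(ltW Dp) // addr_ge0 // ltW.
have C0 : 0 < C by exact: lt_le_trans ltr01 C1.
pose eps := t / C; have eps0 : 0 < eps by rewrite divr_gt0.
have eps_t : eps <= t by rewrite ler_pdivrMr // ler_peMr // ltW.
(* [y] lies at depth [t] below [x0]; a point of the domain within [eps] of [y] would
   have to lie above the graph, which rises by less than [t] over that distance. *)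
pose y := x0 - t *: e.
have yx : `|y - x0| <= t.
  rewrite /y addrC addKr normrN normrZ gtr0_norm // ler_piMr // ltW //.
have yC : closure Omega y.
  by apply: delO; apply/ball_cube => //; rewrite (le_lt_trans yx) //; lra.
have [w [wO wy]] : exists w, Omega w /\ `|w - y| < eps.
  have [w [wO wB]] := yC _ (nbhsx_ballx y _ eps0).
  by exists w; split => //; apply/ball_cube.
have wx : `|w - x0| <= 2 * t.
  rewrite -[w](subrK y) -addrA (le_trans (ler_normD _ _)) //.
  by have := lerD (ltW wy) yx; lra.
have gw : g (pr w) < frob w e.
  apply/gO => //; rewrite (le_lt_trans (frobn_row_le _)) //.
  rewrite (le_lt_trans (ler_pM _ _ dD wx)) //.
  have : D * (4 * t) <= r by rewrite mulrC -ler_pdivlMr.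
  have : 0 < D * t by rewrite mulr_gt0.
  lra.
have wye : frob (w - y) e <= D * eps.
  rewrite (le_trans (ler_norm _)) // (le_trans (frob_row_le _ _)) //.
  rewrite -mulrA ler_pM ?mulr_ge0 //.
  rewrite -[leRHS]mulr1 ler_pM //; exact: ltW.
have pw : frobn (pr w - pr x0) <= D * ((1 + D) * eps).
  have -> : pr w - pr x0 = (w - y) - frob (w - y) e *: e.
    rewrite /pr frobBl [frob y e]frobBl frobZl ee mulr1 /y.
    by apply/rowP => i; rewrite !mxE; ring.
  rewrite (le_trans (frobn_row_le _)) // ler_pM // mulrDl mul1r.
  rewrite (le_trans (ler_normB _ _)) // lerD //; first exact: ltW.
  rewrite normrZ (le_trans (ler_piMr _ en)) // (le_trans (frob_row_le _ _)) //.
  rewrite -mulrA ler_pM ?mulr_ge0 //.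
  by rewrite -[leRHS]mulr1 ler_pM //; exact: ltW.
have gl := glip (pr w) (pr x0) (pre _) (pre _).
have : `|L| * frobn (pr w - pr x0) <= `|L| * (D * ((1 + D) * eps)) by rewrite ler_wpM2l.
have : L * frobn (pr w - pr x0) <= `|L| * frobn (pr w - pr x0).
  by rewrite ler_wpM2r ?frobn_ge0 // ler_norm.
have we : frob w e = frob x0 e - t + frob (w - y) e.
  by rewrite frobBl /y frobBl frobZl ee; ring.
have tC : t = C * eps by rewrite /eps mulrC divfK // gt_eqF.
move: gl; rewrite ler_distl => /andP[gl _] h1 h2.
rewrite we tC /C in gw; lra.
Qed.

(** * Regular elements *)
Section regular_elements.
Variables (R : realType) (d : nat) (Th : mesh R d) (kappa : R) (T : elt Th).
Hypothesis d0 : (0 < d)%N.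
Hypothesis rT : regular_element kappa T.
Local Notation F := (Fmap T).

Lemma element_multiaffine j : Ppoly 1 (fun x => F x 0 j).
Proof. by case: rT. Qed.

Lemma element_Jac_unit x : That x -> Jac F x \in unitmx.
Proof.
by case: rT => _ _ _ H /H[]; rewrite jacobianE //; exact: element_multiaffine.
Qed.

Lemma element_inj : set_inj That F.
Proof. by case: rT. Qed.

(** Injectivity of [F] separates the images of two points of the cube. *)
Lemma diam_gt0 : 0 < diam T.
Proof.
have [K K0 KP] := map_lipschitz element_multiaffine 1.
have ubS : has_ubound [set r | exists x y, [/\ cell T x, cell T y & r = frobn (x - y)]].
  exists (d%:R * (K * 2)) => _ [_ [_ [[u uT <-] [v vT <-] ->]]].
  rewrite (le_trans (frobn_row_le _)) // ler_wpM2l //.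
  have u1 := (That_norm u).1 uT; have v1 := (That_norm v).1 vT.
  rewrite (le_trans (KP u v u1 v1)) // ler_wpM2l // (le_trans (ler_normB _ _)) //.
  by lra.
have T0 : That (0 : 'rV[R]_d) by apply/That_norm; rewrite normr0 ler01.
have T1 : That (const_mx 1 : 'rV[R]_d).
  by move=> i; rewrite mxE lexx andbT (le_trans (lerN10 R)) // ler01.
have := ub_le_sup ubS (_ : [set r | exists x y, [/\ cell T x, cell T y & r = frobn (x - y)]]
  (frobn (F (const_mx 1) - F 0))).
rewrite /diam => H; apply: lt_le_trans (H _); last first.
  by exists (F (const_mx 1)), (F 0); split => //; [exists (const_mx 1)|exists 0].
rewrite lt0r frobn_ge0 andbT; apply/eqP => /frobn_eq0 /eqP; rewrite subr_eq0 => /eqP h.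
have := element_inj (mem_set T1) (mem_set T0) h.
move/rowP => /(_ (Ordinal d0)); rewrite !mxE => /eqP.
by rewrite oner_eq0.
Qed.

Lemma element_Jac_bound : exists2 kap, 0 <= kap & forall x (z : 'rV[R]_d), That x ->
  `|z *m invmx (Jac F x)| <= kap * `|z|.
Proof.
have D0 := diam_gt0; exists (d%:R * (`|kappa| / diam T)) => [|x z xT].
  by rewrite mulr_ge0 // divr_ge0 // ltW.
rewrite (le_trans (mulmx_norm_le _ _)) // ler_wpM2r // ler_wpM2l //.
case: rT => _ _ _ /(_ x xT)[_ _]; rewrite jacobianE; last exact: element_multiaffine.
by move=> h; rewrite ler_pdivlMr // (le_trans h) // ler_norm.
Qed.

(** A substitute for the interior of an element that is known to be parametrized by
    the open cube. *)
Definition open_cell : set 'rV[R]_d := F @` ocube 0 1.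

Lemma open_cell_open : open open_cell.
Proof.
have [kap kap0 kapP] := element_Jac_bound.
exact: (image_ocube_open element_multiaffine element_Jac_unit kap0 kapP (@inside01 R d)).
Qed.

Lemma open_cell_sub : open_cell `<=` cell T.
Proof. exact: (image_ocube_cellF ler01 (@inside01 R d)). Qed.

Lemma measurable_cell : measurable (cell T).
Proof. exact: measurable_cellF element_multiaffine. Qed.

Lemma Finv_Fmap x : That x -> Finv T (F x) = x.
Proof. exact: (invFK element_inj). Qed.

Lemma Finv_That y : cell T y -> That (Finv T y).
Proof. by move=> [x xT <-]; rewrite Finv_Fmap. Qed.

Lemma det_jacobian_poly : exists2 P : fpol R d, degs_le (fun=> d.-1) P &
  forall x, That x -> feval P x = `|\det ('J F x)|.
Proof.
have [s sd sE] := det_Jac_fpol element_multiaffine.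
have [sg sgP] := det_Jac_sign element_multiaffine element_Jac_unit.
exists (fscale sg s); first by rewrite degs_le_scale.
by move=> x xT; rewrite feval_scale -sE jacobianE ?sgP //; exact: element_multiaffine.
Qed.

Lemma lebesgue_cell_diff : lebesgue_rV R d (cell T `\` open_cell) = 0%E.
Proof.
have [kap kap0 kapP] := element_Jac_bound.
have [P _ PE] := det_jacobian_poly.
apply: (lebesgue_cellF_diff element_multiaffine element_Jac_unit kap0 kapP element_inj (P := P)).
by move=> x xT; rewrite PE // jacobianE //; exact: element_multiaffine.
Qed.

Lemma lebesgue_open_cell_gt0 : (0 < lebesgue_rV R d open_cell)%E.
Proof.
have [kap kap0 kapP] := element_Jac_bound.
exact: (lebesgue_image_gt0 element_multiaffine element_Jac_unit kap0 kapP).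
Qed.

Lemma lebesgue_cell_fin E : measurable E -> E `<=` cell T -> (lebesgue_rV R d E < +oo)%E.
Proof.
have [kap kap0 kapP] := element_Jac_bound.
exact: (lebesgue_sub_cellF_fin element_multiaffine element_Jac_unit kap0 kapP).
Qed.

Lemma measurable_Finv i : measurable_fun (cell T) (fun y => Finv T y 0 i).
Proof. exact: (measurable_invF element_multiaffine element_inj). Qed.

(** Integrals over a subset of full measure of the element, computed by a Gauss
    rule of sufficient order on the reference cube. *)
Lemma integral_element n (xg : 'I_n -> R) r f E : gauss_nodes xg -> (0 < n)%N ->
  Ppoly r f -> (r + d.-1 <= (n + n).-1)%N ->
  measurable E -> open_cell `<=` E -> E `<=` cell T ->
  \int[lebesgue_rV R d]_(y in E) f (Finv T y) =
  \sum_(k : {ffun 'I_d -> 'I_n}) tensor_weight xg k *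
    `|\det ('J F (gauss_point xg k))| * f (gauss_point xg k).
Proof.
move=> gx n0 fr rn mE oE Ec; have [s sr fE] := Ppoly_fpol fr.
have [kap kap0 kapP] := element_Jac_bound; have [P Pd PE] := det_jacobian_poly.
have PE' x : That x -> feval P x = `|\det (Jac F x)|.
  by move=> xT; rewrite PE // jacobianE //; exact: element_multiaffine.
have := pullint_cov element_multiaffine element_Jac_unit kap0 kapP element_inj PE' s mE oE Ec.
rewrite (fint_quadrature gx) //; last by apply: degs_leW (degs_le_mul sr Pd).
move=> H; transitivity (pullint F s E); first by apply: eq_Rintegral => y _; rewrite fE.
rewrite H; apply: eq_bigr => k _; rewrite feval_mul -fE PE; last exact: gauss_point_That.
by rewrite -mulrA; congr (_ * _); rewrite mulrC.
Qed.

End regular_elements.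

(** * Square integrable functions *)
Section L2_theory.
Variables (R : realType) (d : nat) (Omega : set 'rV[R]_d).
Hypothesis mO : measurable Omega.
Local Notation leb := (lebesgue_rV R d).
Implicit Types f g : 'rV[R]_d -> R.

Lemma L2_mul_integrable f g : L2 Omega f -> L2 Omega g ->
  leb.-integrable Omega (EFin \o (fun x => f x * g x)).
Proof.
move=> [mf f2] [mg g2]; have fg := integrableD mO f2 g2.
apply: (le_integrable mO _ _ fg); first by apply/measurable_EFinP; exact: measurable_funM.
move=> x _; rewrite /= lee_fin (@ger0_norm _ (_ + _)) ?addr_ge0 ?sqr_ge0 //.
rewrite normrM -(real_normK (num_real (f x))) -(real_normK (num_real (g x))).
have := sqr_ge0 (`|f x| - `|g x|); have := mulr_ge0 (normr_ge0 (f x)) (normr_ge0 (g x)).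
by rewrite !expr2; lra.
Qed.

Lemma L2_cst0 : L2 Omega (fun=> 0).
Proof.
split; first exact: measurable_cst.
by under eq_fun do rewrite expr0n; exact: integrable0.
Qed.

Lemma L2_add f g : L2 Omega f -> L2 Omega g -> L2 Omega (fun x => f x + g x).
Proof.
move=> Lf Lg; have fg := L2_mul_integrable Lf Lg; move: Lf Lg => [mf f2] [mg g2].
split; first exact: measurable_funD.
have H := integrableD mO (integrableD mO f2 g2) (integrableD mO fg fg).
apply: (eq_integrable mO _ _ _ H) => // x _ /=.
by rewrite -!EFinD; congr EFin; ring.
Qed.

Lemma L2_scale a f : L2 Omega f -> L2 Omega (fun x => a * f x).
Proof.
move=> [mf f2]; split; first exact: measurable_funM.
apply: (eq_integrable mO _ _ _ (integrableZl mO (a ^+ 2) f2)) => // x _ /=.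
by rewrite -EFinM exprMn.
Qed.

Lemma L2_sum (I : Type) (l : seq I) (f : I -> 'rV[R]_d -> R) :
  (forall i, L2 Omega (f i)) -> L2 Omega (fun x => \sum_(i <- l) f i x).
Proof.
move=> Lf; elim: l => [|i l IH].
  by rewrite (_ : (fun _ => _) = fun=> 0); [exact: L2_cst0|apply/funext => x; rewrite big_nil].
rewrite (_ : (fun _ => _) = fun x => f i x + \sum_(j <- l) f j x); first exact: L2_add.
by apply/funext => x; rewrite big_cons.
Qed.

Lemma Rintegral_sum (I : Type) (l : seq I) (f : I -> 'rV[R]_d -> R) (a : I -> R) :
  (forall i, leb.-integrable Omega (EFin \o f i)) ->
  \int[leb]_(x in Omega) (\sum_(i <- l) a i * f i x) =
  \sum_(i <- l) a i * \int[leb]_(x in Omega) f i x.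
Proof.
move=> If; have Iaf i : leb.-integrable Omega (EFin \o (fun x => a i * f i x)).
  by apply: (eq_integrable mO _ _ _ (integrableZl mO (a i) (If i))) => // x _; rewrite /= EFinM.
have Isum l' : leb.-integrable Omega (EFin \o (fun x => \sum_(i <- l') a i * f i x)).
  apply: (eq_integrable mO _ _ _ (integrable_sum mO l' (P := xpredT) (fun i _ => Iaf i))) => // x _ /=.
  by rewrite sumEFin.
elim: l => [|i l IH].
  rewrite big_nil (eq_Rintegral _ _ (g := fun=> 0)) => [|x _]; last by rewrite big_nil.
  by rewrite Rintegral_cst // mul0r.
rewrite big_cons -IH -RintegralZl // -RintegralD //.
by apply: eq_Rintegral => x _; rewrite big_cons.
Qed.

Lemma Rintegral_ae f g : measurable_fun Omega f -> measurable_fun Omega g ->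
  {ae leb, forall x, Omega x -> f x = g x} ->
  \int[leb]_(x in Omega) f x = \int[leb]_(x in Omega) g x.
Proof.
move=> mf mg fg; congr fine; apply: ae_eq_integral => //.
- exact/measurable_EFinP.
- exact/measurable_EFinP.
by apply: filterS fg => x fgx Ox; rewrite fgx.
Qed.

End L2_theory.

(** * Nodal and biorthogonal bases *)
Section bases.
Variables (R : realType) (d : nat) (Omega : set 'rV[R]_d) (sigma_y : R).
Variables (Th : mesh R d) (kappa : R) (x : forall n, 'I_n -> R).
Arguments x {n}.
Variable phih : forall T : elt Th, {ffun 'I_d -> 'I_(pdeg T)} -> 'rV[R]_d -> R.
Arguments phih : clear implicits.
Variables (zeta : node Th -> 'I_(ndof Th)) (phi vphi : 'I_(ndof Th) -> 'rV[R]_d -> R).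
Hypothesis d23 : d = 2%N \/ d = 3%N.
Hypothesis hOmega : bounded_lipschitz_domain Omega.
Hypothesis hTh : fe_mesh Th kappa Omega.
Hypothesis hx : forall n, gauss_nodes (@x n).
Hypothesis hphih : forall T, lagrange_basis (@x (pdeg T)) (phih T).
Hypothesis hzeta : bijective zeta.
Hypothesis hphi : nodal_basis phih zeta phi.
Hypothesis hvphi : biorthogonal_basis Omega phi vphi.
Local Notation leb := (lebesgue_rV R d).
Implicit Types (T S : elt Th) (y : 'rV[R]_d).

Definition nd T (k : {ffun 'I_d -> 'I_(pdeg T)}) : node Th :=
  Tagged (fun T : elt Th => {ffun 'I_d -> 'I_(pdeg T)}) k.

Lemma d_gt0 : (0 < d)%N. Proof. by case: d23 => ->. Qed.
Let d0 := d_gt0.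

Lemma dpred_le2 : (d.-1 <= 2)%N. Proof. by case: d23 => ->. Qed.

Lemma mesh_regular T : regular_element kappa T.
Proof. by case: hTh => _ _ H _ _; exact: H. Qed.
Let rT := mesh_regular.

Lemma pdeg_gt0 (T : elt Th) : (0 < pdeg T)%N.
Proof. by case: hTh => _ _ _ H _; exact: H. Qed.

Lemma Omega_open : open Omega. Proof. by case: hOmega. Qed.

Lemma measurable_Omega : measurable Omega.
Proof. exact: open_measurable_rV Omega_open. Qed.
Let mO := measurable_Omega.

Lemma open_cell_Omega T : open_cell T `<=` Omega.
Proof.
apply: subset_trans (lipschitz_domain_interior_closure hOmega).
rewrite -open_subsetE; last exact: open_cell_open d0 (rT T).
apply: subset_trans (open_cell_sub (T := T)) _.
by case: hTh => -> _ _ _ _ y Ty; exists T.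
Qed.

Lemma open_cell_disjoint T T' : T != T' -> open_cell T `&` open_cell T' = set0.
Proof.
have oI S : open_cell S `<=` interior (cell S).
  rewrite -open_subsetE; first exact: open_cell_sub.
  exact: open_cell_open d0 (rT S).
case: hTh => _ H _ _ _ /H e; apply/seteqP; split => // y [/oI yT /oI yT'].
by rewrite -e.
Qed.

(** Up to a null set, cells are open, disjoint and contained in the domain. *)
Definition regular_point y := forall T, cell T y -> open_cell T y.

Lemma ae_regular : {ae leb, forall y, regular_point y}.
Proof.
apply: filter_forall => T; exists (cell T `\` open_cell T); split.
- apply: measurableD; first exact: measurable_cell (rT T).
  exact: open_measurable_rV (open_cell_open d0 (rT T)).
- exact: lebesgue_cell_diff d0 (rT T).
- by move=> y /= /not_implyP.
Qed.

Lemma regular_point_cell y T T' : regular_point y -> cell T y -> cell T' y -> T = T'.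
Proof.
move=> ry /ry yT /ry yT'; apply/eqP; apply: contraT => /open_cell_disjoint e.
by have : set0 y by rewrite -e.
Qed.

Lemma Omega_cell y : Omega y -> exists T, cell T y.
Proof.
move=> /subset_closure; case: hTh => -> _ _ _ _ [T _ Ty]; by exists T.
Qed.

Lemma ae_sub (P Q : 'rV[R]_d -> Prop) : (forall y, P y -> Q y) ->
  {ae leb, forall y, P y} -> {ae leb, forall y, Q y}.
Proof. by move=> PQ; apply: filterS. Qed.

(** * Expansion in the nodal basis *)

Lemma phi_node T (k : {ffun 'I_d -> 'I_(pdeg T)}) y :
  phi (zeta (nd k)) y = \1_(cell T) y * phih T k (Finv T y).
Proof. exact: hphi. Qed.

Lemma sum_node (V : nmodType) (c : 'I_(ndof Th) -> V) :
  \sum_i c i = \sum_(T : elt Th) \sum_(k : {ffun 'I_d -> 'I_(pdeg T)}) c (zeta (nd k)).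
Proof.
rewrite (reindex zeta) /=; last by apply: onW_bij.
by rewrite sig_big_dep; apply: eq_bigr => -[].
Qed.

Lemma phi_sum (V : lmodType R) (c : 'I_(ndof Th) -> V) y T : regular_point y -> cell T y ->
  \sum_i phi i y *: c i = \sum_k phih T k (Finv T y) *: c (zeta (nd k)).
Proof.
move=> ry Ty; rewrite sum_node (bigD1 T) //= [X in _ + X]big1 ?addr0.
  by apply: eq_bigr => k _; rewrite phi_node indicE mem_set // mul1r.
move=> S ST; apply: big1 => k _; rewrite phi_node indicE memNset ?mul0r ?scale0r //.
by move=> Sy; move/eqP: ST; apply; exact: regular_point_cell Sy Ty.
Qed.

Definition gp T (k : {ffun 'I_d -> 'I_(pdeg T)}) : 'rV[R]_d := gauss_point x k.

Lemma node_of (i : 'I_(ndof Th)) : exists T (k : {ffun 'I_d -> 'I_(pdeg T)}), i = zeta (nd k).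
Proof. by have [zi zK ziK] := hzeta; case: (zi i) (ziK i) => T k <-; exists T, k. Qed.

Lemma node_fun (V : Type) (f : forall T : elt Th, {ffun 'I_d -> 'I_(pdeg T)} -> V) :
  exists c : 'I_(ndof Th) -> V, forall T (k : {ffun 'I_d -> 'I_(pdeg T)}), c (zeta (nd k)) = f T k.
Proof.
have [zi zK ziK] := hzeta; exists (fun i => f (tag (zi i)) (tagged (zi i))) => T k.
by rewrite zK.
Qed.

(** On each element, interpolate the polynomial that represents [f] there. *)
Lemma hp_expand (f : 'rV[R]_d -> R) (P : elt Th -> 'rV[R]_d -> R) (c : 'I_(ndof Th) -> R) :
  (forall T, Ppoly (pdeg T).-1 (P T)) -> (forall T, pullback T f (P T)) ->
  (forall T (k : {ffun 'I_d -> 'I_(pdeg T)}), c (zeta (nd k)) = P T (gp k)) ->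
  {ae leb, forall y, Omega y -> f y = \sum_i phi i y * c i}.
Proof.
move=> PP fP cE; have ae_fP : {ae leb, forall y, forall T, cell T y -> f y = P T (Finv T y)}.
  exact: filter_forall.
move: ae_regular ae_fP; apply: filterS2 => y ry fy Oy.
have [T Ty] := Omega_cell Oy; rewrite (fy T Ty).
have := phi_sum (c : 'I_(ndof Th) -> R^o) ry Ty => /= ->.
rewrite (lagrange_basis_interp (hx _) _ (pdeg_gt0 T) (@hphih T) (PP T)).
by apply: eq_bigr => k _; rewrite cE mulrC.
Qed.

Lemma hp_expand_mx q (P : elt Th -> 'rV[R]_d -> 'M[R]_d) (c : 'I_(ndof Th) -> 'M[R]_d) :
  (forall T, Ppoly_mx (pdeg T).-1 (P T)) -> (forall T, pullback T q (P T)) ->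
  (forall T (k : {ffun 'I_d -> 'I_(pdeg T)}), c (zeta (nd k)) = P T (gp k)) ->
  represents Omega phi c q.
Proof.
move=> PP qP cE.
have H : {ae leb, forall y, forall ab : 'I_d * 'I_d, Omega y ->
    q y ab.1 ab.2 = \sum_i phi i y * c i ab.1 ab.2}.
  apply: filter_forall => -[a b] /=.
  apply: (hp_expand (P := fun T y => P T y a b)) => [T|T|T k]; first exact: PP.
    by apply: ae_sub (qP T) => y qy Ty; rewrite qy.
  by rewrite cE.
apply: ae_sub H => y H Oy; apply/matrixP => a b; rewrite (H (a, b)) // summxE.
by apply: eq_bigr => i _; rewrite mxE.
Qed.

Lemma pullback_phi_sum (c : 'I_(ndof Th) -> 'M[R]_d) T :
  pullback T (fun y => \sum_i phi i y *: c i)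
    (fun u => \sum_(k : {ffun 'I_d -> 'I_(pdeg T)}) phih T k u *: c (zeta (nd k))).
Proof. by apply: ae_sub ae_regular => y ry Ty; rewrite (phi_sum c ry Ty). Qed.

Lemma Ppoly_mx_sum r (I : finType) (f : I -> 'rV[R]_d -> R) (A : I -> 'M[R]_d) :
  (forall i, Ppoly r (f i)) -> Ppoly_mx r (fun u => \sum_i f i u *: A i).
Proof.
move=> fr a b; apply: (@Ppoly_eq _ _ r (fun u => \sum_i A i a b * f i u)).
  by move=> u; rewrite summxE; apply: eq_bigr => i _; rewrite mxE mulrC.
by apply: Ppoly_sum => i; exact: Ppoly_scale.
Qed.

(** * Integrals of the nodal basis *)

Lemma lebesgue_Omega_fin : (leb Omega < +oo)%E.
Proof.
have [M [_ MP]] : bounded_set Omega by case: hOmega.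
have M0 : 0 <= `|M| + 1 by rewrite addr_ge0.
apply: (@le_lt_trans _ _ (leb (cube 0 (`|M| + 1)))); last by rewrite lebesgue_cube // ltry.
apply: le_measure; [exact: mem_set|by apply: mem_set; exact: measurable_cube|].
move=> y Oy; apply/cube_normP => //; rewrite subr0; apply: MP => //.
by rewrite (le_lt_trans (ler_norm M)) // ltrDl.
Qed.

Lemma measurable_Ppoly_Finv r f T : Ppoly r f -> measurable_fun (cell T) (fun y => f (Finv T y)).
Proof.
move=> /Ppoly_fpol[s _ fE].
rewrite (_ : (fun _ => _) = fun y => feval s (Finv T y)); last by apply/funext => y; rewrite fE.
apply: measurable_sum => p; apply: measurable_funM => //.
apply: measurable_prod => i _; apply: measurable_funX; exact: measurable_Finv (rT T) i.
Qed.

Lemma phi_patch T (k : {ffun 'I_d -> 'I_(pdeg T)}) :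
  phi (zeta (nd k)) = (fun y => phih T k (Finv T y)) \_ (cell T).
Proof.
apply/funext => y; rewrite phi_node patchE indicE.
by case: ifP; rewrite ?mul1r ?mul0r.
Qed.

Lemma measurable_phi i : measurable_fun setT (phi i).
Proof.
have [T [k ->]] := node_of i; rewrite phi_patch.
have [H _] := measurable_restrictT (fun y => phih T k (Finv T y)) (measurable_cell (rT T)).
by apply: H; exact: measurable_Ppoly_Finv (@hphih T k).1.
Qed.

Lemma phi_bounded i : exists2 C, 0 <= C & forall y, `|phi i y| <= C.
Proof.
have [T [k ->]] := node_of i; have [C C0 CP] := bounded_lip_Ppoly 1 (@hphih T k).1.
exists C => // y; rewrite phi_patch patchE; case: ifP => [|_]; last by rewrite normr0.
move=> /set_mem Ty; have y1 := (That_norm _).1 (Finv_That (rT T) Ty).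
by have [] := CP _ _ y1 y1.
Qed.

Lemma L2_phi i : L2 Omega (phi i).
Proof.
have mp : measurable_fun Omega (phi i) by apply: measurable_funTS; exact: measurable_phi.
split => //; apply: measurable_bounded_integrable => //; first exact: lebesgue_Omega_fin.
  exact: measurable_funX.
have [C C0 CP] := phi_bounded i; exists (C ^+ 2); split; first exact: num_real.
move=> M CM y _ /=; rewrite normrX (le_trans _ (ltW CM)) // ler_pXn2r ?nnegrE //.
Qed.

Lemma L2_vphi j : L2 Omega (vphi j).
Proof. by case: hvphi => H _; case: (H j). Qed.

(** The number [D_i]. *)
Definition dmass i : R := inner Omega (phi i) (cst 1).

Lemma Ppoly0_cst (f : 'rV[R]_d -> R) u v : Ppoly 0 f -> f u = f v.
Proof.
move=> /Ppoly_fpol[s s0 fE]; rewrite !fE /feval big_seq [RHS]big_seq.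
apply: eq_bigr => p ps; congr (_ * _); apply: eq_bigr => i _.
have /forallP/(_ i) := allP s0 _ ps.
by rewrite leqn0 => /eqP ->; rewrite !expr0.
Qed.

Lemma dmass_integral T (k : {ffun 'I_d -> 'I_(pdeg T)}) :
  dmass (zeta (nd k)) = \int[leb]_(y in Omega `&` cell T) phih T k (Finv T y).
Proof.
rewrite /dmass /inner Rintegral_mkcondr; apply: eq_Rintegral => y _.
by rewrite mulr1 phi_patch.
Qed.

Lemma measurable_Omega_cell T : measurable (Omega `&` cell T).
Proof. by apply: measurableI => //; exact: measurable_cell (rT T). Qed.

Lemma open_cell_Omega_cell T : open_cell T `<=` Omega `&` cell T.
Proof. by move=> y yT; split; [exact: open_cell_Omega yT|exact: open_cell_sub yT]. Qed.

(** The part of a cell outside of [open_cell] is a null set. *)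
Lemma lebesgue_Omega_cell T : leb (Omega `&` cell T) = leb (cell T).
Proof.
have mc := measurable_cell (rT T); have mi := measurable_Omega_cell T.
have mo := open_measurable_rV (open_cell_open d0 (rT T)).
apply/eqP; rewrite eq_le; apply/andP; split.
  by apply: le_measure; [exact: mem_set|exact: mem_set|exact: subIsetr].
have -> : leb (cell T) = (leb (open_cell T) + leb (cell T `\` open_cell T))%E.
  rewrite -measureU //; [|exact: measurableD|exact: setDIK].
  by rewrite setDUK //; exact: open_cell_sub.
rewrite (lebesgue_cell_diff d0 (rT T)) adde0.
by apply: le_measure; [exact: mem_set|exact: mem_set|exact: open_cell_Omega_cell].
Qed.

(** The integrals of the nodal basis are the weights of [quadrature]: the Gauss
    rule with [p] nodes is exact in degree [2 p - 1], while the Lagrange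
    polynomials times the Jacobian determinant have degree at most [p + 1]. *)
Lemma dmassE T (k : {ffun 'I_d -> 'I_(pdeg T)}) : dmass (zeta (nd k)) =
  if pdeg T == 1%N then fine (leb (cell T)) else
  tensor_weight (@x (pdeg T)) k * `|\det ('J (Fmap T) (gp k))|.
Proof.
rewrite dmass_integral; have [kP kE] := @hphih T k.
have sum_nodal (w : {ffun 'I_d -> 'I_(pdeg T)} -> R) : \sum_l w l * phih T k (gp l) = w k.
  rewrite (bigD1 k) //= [X in _ + X]big1 => [|l lk].
    by rewrite [phih T k _]kE eqxx mulr1 addr0.
  by rewrite [phih T k _]kE eq_sym (negbTE lk) mulr0.
case: eqP => p1.
  have kP0 : Ppoly 0 (phih T k) by have := kP; rewrite p1.
  rewrite (eq_Rintegral _ (g := fun=> 1)) => [|y _].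
    rewrite Rintegral_cst; last exact: measurable_Omega_cell.
    by rewrite mul1r; congr fine; exact: lebesgue_Omega_cell.
  by rewrite (Ppoly0_cst _ (gp k) kP0) kE eqxx.
rewrite (integral_element d0 (rT T) (hx _) (pdeg_gt0 T) kP).
- exact: sum_nodal.
- move: (pdeg_gt0 T) p1 dpred_le2; move: (pdeg T) (d.-1) => [|[|p]] e // _ _ e2.
  by rewrite addSn /= leq_add2l (leq_trans e2).
- exact: measurable_Omega_cell.
- exact: open_cell_Omega_cell.
- exact: subIsetr.
Qed.

Lemma dmass_gt0 i : 0 < dmass i.
Proof.
have [T [k ->]] := node_of i; rewrite dmassE; case: eqP => p1.
  have mc := measurable_cell (rT T).
  apply: fine_gt0; rewrite (lebesgue_cell_fin d0 (rT T)) // andbT.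
  apply: lt_le_trans (lebesgue_open_cell_gt0 d0 (rT T)) _.
  apply: le_measure; [|exact: mem_set|exact: open_cell_sub].
  by apply: mem_set; exact: open_measurable_rV (open_cell_open d0 (rT T)).
rewrite mulr_gt0 ?tensor_weight_gt0 // normr_gt0 -unitfE -unitmxE.
case: (rT T) => _ _ _ H; case: (H (gp k)) => //; exact: gauss_point_That.
Qed.

Lemma sigma_coefE i : sigma_coef Omega sigma_y phi i = sigma_y.
Proof.
rewrite /sigma_coef -/(dmass i).
have -> : inner Omega (cst sigma_y) (phi i) = sigma_y * dmass i.
  rewrite /inner RintegralZl //.
    by congr (_ * _); apply: eq_Rintegral => y _; rewrite mulr1.
  have [mp _] := L2_phi i; have [C C0 CP] := phi_bounded i.
  apply: measurable_bounded_integrable => //; first exact: lebesgue_Omega_fin.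
  by exists C; split=> [|M CM y _ /=]; [exact: num_real|exact: le_trans (CP y) (ltW CM)].
by rewrite mulrC mulfK // gt_eqF // dmass_gt0.
Qed.

Lemma gp_That T (k : {ffun 'I_d -> 'I_(pdeg T)}) : That (gp k).
Proof. exact: gauss_point_That. Qed.

Definition hp_poly q T : 'rV[R]_d -> 'M[R]_d :=
  xget (fun=> 0) [set P | Ppoly_mx (pdeg T).-1 P /\ pullback T q P].

Lemma hp_polyP q T : Q_hp Th Omega q ->
  Ppoly_mx (pdeg T).-1 (hp_poly q T) /\ pullback T q (hp_poly q T).
Proof. by move=> [_ /(_ T) H]; exact: (xgetPex (fun=> 0) H). Qed.

Lemma nodal_values q : exists c : 'I_(ndof Th) -> 'M[R]_d,
  forall T (k : {ffun 'I_d -> 'I_(pdeg T)}), c (zeta (nd k)) = hp_poly q T (gp k).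
Proof. exact: (node_fun (fun T k => hp_poly q T (gp k))). Qed.

(** For [p = 1] the quadrature evaluates at the centre of the element instead of a
    Gauss node, which is immaterial for constants. *)
Lemma psi_hpE q (c : 'I_(ndof Th) -> 'M[R]_d) : Q_hp Th Omega q ->
  (forall T (k : {ffun 'I_d -> 'I_(pdeg T)}), c (zeta (nd k)) = hp_poly q T (gp k)) ->
  psi_hp Th (@x) sigma_y q = \sum_i dmass i * (sigma_y * frobn (c i)).
Proof.
move=> Qq cE; rewrite sum_node; apply: eq_bigr => T _; rewrite /quadrature.
have repE u : That u -> hp_rep q T (Fmap T u) = hp_poly q T u.
  by move=> uT; rewrite /hp_rep (Finv_Fmap (rT T) uT).
have T0 : That (0 : 'rV[R]_d) by apply/That_norm; rewrite normr0 ler01.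
case: eqP => p1; last first.
  by apply: eq_bigr => k _; rewrite dmassE (introF eqP p1) repE ?cE //; exact: gp_That.
have [PP _] := hp_polyP T Qq.
have cst (k : {ffun 'I_d -> 'I_(pdeg T)}) : dmass (zeta (nd k)) * (sigma_y * frobn (c (zeta (nd k)))) =
    fine (leb (cell T)) * (sigma_y * frobn (hp_poly q T 0)).
  rewrite dmassE (introT eqP p1) /= cE; congr (_ * (_ * frobn _)); apply/matrixP => a b; have := PP a b; rewrite p1 => PP0.
  exact: Ppoly0_cst PP0.
rewrite repE // (eq_bigr _ (fun k _ => cst k)) sumr_const card_ffun !card_ord p1 exp1n.
by [].
Qed.

(** * The duality pairing in coordinates *)

(** Biorthogonality makes the double sum diagonal. *)
Lemma inner_coord (a b : 'I_(ndof Th) -> R) :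
  \int[leb]_(y in Omega) ((\sum_i phi i y * a i) * (\sum_j vphi j y * b j)) =
  \sum_i dmass i * (a i * b i).
Proof.
pose h (p : 'I_(ndof Th) * 'I_(ndof Th)) y := phi p.1 y * vphi p.2 y.
have hI p : leb.-integrable Omega (EFin \o h p).
  by apply: L2_mul_integrable => //; [exact: L2_phi|exact: L2_vphi].
rewrite (eq_Rintegral _ (g := fun y => \sum_p (a p.1 * b p.2) * h p y)) => [|y _]; last first.
  rewrite mulr_suml; under eq_bigr do rewrite mulr_sumr.
  rewrite pair_bigA /=.
  by apply: eq_bigr => -[i j] _ /=; rewrite /h /=; ring.
rewrite (Rintegral_sum mO _ _ hI) -(pair_bigA _ (fun i j => a i * b j * \int[leb]_(y in Omega) h (i, j) y)) /=.
apply: eq_bigr => i _; case: hvphi => _ bi.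
have biE j : \int[leb]_(y in Omega) h (i, j) y = (i == j)%:R * dmass i by exact: bi.
rewrite (bigD1 i) //= big1 => [|j ji]; first by rewrite biE eqxx mul1r addr0; ring.
by rewrite biE eq_sym (negbTE ji) mul0r mulr0.
Qed.

Lemma measurable_phi_sum (a : 'I_(ndof Th) -> R) :
  measurable_fun Omega (fun y => \sum_i phi i y * a i).
Proof.
apply: measurable_sum => i; apply: measurable_funM => //.
by have [] := L2_phi i.
Qed.

Lemma measurable_vphi_sum (b : 'I_(ndof Th) -> R) :
  measurable_fun Omega (fun y => \sum_j vphi j y * b j).
Proof.
apply: measurable_sum => j; apply: measurable_funM => //.
by have [] := L2_vphi j.
Qed.

(** Pair the vanishing combination with the dual basis. *)
Lemma phi_free (a : 'I_(ndof Th) -> R) :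
  {ae leb, forall y, Omega y -> \sum_i phi i y * a i = 0} -> forall i, a i = 0.
Proof.
move=> a0 i; pose b j : R := (j == i)%:R.
have := inner_coord a b; rewrite (Rintegral_ae mO (g := fun=> 0)).
- rewrite Rintegral_cst // mul0r (bigD1 i) //= big1 ?addr0 => [|j ji].
    by rewrite /b eqxx mulr1 => /esym/eqP; rewrite mulf_eq0 gt_eqF ?dmass_gt0 // => /eqP.
  by rewrite /b (negbTE ji) !mulr0.
- by apply: measurable_funM; [exact: measurable_phi_sum|exact: measurable_vphi_sum].
- exact: measurable_cst.
by apply: ae_sub a0 => y a0 Oy; rewrite a0 // mul0r.
Qed.

Lemma vphi_free (b : 'I_(ndof Th) -> R) :
  {ae leb, forall y, Omega y -> \sum_j vphi j y * b j = 0} -> forall j, b j = 0.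
Proof.
move=> b0 i; pose a j : R := (j == i)%:R.
have := inner_coord a b; rewrite (Rintegral_ae mO (g := fun=> 0)).
- rewrite Rintegral_cst // mul0r (bigD1 i) //= big1 ?addr0 => [|j ji].
    by rewrite /a eqxx mul1r => /esym/eqP; rewrite mulf_eq0 gt_eqF ?dmass_gt0 // => /eqP.
  by rewrite /a (negbTE ji) !mul0r mulr0.
- by apply: measurable_funM; [exact: measurable_phi_sum|exact: measurable_vphi_sum].
- exact: measurable_cst.
by apply: ae_sub b0 => y b0 Oy; rewrite b0 // mulr0.
Qed.

Lemma sum_scaler_entry (b : 'I_(ndof Th) -> 'rV[R]_d -> R) (c : 'I_(ndof Th) -> 'M[R]_d) y r s :
  (\sum_i b i y *: c i) r s = \sum_i b i y * c i r s.
Proof. by rewrite summxE; apply: eq_bigr => i _; rewrite mxE. Qed.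

Lemma inner_mx_coord (mu q : 'rV[R]_d -> 'M[R]_d) (m c : 'I_(ndof Th) -> 'M[R]_d) :
  (forall r s, measurable_fun Omega (fun y => mu y r s)) ->
  (forall r s, measurable_fun Omega (fun y => q y r s)) ->
  represents Omega vphi m mu -> represents Omega phi c q ->
  inner_mx Omega mu q = \sum_i dmass i * frob (m i) (c i).
Proof.
move=> mmu mq rmu rq.
pose h (p : 'I_d * 'I_d) y : R :=
  (\sum_i phi i y * c i p.1 p.2) * (\sum_j vphi j y * m j p.1 p.2).
have frobE (A B : 'M[R]_d) : frob A B = \sum_(p : 'I_d * 'I_d) A p.1 p.2 * B p.1 p.2.
  by rewrite /frob pair_bigA.
have L2phis p : L2 Omega (fun y => \sum_i phi i y * c i p.1 p.2).
  apply: (L2_sum mO) => i; rewrite (_ : (fun _ => _) = fun y => c i p.1 p.2 * phi i y).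
    by apply: L2_scale => //; exact: L2_phi.
  by apply/funext => y; rewrite mulrC.
have L2vphis p : L2 Omega (fun y => \sum_j vphi j y * m j p.1 p.2).
  apply: (L2_sum mO) => j; rewrite (_ : (fun _ => _) = fun y => m j p.1 p.2 * vphi j y).
    by apply: L2_scale => //; exact: L2_vphi.
  by apply/funext => y; rewrite mulrC.
have hI p : leb.-integrable Omega (EFin \o h p) by exact: L2_mul_integrable.
rewrite /inner_mx (Rintegral_ae mO (g := fun y => \sum_p 1 * h p y)).
- rewrite (Rintegral_sum mO _ _ hI).
  under eq_bigr => p _ do rewrite mul1r inner_coord.
  rewrite exchange_big /=; apply: eq_bigr => i _; rewrite -mulr_sumr frobE.
  by congr (_ * _); apply: eq_bigr => p _; rewrite mulrC.
- rewrite (_ : (fun _ => _) = fun y => \sum_(p : 'I_d * 'I_d) mu y p.1 p.2 * q y p.1 p.2).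
    by apply: measurable_sum => p; exact: measurable_funM.
  by apply/funext => y; rewrite frobE.
- apply: measurable_sum => p; apply: measurable_funM => //; apply: measurable_funM.
    exact: measurable_phi_sum.
  exact: measurable_vphi_sum.
move: rmu rq; apply: filterS2 => y rmu rq Oy.
rewrite frobE rmu // rq //; apply: eq_bigr => p _.
by rewrite !sum_scaler_entry mul1r mulrC.
Qed.

(** * The biorthogonal functions form a basis *)

Lemma vphi_phi : exists B : 'M[R]_(ndof Th), forall j,
  {ae leb, forall y, Omega y -> vphi j y = \sum_i phi i y * B j i}.
Proof.
have H j : exists b : 'I_(ndof Th) -> R,
    {ae leb, forall y, Omega y -> vphi j y = \sum_i phi i y * b i}.
  case: hvphi => /(_ j) [_ hp] _; have /choice[P PP] := hp.
  have [b bE] := node_fun (fun T k => P T (gp k)).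
  by exists b; apply: (hp_expand _ _ bE) => T; case: (PP T).
have /choice[b bP] := H; exists (\matrix_(j, i) b j i) => j.
by apply: ae_sub (bP j) => y yE Oy; rewrite yE //; apply: eq_bigr => i _; rewrite mxE.
Qed.

(** The matrix expressing the [vphi] by the [phi] is square, and its rows are
    independent because the [vphi] are; its inverse gives the converse expansion. *)
Lemma phi_vphi : exists C : 'M[R]_(ndof Th), forall i,
  {ae leb, forall y, Omega y -> phi i y = \sum_j vphi j y * C i j}.
Proof.
have [B BP] := vphi_phi.
have ae_B : {ae leb, forall y, forall j, Omega y -> vphi j y = \sum_i phi i y * B j i}.
  exact: filter_forall.
have Bu : B \in unitmx.
  rewrite -row_free_unit; apply: inj_row_free => v vB.
  suff v0 : forall j, v 0 j = 0 by apply/rowP => j; rewrite v0 mxE.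
  apply: vphi_free; apply: ae_sub ae_B => y yB Oy.
  under eq_bigr => j _ do rewrite yB // mulr_suml.
  rewrite exchange_big /= big1 // => i _.
  have := congr1 (fun w : 'rV[R]_(ndof Th) => w 0 i) vB; rewrite !mxE => vBi.
  transitivity (phi i y * \sum_j v 0 j * B j i); last by rewrite vBi mulr0.
  by rewrite mulr_sumr; apply: eq_bigr => j _; ring.
exists (invmx B) => i; apply: ae_sub ae_B => y yB Oy.
under eq_bigr => j _ do rewrite yB // mulr_suml.
rewrite exchange_big /= (bigD1 i) //= [X in _ + X]big1 ?addr0 => [|k ki].
  transitivity (phi i y * (invmx B *m B) i i); first by rewrite mulVmx // mxE eqxx mulr1.
  by rewrite mxE mulr_sumr; apply: eq_bigr => j _; ring.
transitivity (phi k y * (invmx B *m B) i k).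
  by rewrite mxE mulr_sumr; apply: eq_bigr => j _; ring.
by rewrite mulVmx // mxE eq_sym (negbTE ki) mulr0.
Qed.

Lemma sym0_sum (I : finType) (a : I -> R) (A : I -> 'M[R]_d) :
  (forall i, sym0 (A i)) -> sym0 (\sum_i a i *: A i).
Proof.
move=> sA; split.
  by rewrite linear_sum; apply: eq_bigr => i _; rewrite linearZ /= (sA i).1.
by rewrite linear_sum big1 // => i _; rewrite linearZ /= (sA i).2 mulr0.
Qed.

(** Symmetry and vanishing trace are linear conditions, so they pass to the
    coefficients with respect to a free family. *)
Lemma sym0_coef (b : 'I_(ndof Th) -> 'rV[R]_d -> R) q (c : 'I_(ndof Th) -> 'M[R]_d) :
  (forall a : 'I_(ndof Th) -> R,
     {ae leb, forall y, Omega y -> \sum_i b i y * a i = 0} -> forall i, a i = 0) ->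
  {ae leb, forall y, Omega y -> sym0 (q y)} -> represents Omega b c q ->
  forall i, sym0 (c i).
Proof.
move=> bfree sq rq i; split.
  apply/matrixP => r s; rewrite mxE; apply/eqP; rewrite -subr_eq0; apply/eqP.
  apply: (bfree (fun i => c i s r - c i r s)); move: sq rq; apply: filterS2 => y sq rq Oy.
  under eq_bigr do rewrite mulrBr; rewrite sumrB -!sum_scaler_entry -rq //.
  by rewrite -[in X in X - _](sq Oy).1 mxE subrr.
apply: (bfree (fun i => \tr (c i))); move: sq rq; apply: filterS2 => y sq rq Oy.
rewrite -[RHS](sq Oy).2 rq // linear_sum; apply: eq_bigr => j _.
by rewrite linearZ.
Qed.

Lemma represents_unique b q (c c' : 'I_(ndof Th) -> 'M[R]_d) :
  (forall a : 'I_(ndof Th) -> R,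
     {ae leb, forall y, Omega y -> \sum_i b i y * a i = 0} -> forall i, a i = 0) ->
  represents Omega b c q -> represents Omega b c' q -> forall i, c i = c' i.
Proof.
move=> bfree rc rc' i; apply/matrixP => r s; apply/eqP; rewrite -subr_eq0; apply/eqP.
apply: (bfree (fun i => c i r s - c' i r s)); move: rc rc'; apply: filterS2 => y rc rc' Oy.
under eq_bigr do rewrite mulrBr.
by rewrite sumrB -!sum_scaler_entry -rc // -rc' // subrr.
Qed.

Lemma Q_hp_measurable q : Q_space Omega q -> forall r s, measurable_fun Omega (fun y => q y r s).
Proof. by move=> [H _] r s; case: (H r s). Qed.

(** The coefficients are nodal values of the polynomial representative of [q] on each
    element, the same values that enter [psi_hp]. *)
Lemma Q_hp_phi q : Q_hp Th Omega q -> exists c : 'I_(ndof Th) -> 'M[R]_d,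
  [/\ represents Omega phi c q, forall i, sym0 (c i) &
   psi_hp Th (@x) sigma_y q = \sum_i dmass i * (sigma_y * frobn (c i))].
Proof.
move=> Qq; have [c cE] := nodal_values q.
have rc : represents Omega phi c q.
  by apply: hp_expand_mx cE => T; case: (hp_polyP T Qq).
exists c; split => //; last exact: psi_hpE.
exact: (sym0_coef phi_free Qq.1.2 rc).
Qed.

Lemma Q_hp_vphi q : Q_hp Th Omega q -> exists2 m : 'I_(ndof Th) -> 'M[R]_d,
  represents Omega vphi m q & forall i, sym0 (m i).
Proof.
move=> /Q_hp_phi[c [rc sc _]]; have [C CP] := phi_vphi.
exists (fun j => \sum_i C i j *: c i); last by move=> j; exact: sym0_sum.
have ae_C : {ae leb, forall y, forall i, Omega y -> phi i y = \sum_j vphi j y * C i j}.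
  exact: filter_forall.
move: rc ae_C; apply: filterS2 => y rc yC Oy; rewrite rc //.
under eq_bigr => i _ do rewrite yC // scaler_suml.
rewrite exchange_big /=; apply: eq_bigr => j _.
by rewrite scaler_sumr; apply: eq_bigr => i _; rewrite scalerA.
Qed.

Lemma Q_space_sum (b : 'I_(ndof Th) -> 'rV[R]_d -> R) (c : 'I_(ndof Th) -> 'M[R]_d) :
  (forall i, L2 Omega (b i)) -> (forall i, sym0 (c i)) ->
  Q_space Omega (fun y => \sum_i b i y *: c i).
Proof.
move=> Lb sc; split; last by apply: aeW => y _; exact: sym0_sum.
move=> r s; rewrite (_ : (fun _ => _) = fun y => \sum_i c i r s * b i y).
  by apply: (L2_sum mO) => i; exact: L2_scale.
by apply/funext => y; rewrite sum_scaler_entry; apply: eq_bigr => i _; rewrite mulrC.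
Qed.

Lemma represents_sum (b : 'I_(ndof Th) -> 'rV[R]_d -> R) (c : 'I_(ndof Th) -> 'M[R]_d) :
  represents Omega b c (fun y => \sum_i b i y *: c i).
Proof. exact: aeW. Qed.

Lemma phi_sum_Q_hp (c : 'I_(ndof Th) -> 'M[R]_d) : (forall i, sym0 (c i)) ->
  Q_hp Th Omega (fun y => \sum_i phi i y *: c i).
Proof.
move=> sc; split; first by apply: Q_space_sum => // i; exact: L2_phi.
move=> T; exists (fun u => \sum_(k : {ffun 'I_d -> 'I_(pdeg T)}) phih T k u *: c (zeta (nd k))).
split; last exact: pullback_phi_sum.
by apply: Ppoly_mx_sum => k; exact: (@hphih T k).1.
Qed.

Lemma vphi_repr_Q_hp mu (m : 'I_(ndof Th) -> 'M[R]_d) :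
  Q_space Omega mu -> represents Omega vphi m mu -> Q_hp Th Omega mu.
Proof.
move=> Qmu rmu; split => // T.
have /choice[P PP] : forall j, exists P, Ppoly (pdeg T).-1 P /\ pullback T (vphi j) P.
  by move=> j; case: hvphi => /(_ j) [_ /(_ T)].
exists (fun u => \sum_j P j u *: m j); split.
  by apply: Ppoly_mx_sum => j; case: (PP j).
have ae_P : {ae leb, forall y, forall j, cell T y -> vphi j y = P j (Finv T y)}.
  by apply: filter_forall => j; case: (PP j).
have ae_PO : {ae leb, forall y, regular_point y /\ forall j, cell T y -> vphi j y = P j (Finv T y)}.
  by move: ae_regular ae_P; apply: filterS2.
move: ae_PO rmu; apply: filterS2 => y [ry yP] rmu Ty.
rewrite rmu; last exact: open_cell_Omega (ry _ Ty).
by apply: eq_bigr => j _; rewrite yP.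
Qed.

(** * The admissible set and the complementarity condition *)

Lemma pairing_le_psi (m c : 'I_(ndof Th) -> 'M[R]_d) :
  (forall i, frobn (m i) <= sigma_y) ->
  \sum_i dmass i * frob (m i) (c i) <= \sum_i dmass i * (sigma_y * frobn (c i)).
Proof.
move=> ms; apply: ler_sum => i _; rewrite ler_wpM2l ?(ltW (dmass_gt0 i)) //.
by rewrite (le_trans (frob_CauchySchwarz _ _)) // ler_wpM2r ?frobn_ge0.
Qed.

(** Test the defining inequality with [q = phi_i m_i]. *)
Lemma Lambda_w_bound mu (m : 'I_(ndof Th) -> 'M[R]_d) : 0 < sigma_y ->
  Lambda_w Th Omega (@x) sigma_y mu -> represents Omega vphi m mu ->
  forall i, frobn (m i) <= sigma_y.
Proof.
move=> s0 [Qmu mule] rmu i; have sm := sym0_coef vphi_free Qmu.1.2 rmu.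
pose c j : 'M[R]_d := if j == i then m i else 0.
have sc j : sym0 (c j).
  rewrite /c; case: eqP => _ //; split; first by rewrite trmx0.
  by rewrite linear0.
have Qq := phi_sum_Q_hp sc; have := mule _ Qq.
have [c' [rc' _ ->]] := Q_hp_phi Qq.
have cc' := represents_unique phi_free rc' (represents_sum phi c).
rewrite (inner_mx_coord (Q_hp_measurable Qmu.1) (Q_hp_measurable Qq.1) rmu (represents_sum phi c)).
have single (f : 'I_(ndof Th) -> R) : (forall j, j != i -> f j = 0) -> \sum_j f j = f i.
  by move=> f0; rewrite (bigD1 i) //= big1 ?addr0.
rewrite !single => [|j ji|j ji]; last 2 first.
- by rewrite cc' /c (negbTE ji) frobn0 !mulr0.
- by rewrite /c (negbTE ji) frobC -(scale0r 0) frobZl mul0r mulr0.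
rewrite cc' /c eqxx ler_pM2l ?dmass_gt0 // -frobn_sqr expr2.
have [->|m0] := eqVneq (frobn (m i)) 0; first by move=> _; rewrite ltW.
by rewrite ler_pM2r // lt0r m0 frobn_ge0.
Qed.

Lemma vphi_repr_Lambda_w mu (m : 'I_(ndof Th) -> 'M[R]_d) :
  Q_space Omega mu -> represents Omega vphi m mu -> (forall i, frobn (m i) <= sigma_y) ->
  Lambda_w Th Omega (@x) sigma_y mu.
Proof.
move=> Qmu rmu ms; have Qhp := vphi_repr_Q_hp Qmu rmu; split => // q Qq.
have [c [rc _ ->]] := Q_hp_phi Qq.
rewrite (inner_mx_coord (Q_hp_measurable Qmu) (Q_hp_measurable Qq.1) rmu rc).
exact: pairing_le_psi.
Qed.

Lemma Lambda_w_eq : 0 < sigma_y -> Lambda_w Th Omega (@x) sigma_y =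
  [set mu | Q_space Omega mu /\ exists m : 'I_(ndof Th) -> 'M[R]_d,
     (forall i, sym0 (m i) /\ frobn (m i) <= sigma_coef Omega sigma_y phi i) /\
     represents Omega vphi m mu].
Proof.
move=> s0; apply/seteqP; split=> [mu Lmu|mu [Qmu [m [ms rmu]]]].
  have [m rmu sm] := Q_hp_vphi Lmu.1; split; first exact: Lmu.1.1.
  exists m; split => // i; split; first exact: sm.
  by rewrite sigma_coefE (Lambda_w_bound s0 Lmu rmu).
apply: vphi_repr_Lambda_w rmu _ => // i.
by have [_] := ms i; rewrite sigma_coefE.
Qed.

(** Both sides of the equivalence compare [\sum_i D_i lam_i : pc_i] with its upper
    bound [\sum_i D_i sigma_y |pc_i|], which is attained on the admissible set. *)
Lemma complementarity lambda p (lam pc : 'I_(ndof Th) -> 'M[R]_d) : 0 < sigma_y ->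
  Lambda_w Th Omega (@x) sigma_y lambda -> Q_hp Th Omega p ->
  (forall i, sym0 (lam i)) -> (forall i, sym0 (pc i)) ->
  represents Omega vphi lam lambda -> represents Omega phi pc p ->
  ((forall mu, Lambda_w Th Omega (@x) sigma_y mu ->
      inner_mx Omega (fun y => mu y - lambda y) p <= 0) <->
   (forall i, frob (lam i) (pc i) = sigma_coef Omega sigma_y phi i * frobn (pc i))).
Proof.
move=> s0 Ll Qp sl sp rl rp; have lams := Lambda_w_bound s0 Ll rl.
have pairE mu (m : 'I_(ndof Th) -> 'M[R]_d) : Q_space Omega mu -> represents Omega vphi m mu ->
    inner_mx Omega (fun y => mu y - lambda y) p =
    \sum_i dmass i * frob (m i) (pc i) - \sum_i dmass i * frob (lam i) (pc i).
  move=> Qmu rmu.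
  rewrite (@inner_mx_coord _ _ (fun i => m i - lam i) pc) //.
  - by rewrite -sumrB; apply: eq_bigr => i _; rewrite frobBl mulrBr.
  - move=> r s; rewrite (_ : (fun _ => _) = fun y => mu y r s - lambda y r s).
      apply: measurable_funB; first exact: Q_hp_measurable Qmu r s.
      exact: Q_hp_measurable Ll.1.1 r s.
    by apply/funext => y; rewrite !mxE.
  - exact: Q_hp_measurable Qp.1.
  move: rmu rl; apply: filterS2 => y rmu rl Oy; rewrite rmu // rl // -sumrB.
  by apply: eq_bigr => i _; rewrite scalerBr.
split=> [H i|H mu Lmu]; last first.
  have [m rmu sm] := Q_hp_vphi Lmu.1.
  rewrite (pairE _ _ Lmu.1.1 rmu) subr_le0.
  apply: le_trans (pairing_le_psi pc (Lambda_w_bound s0 Lmu rmu)) _.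
  by apply: ler_sum => i _; rewrite H sigma_coefE.
rewrite sigma_coefE.
(* The pairing with [p] is maximal at the multiplier aligned with [p]. *)
pose m j := (sigma_y / frobn (pc j)) *: pc j.
have mpc j : frob (m j) (pc j) = sigma_y * frobn (pc j).
  rewrite frobZl -frobn_sqr; have [->|p0] := eqVneq (frobn (pc j)) 0.
    by rewrite expr0n !mulr0.
  by rewrite expr2 mulrA divfK.
have ms j : frobn (m j) <= sigma_y.
  rewrite frobnZ normrM normfV (ger0_norm (frobn_ge0 _)) (gtr0_norm s0).
  have [->|p0] := eqVneq (frobn (pc j)) 0; first by rewrite mulr0 ltW.
  by rewrite divfK.
have sm j : sym0 (m j).
  by split; rewrite linearZ /= ?(sp j).1 // (sp j).2 mulr0.
have Qmu : Q_space Omega (fun y => \sum_j vphi j y *: m j).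
  by apply: Q_space_sum => // j; exact: L2_vphi.
have rmu := represents_sum vphi m.
have := H _ (vphi_repr_Lambda_w Qmu rmu ms); rewrite (pairE _ _ Qmu rmu) -sumrB.
have term_ge0 j : 0 <= dmass j * frob (m j) (pc j) - dmass j * frob (lam j) (pc j).
  rewrite -mulrBr mulr_ge0 ?(ltW (dmass_gt0 j)) // subr_ge0 mpc.
  by rewrite (le_trans (frob_CauchySchwarz _ _)) // ler_wpM2r ?frobn_ge0.
move=> le0; have : \sum_j (dmass j * frob (m j) (pc j) - dmass j * frob (lam j) (pc j)) = 0.
  by apply/eqP; rewrite eq_le le0 sumr_ge0.
move=> /eqP; rewrite psumr_eq0 // => /allP /(_ i (mem_index_enum i)) /=.
rewrite -mulrBr mulf_eq0 gt_eqF ?dmass_gt0 //= subr_eq0 mpc => /eqP.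
by [].
Qed.

End bases.

Theorem theorem5 (R : realType) (d : nat) (hd : d = 2%N \/ d = 3%N)
  (Omega : set 'rV[R]_d) (hOmega : bounded_lipschitz_domain Omega)
  (sigma_y : R) (hsigma : 0 < sigma_y)
  (Th : mesh R d) (kappa : R) (hTh : fe_mesh Th kappa Omega)
  (x : forall n, 'I_n -> R) (hx : forall n, gauss_nodes (x n))
  (phih : forall T : elt Th, {ffun 'I_d -> 'I_(pdeg T)} -> 'rV[R]_d -> R)
  (hphih : forall T, lagrange_basis (x (pdeg T)) (phih T))
  (zeta : node Th -> 'I_(ndof Th)) (hzeta : bijective zeta)
  (phi vphi : 'I_(ndof Th) -> 'rV[R]_d -> R)
  (hphi : nodal_basis phih zeta phi)
  (hvphi : biorthogonal_basis Omega phi vphi) :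
  Lambda_w Th Omega x sigma_y =
    [set mu | Q_space Omega mu /\
       exists m : 'I_(ndof Th) -> 'M[R]_d,
         (forall i, sym0 (m i) /\
            frobn (m i) <= sigma_coef Omega sigma_y phi i) /\
         represents Omega vphi m mu]
  /\
  forall (lambda p : 'rV[R]_d -> 'M[R]_d) (lam pc : 'I_(ndof Th) -> 'M[R]_d),
    Lambda_w Th Omega x sigma_y lambda -> Q_hp Th Omega p ->
    (forall i, sym0 (lam i)) -> (forall i, sym0 (pc i)) ->
    represents Omega vphi lam lambda -> represents Omega phi pc p ->
    ((forall mu, Lambda_w Th Omega x sigma_y mu ->
        inner_mx Omega (fun y => mu y - lambda y) p <= 0)
     <->
     (forall i, frob (lam i) (pc i) =
        sigma_coef Omega sigma_y phi i * frobn (pc i))).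

Proof.
split; first exact: (@Lambda_w_eq _ _ _ _ _ kappa _ phih zeta phi vphi).
move=> lambda p lam pc; exact: (@complementarity _ _ _ _ _ kappa _ phih zeta phi vphi).
Qed.
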